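(* Let $\pi=1\pi'$ with $\pi'$ dominant, and let $m$ be the number of vertices of $T(\pi)$. Let $v$ be the unique vertex of $\mathcal{C}(\pi)$ on the ray from $0$ through $e_1-e_m$. If $\pi\neq 1\,m\,(m-1)\cdots 2$, then $v$ is in the boundary of $\mathcal{C}(\pi)$, and $\mathrm{core}(\pi)$ is geometrically realized by the induced triangulation of the vertex figure of $\mathcal{C}(\pi)$ at $v$. If $\pi=1\,m\,(m-1)\cdots 2$, then $\mathrm{core}(\pi)$ is geometrically realized by the induced triangulation of the boundary of $\mathcal{C}(\pi)$.
   Context: Permutations and diagrams. A permutation $\pi\in S_n$ is written in one-line notation $\pi_1\cdots\pi_n$; permutations differing only by trailing fixed points are identified ($S_n\subset S_{n+1}$). Positions in the $n\times n$ grid are (row, column), rows numbered top to bottom and columns left to right. The diagram of $\pi$ is $D(\pi)=\{(\pi_j,i): i<j,\ \pi_i>\pi_j\}$. $\pi=1\pi'$ with $\pi'$ dominant means $\pi_1=1$ and $\pi'=\pi_2\cdots\pi_n$ is a $132$-avoiding permutation of $\{2,\ldots,n\}$; equivalently $D(\pi)$ is the Young diagram of a partition whose north-west most box is at $(2,2)$. Pipe dreams. A pipe dream for $\pi$ is a tiling of the $n\times n$ grid by crosses (two strands cross straight) and elbows (one strand joins the left edge to the top edge, another joins the bottom edge to the right edge) such that all tiles at $(a,b)$ with $a+b\ge n+1$ are elbows, and if the strands entering from the left in rows $1,\ldots,n$ are labelled $1,\ldots,n$ and followed (ignoring second crossings among the same strands), they exit at the top reading $\pi_1,\ldots,\pi_n$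 from left to right. It is reduced if no two strands cross twice. $PD(\pi)$ is the simplicial complex with vertices the entries $(a,b)$, $a+b\le n$, and facets the sets of elbow positions (in this triangle) of reduced pipe dreams for $\pi$. Let $\mathrm{cone}(\pi)$ be the set of vertices lying in all facets of $PD(\pi)$; $\mathrm{core}(\pi)$ is the restriction of $PD(\pi)$ to the vertices not in $\mathrm{cone}(\pi)$. The region $R(\pi)$. The bottom reduced pipe dream of $\pi$ has crosses at the boxes obtained by pushing $D(\pi)$ left (left-justifying each row); the top reduced pipe dream has crosses at the boxes obtained by pushing $D(\pi)$ up. The core region $\mathrm{cr}(\pi)$ is the union of the cross positions of these two pipe dreams (it is the vertex set of $\mathrm{core}(\pi)$), and $R(\pi)=\mathrm{cr}(\pi)\cup\{(1,1)\}$. The tree $T(\pi)$. Traverse the southeast boundary of $R(\pi)$ from its SW corner to its NE corner as a sequence of east steps (E) and north steps (N). Let $A$ consist of all N steps together with those E steps such that E bounds the bottom reduced pipe dream (the box of $R(\pi)$ directly above E is a cross of it) but the N step directly preceding E (if the preceding step is an N step) does not bound it (the box directly left of that N step is not a cross of it). Label the steps of $A$ by $1,\ldots,m$ in the order traversed; an E step not in $A$ receives the label of the N step directly preceding it. Place a dot in each box of $R(\pi)$ that is an elbow in the bottom reduced pipe dream, then let the dots in each column drop south so that they occupy the lowest boxes of that column of $R(\pi)$. $T(\pi)$ is the tree on $[m]$ with an edge $(i,j)$, $i<j$, whenever there is a dot in the box in the column of the E step labelled $i$ and the row of the N step labelled $j$. Root polytopes. For an acyclic graph $G$ on $[m]$,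 with $e_i$ the standard basis of $\mathbb{R}^m$, let $\mathrm{cone}(G)$ be the cone of nonnegative combinations of $e_i-e_j$, $(i,j)\in E(G)$, $i<j$, and let $\mathcal{P}(G)$ be the convex hull of $0$ and all $e_i-e_j$, $1\le i<j\le m$, lying in $\mathrm{cone}(G)$. The directed transitive closure of $G$ adds every edge $(i,j)$ such that there is an increasing path $i<i_1<\cdots<i_k<j$ along edges of $G$. A graph is noncrossing if there are no $i<j<k<l$ with $(i,k),(j,l)$ both edges; it is alternating if at each vertex $v$ all edges go to larger vertices or all go to smaller vertices. For $G$ noncrossing and acyclic, the canonical triangulation of $\mathcal{P}(G)$ is the triangulation with top-dimensional simplices $\mathcal{P}(T_1),\ldots,\mathcal{P}(T_k)$, where $T_1,\ldots,T_k$ are the noncrossing alternating spanning trees of the directed transitive closure of $G$. All these simplices contain $0$; $\mathcal{C}(\pi)$ denotes the induced triangulation of the vertex figure of $\mathcal{P}(T(\pi))$ at $0$ (the section by a hyperplane separating $0$ from the other vertices). Its vertices correspond to the edges $(i,j)$ of the directed transitive closure of $T(\pi)$: the vertex for $(i,j)$ is the intersection of the ray through $e_i-e_j$ with that hyperplane. Boundary. The boundary of a pure simplicial complex is the subcomplex whose facets are the codimension $1$ faces lying in exactly one facet. The induced triangulation of the vertex figure of $\mathcal{C}(\pi)$ at $v$ is the one obtained by sectioning the simplices of $\mathcal{C}(\pi)$ containing $v$ near $v$; as an abstract complex it is the link of $v$ in $\mathcal{C}(\pi)$. *)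

(* Defs.v *)
From HB Require Import structures.
From mathcomp Require Import all_boot all_order all_algebra all_fingroup.
From mathcomp Require Import boolp classical_sets reals convex.

Set Implicit Arguments.
Unset Strict Implicit.
Unset Printing Implicit Defensive.

Import Order.TTheory GRing.Theory Num.Theory.

(* Everything is numbered from 0: a permutation of {1,..,n} is pi : 'S_n, the  *)
(* grid position (a, b) is (a - 1, b - 1), and the labels 1,..,m are 0,..,m-1. *)
Notation pos n := ('I_n * 'I_n)%type (only parsing).

Section Permutations.
Local Open Scope nat_scope.

(* pi = 1 pi' with pi' avoiding 132 *)
Definition one_dominant n (pi : 'S_n) : Prop :=
  (forall i : 'I_n, i = 0 :> nat -> pi i = 0 :> nat) /\
  (forall i j k : 'I_n, 0 < i -> i < j -> j < k -> ~~ (pi i < pi k < pi j)).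

(* Permutations that differ by trailing fixed points are the same function     *)
(* on nat.                                                                     *)
Definition extend n (pi : 'S_n) (i : nat) : nat :=
  if (insub i : option 'I_n) is Some j then pi j else i.

(* 1 m (m-1) ... 2 *)
Definition one_reversed (m i : nat) : nat := if 0 < i < m then m - i else i.

Definition diagram n (pi : 'S_n) : {set pos n} :=
  [set (pi e.2, e.1) | e : pos n & (e.1 < e.2) && (pi e.2 < pi e.1)]%SET.

End Permutations.

Section PipeDreams.
Local Open Scope nat_scope.
Local Open Scope set_scope.
Variable n : nat.
Implicit Types (C F G : {set pos n}) (pi : 'S_n).

Definition triangle : {set pos n} := [set p : pos n | (p.1 + p.2).+1 < n].

Definition tile (p : pos n) : nat * nat := (p.1 : nat, p.2 : nat).

Definition is_cross C (a b : nat) : bool := [exists p in C, tile p == (a, b)].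

(* Tiles visited by the strand that enters tile (a, b) by its left edge (if    *)
(* from_left) or by its bottom edge.  It leaves by the top edge if it came     *)
(* from the left into an elbow or from below into a cross, and by the right    *)
(* edge otherwise; it stops on leaving the grid at the top.                    *)
Fixpoint walk C (fuel a b : nat) (from_left : bool) : seq (nat * nat) :=
  if fuel is k.+1 then
    (a, b) :: (if from_left (+) is_cross C a b
               then if a is a'.+1 then walk C k a' b false else [::]
               else walk C k a b.+1 true)
  else [::].

(* A strand makes less than n moves up and less than n moves to the right, so  *)
(* that the fuel is never exhausted when C is contained in the triangle.       *)
Definition strand C (i : 'I_n) : seq (nat * nat) := walk C n.*2 i 0 true.

Definition exits_at C (i j : 'I_n) : bool :=
  last (i : nat, 0) (strand C i) == (0, j : nat).

Definition reduced C : bool :=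
  [forall s : 'I_n, forall t : 'I_n, (s != t) ==>
     (#|[set p in C | (tile p \in strand C s) && (tile p \in strand C t)]| <= 1)].

(* A pipe dream is given by its set of crosses.  In a reduced one there are no *)
(* second crossings to ignore when following the strands.                      *)
Definition reduced_pipe_dreams pi : {set {set pos n}} :=
  [set C : {set pos n} | [&& C \subset triangle, reduced C
                           & [forall j, exits_at C (pi j) j]]].

Definition PD_facets pi : {set {set pos n}} :=
  [set triangle :\: C | C in reduced_pipe_dreams pi].

Definition PD pi : {set {set pos n}} :=
  [set F : {set pos n} | [exists G in PD_facets pi, F \subset G]].

Definition PD_cone pi : {set pos n} :=
  [set p in triangle | [forall G in PD_facets pi, p \in G]].

Definition core pi : {set {set pos n}} :=
  [set F in PD pi | [disjoint F & PD_cone pi]].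

End PipeDreams.

Section CoreRegionAndTree.
Local Open Scope nat_scope.
Local Open Scope set_scope.
Variables (n : nat) (pi : 'S_n).

Definition bottom_pd : {set pos n} :=
  [set p : pos n | p.2 < #|[set q in diagram pi | q.1 == p.1]|].

Definition top_pd : {set pos n} :=
  [set p : pos n | p.1 < #|[set q in diagram pi | q.2 == p.2]|].

Definition core_region : {set pos n} := bottom_pd :|: top_pd.

Definition region : {set pos n} :=
  core_region :|: [set p : pos n | tile p == (0, 0)].

Definition row_length (a : nat) : nat := #|[set p in region | p.1 == a :> nat]|.
Definition col_height (b : nat) : nat := #|[set p in region | p.2 == b :> nat]|.

(* The southeast boundary from SW to NE: inl b is the E step below column b    *)
(* and inr a is the N step to the right of row a.                              *)
Definition steps : seq (nat + nat) :=
  flatten [seq inl b ::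
             [seq inr a | a <- rev (iota (col_height b.+1)
                                         (col_height b - col_height b.+1))]
          | b <- iota 0 (row_length 0)].

Definition E_bounds_bottom (b : nat) : bool :=
  is_cross bottom_pd (col_height b).-1 b.

Definition N_bounds_bottom (a : nat) : bool :=
  is_cross bottom_pd a (row_length a).-1.

Definition step_at (k : nat) : nat + nat := nth (inl 0) steps k.

Definition preceded_by_bounding_N (k : nat) : bool :=
  if k is k'.+1 then if step_at k' is inr a then N_bounds_bottom a else false
  else false.

(* The k-th step of the traversal belongs to A, i.e., starts a new label. *)
Definition in_A (k : nat) : bool :=
  match step_at k with
  | inl b => E_bounds_bottom b && ~~ preceded_by_bounding_N k
  | inr _ => true
  end.

Definition num_labels : nat := count in_A (iota 0 (size steps)).

(* The number of steps in A up to and including s, shifted to start from 0.    *)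
(* For an E step outside A this is the label of the N step just before it.     *)
Definition label (s : nat + nat) : nat :=
  (count in_A (iota 0 (index s steps).+1)).-1.

Definition num_dots (b : nat) : nat :=
  #|[set p in region :\: bottom_pd | p.2 == b :> nat]|.

Definition dropped_dots : {set pos n} :=
  [set p : pos n | col_height p.2 - num_dots p.2 <= p.1 < col_height p.2].

Definition tree_edges : {set 'I_num_labels * 'I_num_labels} :=
  [set e : 'I_num_labels * 'I_num_labels | (e.1 < e.2) &&
     [exists p in dropped_dots, (label (inl (p.2 : nat)) == e.1) &&
                                (label (inr (p.1 : nat)) == e.2)]].

End CoreRegionAndTree.

(* A graph on [m] is given by the set of its edges (i, j), i < j. *)
Section Graphs.
Local Open Scope nat_scope.
Local Open Scope set_scope.
Variable m : nat.
Implicit Types (G T : {set 'I_m * 'I_m}).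

Definition trans_closure G : {set 'I_m * 'I_m} :=
  [set e : 'I_m * 'I_m | (e.1 < e.2) &&
     connect [rel i j : 'I_m | (i < j) && ((i, j) \in G)] e.1 e.2].

Definition noncrossing T : Prop :=
  forall i j k l : 'I_m, i < j -> j < k -> k < l ->
    ~~ (((i, k) \in T) && ((j, l) \in T)).

Definition alternating T : Prop :=
  forall v : 'I_m, (forall e, e \in T -> e.2 != v) \/
                   (forall e, e \in T -> e.1 != v).

Definition adjacent T : rel 'I_m :=
  [rel i j | ((i, j) \in T) || ((j, i) \in T)].

Definition acyclic T : Prop :=
  forall s : seq 'I_m, 2 < size s -> ~ ucycle (adjacent T) s.

Definition spanning_tree G T : Prop :=
  [/\ T \subset G, acyclic T & forall i j, connect (adjacent T) i j].

Definition canonical_tree G T : Prop :=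
  [/\ noncrossing T, alternating T & spanning_tree (trans_closure G) T].

End Graphs.

Section Geometry.
Local Open Scope classical_set_scope.
Local Open Scope ring_scope.
Variables (R : realType) (m : nat).
Local Notation V := 'rV[R]_m.
Implicit Types (G T : {set 'I_m * 'I_m}) (K : set (set V)).

Definition hull (A : set V) : set V := smallest (@convex_set R V) A.

(* e_i - e_j *)
Definition root (i j : nat) : V :=
  \row_k ((k == i :> nat)%:R - (k == j :> nat)%:R).

Definition graph_cone G : set V :=
  [set x | exists2 c : 'I_m * 'I_m -> R, forall e, 0 <= c e &
     x = \sum_(e in G) c e *: root e.1 e.2].

Definition cone_roots G : set V :=
  [set x | exists i j : 'I_m, [/\ (i < j)%N, x = root i j & graph_cone G x]].

Definition polytope_points G : set V := [set 0] `|` cone_roots G.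

Definition root_polytope G : set V := hull (polytope_points G).

(* A geometric simplicial complex is the set of all its simplices, the empty   *)
(* one included.  The canonical triangulation consists of the faces of the     *)
(* simplices root_polytope T, T a canonical tree of G.                         *)
Definition canonical_triangulation G : set (set V) :=
  [set s | exists T A, [/\ canonical_tree G T, A `<=` polytope_points T
                         & s = hull A]].

Definition dot (u x : V) : R := \sum_k u 0 k * x 0 k.

Definition hyperplane (u : V) (c : R) : set V := [set x | dot u x = c].

(* The vertices of root_polytope G other than 0 are the elements of            *)
(* cone_roots G.                                                               *)
Definition separates_0 G (u : V) (c : R) : Prop :=
  0 < c /\ forall x, cone_roots G x -> c < dot u x.

Definition section_triangulation G (u : V) (c : R) : set (set V) :=
  [set s `&` hyperplane u c | s in canonical_triangulation G].

Definition affinely_independent (I : finType) (p : I -> V) (F : {set I}) : Prop :=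
  forall c : I -> R, \sum_(i in F) c i = 0 -> \sum_(i in F) c i *: p i = 0 ->
    forall i, i \in F -> c i = 0.

(* s is a simplex with k vertices, i.e., of dimension k - 1 *)
Definition simplex (k : nat) (s : set V) : Prop :=
  exists2 p : 'I_k -> V, affinely_independent p [set: 'I_k]%SET &
    s = hull (range p).

Definition facet K (f : set V) : Prop :=
  K f /\ forall g, K g -> f `<=` g -> g = f.

Definition boundary_facet K (r : set V) : Prop :=
  K r /\ exists f, [/\ facet K f, r `<=` f,
    (exists k, simplex k.+1 f /\ simplex k r) &
    forall g, facet K g -> r `<=` g -> g = f].

Definition boundary_complex K : set (set V) :=
  [set s | K s /\ exists2 r, boundary_facet K r & s `<=` r].

Definition link K (v : V) : set (set V) :=
  [set t | [/\ K t, ~ t v & exists s, [/\ K s, s v & t `<=` s]]].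

(* The section near v of the simplex spanned by v and by a simplex t of the    *)
(* link of v is the image of t under the homothety of centre v and ratio eps.  *)
(* No single hyperplane need cut all these simplices, because v need not be a  *)
(* vertex of the underlying polytope.                                          *)
Definition vertex_figure_at K (v : V) (eps : R) : set (set V) :=
  [set (fun x => v + eps *: (x - v)) @` t | t in link K v].

Definition realized_by (I : finType) (D : {set {set I}}) K : Prop :=
  exists p : I -> V,
    [/\ forall F, F \in D -> affinely_independent p F,
        forall F G : {set I}, F \in D -> G \in D ->
          hull (p @` [set` F]) `&` hull (p @` [set` G]) =
          hull (p @` [set` (F :&: G)%SET])
      & K = [set hull (p @` [set` F]) | F in [set` D]]].

End Geometry.

(* C(pi), for the hyperplane dot u x = c *)
Definition C_complex (R : realType) n (pi : 'S_n)
    (u : 'rV[R]_(num_labels pi)) (c : R) : set (set 'rV[R]_(num_labels pi)) :=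
  section_triangulation (tree_edges pi) u c.

(* w is a vertex of C(pi) on the ray from 0 through e_1 - e_m *)
Definition vertex_on_long_ray (R : realType) n (pi : 'S_n)
    (u : 'rV[R]_(num_labels pi)) (c : R) (w : 'rV[R]_(num_labels pi)) : Prop :=
  C_complex u c [set w]%classic /\
  exists2 t : R, (0 <= t)%R & w = (t *: root R _ 0 (num_labels pi).-1)%R.

(* Main.v *)
Require Import Defs.
From HB Require Import structures.
From mathcomp Require Import all_boot all_order all_algebra all_fingroup.
From mathcomp Require Import zify.

(* Let D be the diagram of pi, a Young diagram with corner (1, 1) when boxes   *)
(* and labels are numbered from 0.                                             *)
(*                                                                             *)
(* Pipe dreams: a set of boxes is a face of PD pi iff it avoids all pairs      *)
(* (x1, y2), (x2, y1) with x1 < x2, y1 < y2 and (x2, y2) in D.  Two such       *)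
(* elbows would let two of the strands 0,..,x2 reach the columns 0,..,y2,      *)
(* whereas pi allows only one.  Conversely, the complement of a maximal set    *)
(* without such pairs is a filling whose permutation w satisfies this rank     *)
(* condition, so that its diagram contains D; it has at most #|D| crosses,     *)
(* hence w = pi and no two strands cross twice.                                *)
(*                                                                             *)
(* Trees: sending a box of R(pi) to the labels of the E step of its column and *)
(* of the N step of its row is a bijection onto the edges of the transitive    *)
(* closure of T(pi), which are all (i, j) with i < j, i the label of an E step *)
(* and j the label of an N step.  An E step shares the label of the N step     *)
(* before it exactly when the corner between them lies in D, and therefore     *)
(* the pairs above correspond to the pairs of edges that cross or do not       *)
(* alternate, and (0, 0) corresponds to the edge (0, m - 1), which is          *)
(* compatible with all others.                                                 *)
(*                                                                             *)
(* Geometry: a point has at most one expression as a nonnegative combination   *)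
(* of roots e_i - e_j along a noncrossing alternating graph, because the total *)
(* weight of the edges covering [k, l] is the minimum over k <= p < l of the   *)
(* sum of the first p + 1 coordinates.  So C(pi) realizes the complex of       *)
(* noncrossing alternating graphs, v is a cone point of it, and its link       *)
(* realizes the core.  If every inner label is both an E and an N label, then  *)
(* the graphs are partial triangulations of a polygon, every edge other than   *)
(* (0, m - 1) can be flipped, and the link is the boundary; otherwise an inner *)
(* label is a leaf in some facet, which has a free codimension 1 face that     *)
(* contains v.                                                                 *)

(** Three descriptions of one flag complex are compared. The faces of [PD pi] are the sets of boxes
    without [box_conflict] ([PD_box_face]), the section of the canonical triangulation has as faces
    the sets of arcs without [arc_conflict] ([section_arc_faces]), and the bijection [arc_of] from
    R(pi) to the arcs matches the two relations ([arc_of_conflict]). The box (0, 0) goes to the arc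
    from the first to the last label, which is in conflict with nothing; removing it leaves the core
    on one side ([core_faces]) and the link of v on the other ([linkE]).

    This bijection becomes a geometric realization through [unique_combinations]: nonnegative
    combinations of the chosen points along faces are unique. For arcs this is [arc_vertex_unique],
    a consequence of [root_combination_unique]; [core_realized] carries it over to the core.

    One count is needed: the complement of a maximal face has at most [#|diagram pi|] crosses
    ([box_face_card]). It follows from a comparison of ranks: a maximal compatible set of arcs
    connects all labels ([maximal_connected]), so its roots span, while roots along any compatible
    set are independent ([compatible_card_le_connected]).

    The two cases are separated by [inner_labelsP]: pi is 1 m ... 2 exactly when every inner label
    is both an E and an N label. Then [flip] shows that only faces omitting the long arc are on the
    boundary ([boundaryE]). Otherwise [free_arc_to_sink] or [free_arc_from_source] gives a free
    codimension 1 face through v ([long_vertex_boundary]). *)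

Set Implicit Arguments.
Unset Strict Implicit.
Unset Printing Implicit Defensive.

(** * Noncrossing alternating graphs *)

Section Arcs.
Variable m : nat.
Local Notation arc := ('I_m * 'I_m)%type.
Implicit Types (e f g : arc) (F H T : {set arc}).

(* Crossing, or consecutive at a common vertex when f.1 = e.2. *)
Definition arc_conflict e f : bool := [&& e.1 < f.1, f.1 <= e.2 & e.2 < f.2].

Definition compatible F : bool :=
  [forall e in F, forall f in F, ~~ arc_conflict e f].

Lemma compatibleP F :
  reflect (forall e f, e \in F -> f \in F -> ~~ arc_conflict e f) (compatible F).
Proof.
apply: (iffP forall_inP) => [h e f eF fF|h e eF]; first by move/forall_inP: (h e eF); apply.
by apply/forall_inP => f fF; apply: h.
Qed.

Lemma compatible_sub F F' : F \subset F' -> compatible F' -> compatible F.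
Proof.
by move=> /subsetP sF /compatibleP h; apply/compatibleP => e f /sF eF /sF; apply: h.
Qed.

Lemma compatibleU1 e F : compatible F ->
  (forall f, f \in F -> ~~ arc_conflict e f && ~~ arc_conflict f e) ->
  compatible (e |: F).
Proof.
move=> /compatibleP cF h; apply/compatibleP => f g.
rewrite !in_setU1 => /predU1P[->|fF] /predU1P[->|gF]; last exact: cF.
- by rewrite /arc_conflict ltnn.
- by case/andP: (h g gF).
- by case/andP: (h f fF).
Qed.

Lemma compatible_noncrossing F : compatible F -> noncrossing F.
Proof.
move=> /compatibleP h i j k l ij jk kl; apply/negP => /andP[ik jl].
by move/negP: (h _ _ ik jl); apply; rewrite /arc_conflict /= ij kl (ltnW jk).
Qed.

Definition increasing F := forall e, e \in F -> e.1 < e.2.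

Lemma compatible_alternating F : increasing F -> compatible F -> alternating F.
Proof.
move=> incF /compatibleP h v.
have [[e /andP[eF /eqP ev]]|no_in] := altP (existsP (P := fun e => (e \in F) && (e.2 == v))).
  right => f fF; apply/eqP => fv; move/negP: (h e f eF fF); apply.
  have := incF _ eF; have := incF _ fF.
  by rewrite /arc_conflict fv ev leqnn => -> ->.
left => e eF; apply: contra no_in => ev; apply/existsP; exists e.
by rewrite eF.
Qed.

Lemma noncrossing_alternating_compatible F :
  increasing F -> noncrossing F -> alternating F -> compatible F.
Proof.
move=> incF ncF altF; apply/compatibleP => e f eF fF; apply/negP => /and3P[e1 e2 e3].
move: e2; rewrite leq_eqVlt => /predU1P[/val_inj e2|e2].
  by case: (altF f.1) => h; [move: (h e eF)|move: (h f fF)]; rewrite -?e2 eqxx.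
have /negP := ncF _ _ _ _ e1 e2 e3; apply.
by rewrite -!surjective_pairing eF.
Qed.

Lemma adjacent_sym F : symmetric (adjacent F).
Proof. by move=> i j; rewrite /adjacent /= orbC. Qed.

Lemma connect_adjacent_sym F : connect_sym (adjacent F).
Proof. exact/sym_connect_sym/adjacent_sym. Qed.

Lemma connect_arc F e : e \in F -> connect (adjacent F) e.1 e.2.
Proof. by move=> eF; apply: connect1; rewrite /adjacent /= -surjective_pairing eF. Qed.

Lemma increasing_sub F F' : F \subset F' -> increasing F' -> increasing F.
Proof. by move=> /subsetP sF h e /sF; apply: h. Qed.

(* At a shortest arc of a cycle, both neighbouring arcs stick out, on opposite *)
(* sides, so that they cross each other.                                       *)
Lemma compatible_acyclic F : increasing F -> compatible F -> acyclic F.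
Proof.
move=> incF cF s.
have altF := compatible_alternating incF cF; move/compatibleP: cF => cF.
(* [len] is the length of the first arc of the cycle, written with truncated differences. By
   induction both rotations of the cycle start with an arc that is no shorter. *)
pose len (s : seq 'I_m) := if s is v :: w :: _ then (v - w) + (w - v) else 0.
elim/ltn_ind: (len s) {-2}s (erefl (len s)) => k IH [|v [|w [|z t]]] //= lk _.
set s1 := [:: v, w, z & t] => cs.
have c1 : ucycle (adjacent F) (rot 1 s1) by rewrite /ucycle rot_cycle rot_uniq.
have c2 : ucycle (adjacent F) (rotr 1 s1) by rewrite /ucycle rotr_cycle rotr_uniq.
have l1 : k <= (w - z) + (z - w).
  rewrite leqNgt; apply/negP => lt; apply: (IH _ lt (rot 1 s1) _ _ c1) => //.
  by rewrite size_rot.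
have [u [t' lu]] : exists u t', rcons t' u = z :: t.
  by exists (last z t), (belast z t); rewrite -lastI.
have r2 : rotr 1 s1 = [:: u, v, w & t'] by rewrite /s1 -lu -!rcons_cons rotr1_rcons.
have l2 : k <= (u - v) + (v - u).
  rewrite leqNgt; apply/negP => lt; apply: (IH _ lt (rotr 1 s1) _ _ c2).
    by rewrite r2.
  by rewrite size_rotr.
have us : uniq s1 by case/andP: cs.
have vz : z != v by rewrite eq_sym; move: us; rewrite /s1 /= !inE !negb_or => /andP[/and3P[]].
have uw : u != w.
  by move: c2; rewrite r2 /ucycle /= !inE !negb_or => /andP[_ /andP[/and3P[]]].
have Avw : adjacent F v w by case/andP: cs => /= /andP[].
have Awz : adjacent F w z by case/andP: cs => /= /and3P[].
have Auv : adjacent F u v by move: c2; rewrite r2 /ucycle /= => /andP[/andP[]].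
have src e f : e \in F -> f \in F -> e.1 = f.2 -> False.
  by move=> eF fF ef; case: (altF e.1) => h; [have := h f fF; rewrite ef eqxx|have := h e eF; rewrite eqxx].
case/orP: Avw => vw; have lvw := incF _ vw; rewrite /= in lvw.
  have zw : (z, w) \in F by case/orP: Awz => // wz; case: (src _ _ wz vw).
  have vu : (v, u) \in F by case/orP: Auv => // uv; case: (src _ _ vw uv).
  have lzw := incF _ zw; have lvu := incF _ vu; rewrite /= in lzw lvu.
  move/negP: (cF _ _ zw vu); apply; rewrite /arc_conflict /=.
  move: vz uw; rewrite -!val_eqE /=; lia.
have wz : (w, z) \in F by case/orP: Awz => // zw; case: (src _ _ vw zw).
have uv : (u, v) \in F by case/orP: Auv => // vu; case: (src _ _ vu vw).
have lwz := incF _ wz; have luv := incF _ uv; rewrite /= in lwz luv.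
move/negP: (cF _ _ uv wz); apply; rewrite /arc_conflict /=.
move: vz uw; rewrite -!val_eqE /=; lia.
Qed.

Variables (S K : pred 'I_m) (lo hi : 'I_m).
Hypotheses (lo0 : lo = 0 :> nat) (him : hi = m.-1 :> nat).
Hypotheses (S_lo : S lo) (K_hi : K hi) (SK : forall v, S v || K v).

(** [S] stands for the labels of E steps and [K] for those of N steps; a label may be of both kinds.
    With these, [arcs] is the transitive closure of the tree ([trans_closure_tree_edges]). *)
Definition arcs : {set arc} := [set e : arc | [&& e.1 < e.2, S e.1 & K e.2]].

Lemma increasing_arcs : increasing arcs.
Proof. by move=> e; rewrite inE => /andP[]. Qed.

Definition compatible_arcs F := (F \subset arcs) && compatible F.

Lemma maximal_compatibleP H e : maxset compatible_arcs H -> e \in arcs ->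
  e \notin H -> exists2 f : arc, f \in H & arc_conflict e f || arc_conflict f e.
Proof.
case/maxsetP => /andP[sH cH] maxH eG eH.
have [/existsP[f /andP[fH fe]]|nf] :=
  boolP [exists f in H, arc_conflict e f || arc_conflict f e]; first by exists f.
case/negP: eH; rewrite -(maxH (e |: H)) ?setU11 ?subsetUr //.
rewrite /compatible_arcs subUset sub1set eG sH compatibleU1 // => f fH.
by move: nf; rewrite negb_exists => /forallP/(_ f); rewrite fH negb_or.
Qed.

(* Take an arc of maximal length between two components.  The arcs of H in    *)
(* conflict with it cross it; replacing one of its ends by the inner end of    *)
(* the most extreme of these gives an arc between the components without       *)
(* conflicts.                                                                  *)
Lemma maximal_connected_arc H e : maxset compatible_arcs H -> e \in arcs ->
  connect (adjacent H) e.1 e.2.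
Proof.
move=> maxH eG; apply/negPn/negP => ne.
have [/andP[/subsetP sH /compatibleP cH] _] := maxsetP maxH.
have sym := connect_adjacent_sym H; set C := connect (adjacent H) in ne sym.
have tr : transitive C := @connect_trans _ _.
have CH k l : (k, l) \in H -> C k l := @connect_arc H (k, l).
case: (@arg_maxnP _ e (fun f => (f \in arcs) && ~~ C f.1 f.2) (fun f => f.2 - f.1)).
  by rewrite eG.
case=> i j /andP[ijG /= nij] longest.
have {}longest k l : (k, l) \in arcs -> j - i < l - k -> C k l.
  move=> klG lt; apply/negPn/negP => nkl.
  by have := longest (k, l); rewrite klG nkl /= => /(_ isT); lia.
have G k l : ((k, l) \in arcs) = [&& k < l, S k & K l] by rewrite inE.
have [lij Si Kj] : [/\ i < j, S i & K j] by move: ijG; rewrite G => /and3P[].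
have SKH k l : (k, l) \in H -> [/\ k < l, S k & K l] by move=> /sH; rewrite G => /and3P[].
(* Strong induction on [l] replaces the choice of the most extreme arc. The longer arc (k, j) joins
   vertices of one component, so (i, l) does not; an arc of H in conflict with (i, l) is either in
   conflict with (k, l) or of the same kind with a smaller right end. *)
have noL k l : (k, l) \in H -> k < i -> i <= l -> l < j -> False.
  move eqd: (l : nat) => d; elim/ltn_ind: d l k eqd => d IH l k eqd klH ki il lj; subst d.
  have [_ Sk Kl] := SKH _ _ klH.
  have kj : C k j by apply: longest; rewrite ?G ?Sk ?Kj ?andbT; clear -ki il lj lij; lia.
  have nil : ~~ C i l.
    by apply: contra nij => il'; apply: (tr l) => //; apply: (tr k) => //; rewrite /C sym; exact: CH.
  have il_neq : i != l by apply: contra nil => /eqP ->; exact: connect0.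
  have ilG : (i, l) \in arcs by rewrite G Si Kl !andbT ltn_neqAle il_neq.
  have ilH : (i, l) \notin H by apply: contra nil => /CH.
  have [[k' l'] klH' /orP[]] := maximal_compatibleP maxH ilG ilH => /and3P /= [c1 c2 c3].
    move/negP: (cH _ _ klH klH'); apply; rewrite /arc_conflict /=; clear -ki c1 c2 c3; lia.
  by apply: (IH l' _ l' k' erefl) => //; exact: ltn_trans lj.
have noR k l : (k, l) \in H -> i < k -> k <= j -> j < l -> False.
  move eqd: (m - k) => d; elim/ltn_ind: d k l eqd => d IH k l eqd klH ik kj jl; subst d.
  have [_ Sk Kl] := SKH _ _ klH.
  have il : C i l by apply: longest; rewrite ?G ?Si ?Kl ?andbT; clear -ik kj jl lij; lia.
  have nkj : ~~ C k j.
    by apply: contra nij => kj'; apply: (tr k) => //; apply: (tr l) => //; rewrite /C sym; exact: CH.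
  have kj_neq : k != j by apply: contra nkj => /eqP ->; exact: connect0.
  have kjG : (k, j) \in arcs by rewrite G Sk Kj !andbT ltn_neqAle kj_neq.
  have kjH : (k, j) \notin H by apply: contra nkj => /CH.
  have [[k' l'] klH' /orP[]] := maximal_compatibleP maxH kjG kjH => /and3P /= [c1 c2 c3].
    by apply: (IH (m - k') _ k' l' erefl) => //; have := ltn_ord k'; clear -c1 c2 c3 ik; lia.
  move/negP: (cH _ _ klH' klH); apply; rewrite /arc_conflict /=; clear -c1 c2 c3 jl; lia.
have ijH : (i, j) \notin H by apply: contra nij => /CH.
have [[k l] klH /orP[]] := maximal_compatibleP maxH ijG ijH => /and3P /= [c1 c2 c3].
  exact: noR klH c1 c2 c3.
exact: noL klH c1 c2 c3.
Qed.

(** Every source other than [hi] has an arc to [hi], every sink other than [lo] has one from [lo],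
    and (lo, hi) is an arc as well. *)
Lemma maximal_connected H i j : maxset compatible_arcs H -> connect (adjacent H) i j.
Proof.
move=> maxH; have sym := connect_adjacent_sym H.
have le_hi (v : 'I_m) : v <= hi by rewrite him; have := ltn_ord v; lia.
have lohi : connect (adjacent H) lo hi.
  have [->|lh] := eqVneq lo hi; first exact: connect0.
  apply: (maximal_connected_arc (e := (lo, hi)) maxH).
  by rewrite inE /= S_lo K_hi ltn_neqAle lh le_hi.
suff to_hi v : connect (adjacent H) v hi by apply: connect_trans (to_hi i) _; rewrite sym.
case/orP: (SK v) => hv.
  have [->|vh] := eqVneq v hi; first exact: connect0.
  apply: (maximal_connected_arc (e := (v, hi)) maxH).
  by rewrite inE /= hv K_hi ltn_neqAle vh le_hi.
have [->//|vl] := eqVneq v lo.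
apply: connect_trans lohi; rewrite sym.
apply: (maximal_connected_arc (e := (lo, v)) maxH).
by rewrite inE /= S_lo hv lo0 lt0n -lo0 val_eqE vl.
Qed.

Lemma maximal_compatible_extend F : compatible_arcs F ->
  exists2 H, maxset compatible_arcs H & F \subset H.
Proof. by move=> cF; have [H mH sH] := maxset_exists cF; exists H. Qed.

Lemma canonical_tree_compatible T0 T : trans_closure T0 = arcs ->
  canonical_tree T0 T -> compatible_arcs T.
Proof.
move=> GE [ncT altT [sT _ _]]; rewrite GE in sT.
rewrite /compatible_arcs sT noncrossing_alternating_compatible //.
exact: increasing_sub sT increasing_arcs.
Qed.

(** The triangulation takes all faces of canonical trees, so this and [canonical_tree_compatible]
    suffice to identify its faces with compatible sets. *)
Lemma canonical_tree_maximal T0 T : trans_closure T0 = arcs ->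
  maxset compatible_arcs T -> canonical_tree T0 T.
Proof.
move=> GE maxT; have [/andP[sT cT] _] := maxsetP maxT.
have incT := increasing_sub sT increasing_arcs.
split; [exact: compatible_noncrossing|exact: compatible_alternating|].
split; rewrite ?GE //; first exact: compatible_acyclic.
by move=> i j; apply: maximal_connected.
Qed.

Definition long_arc : arc := (lo, hi).

Lemma long_arc_no_conflict e : ~~ arc_conflict e long_arc && ~~ arc_conflict long_arc e.
Proof.
rewrite /arc_conflict /= lo0 him.
by have := ltn_ord e.1; have := ltn_ord e.2; lia.
Qed.

Lemma long_arc_arcs : lo != hi -> long_arc \in arcs.
Proof.
rewrite -val_eqE /= lo0 him => lh; rewrite inE /= S_lo K_hi lo0 him; lia.
Qed.

Lemma compatible_arcsU1_long F : lo != hi -> compatible_arcs F -> compatible_arcs (long_arc |: F).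
Proof.
move=> lh /andP[sF cF]; rewrite /compatible_arcs subUset sF sub1set long_arc_arcs //=.
by apply: compatibleU1 => // f _; rewrite andbC long_arc_no_conflict.
Qed.

Lemma long_arc_maximal T : lo != hi -> maxset compatible_arcs T -> long_arc \in T.
Proof.
move=> lh mT; apply/negPn/negP => nT.
have [f _] := maximal_compatibleP mT (long_arc_arcs lh) nT.
by rewrite orbC; apply/negP; rewrite negb_or long_arc_no_conflict.
Qed.

End Arcs.

(** * Codimension 1 faces lying in a single facet *)

Section FreeFace.
Variables (m : nat) (S K : pred 'I_m) (lo hi : 'I_m).
Hypotheses (lo0 : lo = 0 :> nat) (him : hi = m.-1 :> nat).
Hypotheses (S_lo : S lo) (K_hi : K hi) (SK : forall v, S v || K v).
Local Notation arc := ('I_m * 'I_m)%type.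
Local Notation facets := (maxset (compatible_arcs S K)).
Implicit Types (F T : {set arc}).

Lemma facet_incident T v : lo != hi -> facets T ->
  exists2 e : arc, e \in T & (e.1 == v) || (e.2 == v).
Proof.
move=> lh mT.
have [u vu] : exists u, u != v by have [<-|] := eqVneq lo v; [exists hi; rewrite eq_sym|exists lo].
have /connectP[[|w p] /= pth eu] := maximal_connected lo0 him S_lo K_hi SK v u mT.
  by rewrite eu eqxx in vu.
case/andP: pth => /orP[h|h] _; first by exists (v, w); rewrite //= eqxx.
by exists (w, v); rewrite //= eqxx orbT.
Qed.

(** A facet containing [T :\ e] contains F, hence e, hence T, and equals T by maximality. *)
Lemma facet_of_free_arc F e : e.1 != lo \/ e.2 != hi -> e \notin F ->
    compatible_arcs S K (e |: F) ->
    (forall T, facets T -> F \subset T -> e \in T) ->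
  exists T, [/\ facets T, e \in T, e != (lo, hi)
    & forall T', facets T' -> T :\ e \subset T' -> T' = T].
Proof.
move=> ne eF cF FT; have [T mT /subsetP sT] := maximal_compatible_extend cF.
have eT : e \in T by apply: sT; rewrite setU11.
exists T; split=> //.
  by apply/eqP => ee; move: ne; rewrite ee !eqxx; case.
move=> T' mT' sT'; have [c' _] := maxsetP mT'; have [_ h] := maxsetP mT.
apply: h => //; rewrite -(setD1K eT) subUset sub1set sT' andbT.
apply: FT => //; apply: subset_trans sT'; apply/subsetP => f fF.
rewrite in_setD1 sT ?in_setU1 ?fF ?orbT // andbT.
by apply: contra eF => /eqP <-.
Qed.

(** Let p be the last source before x, and let F consist of the arcs from sources to [hi]. A facet
    over F has an arc into x, because x is no source; from a source before p it would cross (p, hi),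
    so it is (p, x). *)
Lemma free_arc_to_sink x : ~~ S x -> x != hi ->
  exists T e, [/\ facets T, e \in T, e != (lo, hi)
    & forall T', facets T' -> T :\ e \subset T' -> T' = T].
Proof.
move=> nSx xhi; have Kx : K x by have := SK x; rewrite (negPf nSx).
have lox : lo < x.
  by rewrite lo0 lt0n -lo0 val_eqE; apply: contra nSx => /eqP ->.
have xlt : x < hi by move: xhi (ltn_ord x); rewrite -val_eqE /= him; lia.
have lh : lo != hi by rewrite -val_eqE /=; apply: contraTneq lox => ->; rewrite -leqNgt ltnW.
case: (@arg_maxnP _ lo (fun v => S v && (v < x)) (fun v => v : nat)); first by rewrite S_lo.
move=> p /andP[Sp px] pmax.
pose F := [set e : arc | [&& S e.1, e.1 < hi & e.2 == hi]].
have Fhi i : ((i, hi) \in F) = S i && (i < hi) by rewrite inE /= eqxx andbT.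
have cF : compatible_arcs S K ((p, x) |: F).
  apply/andP; split.
    rewrite subUset sub1set inE /= px Sp Kx; apply/subsetP => e; rewrite !inE.
    by case/and3P => -> + /eqP ->; rewrite K_hi => ->.
  apply: compatibleU1.
    apply/compatibleP => e f; rewrite !inE => /and3P[_ _ /eqP e2] /and3P[_ _ /eqP f2].
    by rewrite /arc_conflict e2 f2 ltnn !andbF.
  move=> f; rewrite inE => /and3P[Sf fhi /eqP f2]; rewrite /arc_conflict /= f2.
  apply/andP; split; last by rewrite (ltnNge hi x) (ltnW xlt) !andbF.
  apply/negP => /and3P[pf fx _].
  have fx' : f.1 < x by rewrite ltn_neqAle fx andbT val_eqE; apply: contra nSx => /eqP <-.
  by have := pmax f.1; rewrite Sf fx' => /(_ isT) /=; rewrite leqNgt pf.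
have [T H] : exists T, [/\ facets T, (p, x) \in T, (p, x) != (lo, hi)
    & forall T', facets T' -> T :\ (p, x) \subset T' -> T' = T].
  apply: facet_of_free_arc cF _ => /=; first by right.
    by rewrite inE /= (negPf xhi) !andbF.
  move=> T mT /subsetP FT; have [/andP[/subsetP sT /compatibleP cT] _] := maxsetP mT.
  have [[i j] ijT /=] := facet_incident x lh mT.
  have := sT _ ijT; rewrite inE /= => /and3P[ij Si Kj].
  case/orP => /eqP ex; first by rewrite -ex Si in nSx.
  subst j; have [<-//|ip] := eqVneq i p.
  have lt_ip : i < p by rewrite ltn_neqAle val_eqE ip /=; apply: pmax; rewrite Si.
  have phi : (p, hi) \in T by apply: FT; rewrite Fhi Sp (ltn_trans px).
  by have /negP[] := cT _ _ ijT phi; rewrite /arc_conflict /= lt_ip (ltnW px).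
by exists T, (p, x).
Qed.

(** Mirror image of [free_arc_to_sink]: q is the first sink after x, and the fixed arcs start at
    [lo]. *)
Lemma free_arc_from_source x : ~~ K x -> x != lo ->
  exists T e, [/\ facets T, e \in T, e != (lo, hi)
    & forall T', facets T' -> T :\ e \subset T' -> T' = T].
Proof.
move=> nKx xlo; have Sx : S x by have := SK x; rewrite (negPf nKx) orbF.
have xhi : x < hi.
  have : x != hi by apply: contra nKx => /eqP ->.
  by move: (ltn_ord x); rewrite -val_eqE /= him; lia.
have lox : lo < x by rewrite lo0 lt0n -lo0 val_eqE.
have lh : lo != hi by rewrite -val_eqE /=; apply: contraTneq lox => ->; rewrite -leqNgt ltnW.
case: (@arg_minnP _ hi (fun v => K v && (x < v)) (fun v => v : nat)); first by rewrite K_hi.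
move=> q /andP[Kq xq] qmin.
pose F := [set e : arc | [&& K e.2, lo < e.2 & e.1 == lo]].
have Flo j : ((lo, j) \in F) = K j && (lo < j) by rewrite inE /= eqxx andbT.
have cF : compatible_arcs S K ((x, q) |: F).
  apply/andP; split.
    rewrite subUset sub1set inE /= xq Sx Kq; apply/subsetP => e; rewrite !inE.
    by case/and3P => -> + /eqP ->; rewrite S_lo => ->.
  apply: compatibleU1.
    apply/compatibleP => e f; rewrite !inE => /and3P[_ _ /eqP e2] /and3P[_ _ /eqP f2].
    by rewrite /arc_conflict e2 f2 ltnn.
  move=> f; rewrite inE => /and3P[Kf lof /eqP f2]; rewrite /arc_conflict /= f2.
  apply/andP; split; first by rewrite (ltnNge x lo) (ltnW lox).
  apply/negP => /and3P[_ xf fq].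
  have xf' : x < f.2 by rewrite ltn_neqAle xf andbT val_eqE; apply: contra nKx => /eqP ->.
  by have := qmin f.2; rewrite Kf xf' => /(_ isT); rewrite leqNgt fq.
have [T H] : exists T, [/\ facets T, (x, q) \in T, (x, q) != (lo, hi)
    & forall T', facets T' -> T :\ (x, q) \subset T' -> T' = T].
  apply: facet_of_free_arc cF _ => /=; first by left.
    by rewrite inE /= (negPf xlo) !andbF.
  move=> T mT /subsetP FT; have [/andP[/subsetP sT /compatibleP cT] _] := maxsetP mT.
  have [[i j] ijT /=] := facet_incident x lh mT.
  have := sT _ ijT; rewrite inE /= => /and3P[ij Si Kj].
  case/orP => /eqP ex; last by rewrite -ex Kj in nKx.
  subst i; have [<-//|jq] := eqVneq j q.
  have lt_qj : q < j by rewrite ltn_neqAle val_eqE eq_sym jq /=; apply: qmin; rewrite Kj.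
  have loq : (lo, q) \in T by apply: FT; rewrite Flo Kq (ltn_trans lox).
  by have /negP[] := cT _ _ loq ijT; rewrite /arc_conflict /= lt_qj lox (ltnW xq).
by exists T, (x, q).
Qed.

End FreeFace.

(* The arc (i, j) is viewed as the chord {i, j + 1} of a polygon with vertices *)
(* 0,..,m: arcs conflict exactly when their chords cross, and facets are       *)
(* triangulations.                                                             *)
Section Flip.
Variables (m : nat) (S K : pred 'I_m) (lo hi : 'I_m).
Hypotheses (lo0 : lo = 0 :> nat) (him : hi = m.-1 :> nat).
Hypotheses (S_lo : S lo) (K_hi : K hi) (SK : forall v, S v || K v).
Hypothesis inner_SK : forall v, v != lo -> v != hi -> S v && K v.
Local Notation arc := ('I_m * 'I_m)%type.
Local Notation facets := (maxset (compatible_arcs S K)).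
Variable T : {set arc}.
Implicit Types e f g : arc.
Hypothesis mT : facets T.

Lemma all_arcs (e : arc) : (e \in arcs S K) = (e.1 < e.2).
Proof.
rewrite inE; case: ltnP => //= lt.
have -> : S e.1.
  have [->//|h1] := eqVneq e.1 lo; have [h2|h2] := eqVneq e.1 hi; last by case/andP: (inner_SK h1 h2).
  by move: lt (ltn_ord e.2); rewrite h2 him; lia.
have [->//|h1] := eqVneq e.2 hi; have [h2|h2] := eqVneq e.2 lo; last by case/andP: (inner_SK h2 h1).
by rewrite h2 lo0 in lt.
Qed.

(** The sides {x, x + 1} of the polygon are included, although no arc of T gives them, so that all
    sides of the triangles are chords. *)
Definition chord (x y : nat) : bool :=
  (x.+1 == y) || [exists e in T, (e.1 == x :> nat) && (e.2.+1 == y)].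

Lemma chordP x y : chord x y -> x.+1 < y ->
  exists2 e : arc, e \in T & e.1 = x :> nat /\ e.2.+1 = y.
Proof.
case/orP => [/eqP <-|/existsP[e /and3P[eT /eqP e1 /eqP e2] _]]; first by rewrite ltnn.
by exists e.
Qed.

Lemma arc_chord e : e \in T -> chord e.1 e.2.+1.
Proof. by move=> eT; apply/orP; right; apply/existsP; exists e; rewrite eT !eqxx. Qed.

Lemma arc_of_chord x y : x.+1 < y -> y <= m -> exists e : arc, e.1 = x :> nat /\ e.2.+1 = y.
Proof.
case: y => // y xy ym; have xm : x < m by apply: leq_trans ym; rewrite ltnW // ltnW.
by exists (Ordinal xm, Ordinal ym).
Qed.

Lemma conflictE (e f : arc) : arc_conflict e f = [&& e.1 < f.1, f.1 < e.2.+1 & e.2.+1 < f.2.+1].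
Proof. by []. Qed.

Lemma chord_noncrossing x y x' y' : chord x y -> chord x' y' ->
  x < x' -> x' < y -> y < y' -> False.
Proof.
move=> c c' h1 h2 h3.
have [e eT [e1 e2]] := chordP c (leq_ltn_trans h1 h2).
have [f fT [f1 f2]] := chordP c' (leq_ltn_trans h2 h3).
have [/andP[_ /compatibleP cT] _] := maxsetP mT.
by have /negP := cT _ _ eT fT; apply; rewrite conflictE e1 e2 f1 f2 h1 h2.
Qed.

Lemma chord_maximal x y : x.+1 < y -> y <= m ->
    (forall x' y', chord x' y' -> x < x' -> x' < y -> y < y' -> False) ->
    (forall x' y', chord x' y' -> x' < x -> x < y' -> y' < y -> False) -> chord x y.
Proof.
move=> xy ym h1 h2; have [e [e1 e2]] := arc_of_chord xy ym.
suff eT : e \in T by rewrite -e1 -e2 arc_chord.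
apply/negPn/negP => eT.
have eG : e \in arcs S K by rewrite all_arcs; lia.
have [f fT] := maximal_compatibleP mT eG eT.
rewrite !conflictE e1 e2 => /orP[] /and3P[c1 c2 c3].
  exact: h1 (arc_chord fT) c1 c2 c3.
exact: h2 (arc_chord fT) c1 c2 c3.
Qed.

(** The apex of the triangle under {x, y} is the largest z < y joined to x: a chord crossing {z, y}
    would cross {x, y} or {x, z}, or join x to a vertex between z and y. *)
Lemma chord_apex x y : chord x y -> x.+1 < y -> y <= m ->
  exists z, [/\ x < z, z < y, chord x z & chord z y].
Proof.
move=> cxy xy ym.
have ex : exists z, [&& x < z, z < y & chord x z].
  by exists x.+1; rewrite ltnSn xy /chord eqxx.
have ub z : [&& x < z, z < y & chord x z] -> z <= y by case/and3P => _ /ltnW.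
case: (ex_maxnP ex ub) => z /and3P[xz zy cxz] zmax.
exists z; split=> //; move: zy; rewrite leq_eqVlt => /predU1P[<-|zy]; first by rewrite /chord eqxx.
apply: chord_maximal => // x' y' c' h1 h2 h3.
  by apply: (chord_noncrossing cxy c' _ h2 h3); apply: ltn_trans xz h1.
have [lt|] := ltnP x' x; first by apply: (chord_noncrossing c' cxy lt _ h3); apply: ltn_trans xz h2.
rewrite leq_eqVlt => /predU1P[xx|xx]; last exact: (chord_noncrossing cxz c' xx h1 h2).
by have := zmax y'; rewrite xx c' h3 (ltn_trans _ h2) -?xx // => /(_ isT); rewrite leqNgt h2.
Qed.

Lemma arc_bound (e : arc) : e.2.+1 <= m. Proof. exact: ltn_ord. Qed.

Lemma arc_length e : e \in T -> e.1.+1 < e.2.+1.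
Proof.
have [/andP[/subsetP sT _] _] := maxsetP mT.
by move=> /sT; rewrite all_arcs.
Qed.

(** This is the triangle on the other side of e. Take a shortest f among the other arcs of T around
    e. If e lies under one of the two lower sides of the triangle under f, it equals that side by
    minimality; if it passed over the apex, it would cross a side or equal f. *)
Lemma parent_chord e : e \in T -> e != (lo, hi) ->
  (exists y, [/\ e.2.+1 < y, y <= m, chord e.1 y & chord e.2.+1 y]) \/
  (exists x, [/\ x < e.1, chord x e.2.+1 & chord x e.1]).
Proof.
move=> eT ne; have lh : lo != hi.
  have [/andP[/subsetP sT _] _] := maxsetP mT.
  have := sT _ eT; rewrite all_arcs -val_eqE /= lo0 him.
  have := ltn_ord e.2; lia.
pose P (f : arc) := [&& f \in T, f != e, f.1 <= e.1 & e.2 <= f.2].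
have P0 : P (lo, hi).
  rewrite /P (long_arc_maximal lo0 him S_lo K_hi lh mT) eq_sym ne /= lo0 him leq0n /=.
  by rewrite -ltnS (leq_trans (ltn_ord e.2)) // leqSpred.
have [f [fT fe h1 h2] fmin] : exists2 f : arc, [/\ f \in T, f != e, f.1 <= e.1 & e.2 <= f.2] &
    forall g, P g -> f.2 - f.1 <= g.2 - g.1.
  case: (@arg_minnP _ (lo, hi) P (fun f : arc => f.2 - f.1) P0) => f /and4P[fT fe h1 h2] fmin.
  by exists f.
have le := arc_length eT; have lf := arc_length fT.
have [z [z1 z2 c1 c2]] := chord_apex (arc_chord fT) lf (arc_bound f).
have short x y : chord x y -> x <= e.1 -> e.2.+1 <= y -> f.1 <= x -> y <= f.2.+1 ->
    y - x < f.2.+1 - f.1 -> x = e.1 /\ y = e.2.+1.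
  move=> c i1 i2 i3 i4 i5; have [|g gT [g1 g2]] := chordP c; first by clear -i1 i2 le; lia.
  have [ge|ge] := eqVneq g e; first by rewrite -ge.
  have eg : e.2 <= g.2 by rewrite -ltnS g2.
  have := fmin g; rewrite /P gT ge g1 i1 eg => /(_ isT) /=; clear -i1 i2 i3 i5 g1 g2 le lf; lia.
have [ez|ez] := leqP e.2.+1 z.
  have [x1 x2] : f.1 = e.1 :> nat /\ z = e.2.+1.
    by apply: short; rewrite // ?(ltnW z2) //; clear -z1 z2; lia.
  by left; exists f.2.+1; rewrite -x1 -x2; split=> //; exact: arc_chord.
have [ze|ze] := leqP z e.1.
  have [x1 x2] : z = e.1 :> nat /\ f.2.+1 = e.2.+1.
    by apply: short; rewrite // ?(ltnW z1) //; clear -z1 z2; lia.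
  by right; exists f.1; rewrite -x1 -x2; split=> //; exact: arc_chord.
case/negP: fe; rewrite [f]surjective_pairing [e]surjective_pairing xpair_eqE -!val_eqE /=.
apply/andP; split.
  rewrite eqn_leq h1 /= leqNgt; apply/negP => lt.
  exact: (chord_noncrossing c1 (arc_chord eT) lt ze ez).
rewrite eqn_leq h2 andbT leqNgt; apply/negP => lt.
exact: (chord_noncrossing (arc_chord eT) c2 ze ez lt).
Qed.

(** The triangles on both sides of e form a quadrilateral, and g is its other diagonal. An arc of T
    in conflict with g would cross a side of the quadrilateral or be e. *)
Lemma flip e : e \in T -> e != (lo, hi) ->
  exists T', [/\ facets T', T :\ e \subset T' & T' != T].
Proof.
move=> eT ne; have le := arc_length eT; have ce := arc_chord eT.
have [z [z1 z2 c1 c2]] := chord_apex ce le (arc_bound e).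
have [/andP[sT cT] _] := maxsetP mT.
suff [g [gG ge gT]] : exists g, [/\ g \in arcs S K, arc_conflict e g || arc_conflict g e &
    forall f, f \in T -> f != e -> ~~ arc_conflict g f && ~~ arc_conflict f g].
  have cg : compatible_arcs S K (g |: (T :\ e)).
    rewrite /compatible_arcs subUset sub1set gG (subset_trans (subsetDl _ _) sT) /=.
    apply: compatibleU1; first exact: compatible_sub (subsetDl _ _) cT.
    by move=> f /setD1P[fe fT]; apply: gT.
  have [T' mT' sT'] := maximal_compatible_extend cg.
  exists T'; split=> //; first exact: subset_trans (subsetUr _ _) sT'.
  apply/eqP => TT; subst T'.
  have gT' : g \in T by apply: (subsetP sT'); rewrite setU11.
  by case/orP: ge; apply/negP; move/compatibleP: cT; apply.
have chf f : f \in T -> f != e -> chord f.1 f.2.+1 /\ (f.1 = e.1 -> f.2 <> e.2).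
  move=> fT fe; split; first exact: arc_chord.
  by move=> f1 f2; case/negP: fe; rewrite [f]surjective_pairing f1 f2 -surjective_pairing.
have nc := chord_noncrossing.
case: (parent_chord eT ne) => [[y [y1 ym cy cy']]|[x [x1 cx cx']]].
  have [|g [g1 g2]] := arc_of_chord (x := z) (y := y) _ ym; first exact: leq_ltn_trans y1.
  exists g; split; first by rewrite all_arcs -ltnS g1 g2; apply: leq_ltn_trans y1.
    by rewrite !conflictE g1 g2 z1 z2 y1.
  move=> f fT fe; have [cf nf] := chf f fT fe; rewrite !conflictE g1 g2.
  apply/andP; split; apply/negP => /and3P[a1 a2 a3].
    exact: (nc _ _ _ _ cy cf (ltn_trans z1 a1) a2 a3).
  have [b|b] := ltnP f.1 e.1; first exact: (nc _ _ _ _ cf cy b (ltn_trans z1 a2) a3).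
  move: b; rewrite leq_eqVlt => /predU1P[b|b]; last exact: (nc _ _ _ _ c1 cf b a1 a2).
  have [d|] := ltnP f.2.+1 e.2.+1; first exact: (nc _ _ _ _ cf c2 a1 a2 d).
  rewrite leq_eqVlt => /predU1P[[d]|d]; last first.
    by apply: (nc _ _ _ _ cf cy') => //; rewrite -b (ltn_trans z1).
  by apply: nf; apply: val_inj.
have zm : z <= m by apply: leq_trans (ltnW z2) (arc_bound e).
have [|g [g1 g2]] := arc_of_chord (x := x) (y := z) _ zm; first exact: leq_ltn_trans z1.
exists g; split; first by rewrite all_arcs -ltnS g1 g2; apply: leq_ltn_trans z1.
  by rewrite !conflictE g1 g2 z1 z2 x1 orbT.
move=> f fT fe; have [cf nf] := chf f fT fe; rewrite !conflictE g1 g2.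
apply/andP; split; apply/negP => /and3P[a1 a2 a3]; last first.
  exact: (nc _ _ _ _ cf cx a1 a2 (ltn_trans a3 z2)).
have [b|b] := ltnP e.2.+1 f.2.+1; first exact: (nc _ _ _ _ cx cf a1 (ltn_trans a2 z2) b).
move: b; rewrite leq_eqVlt => /predU1P[b|b]; last exact: (nc _ _ _ _ cf c2 a2 a3 b).
have [d|] := ltnP e.1 f.1; first exact: (nc _ _ _ _ c1 cf d a2 a3).
rewrite leq_eqVlt => /predU1P[d|d]; last exact: (nc _ _ _ _ cx' cf a1 d (ltn_trans z1 a3)).
by apply: nf; apply: val_inj => //; case: b.
Qed.

End Flip.

(** * Diagrams and pipe dreams *)

Section Tiles.
Variable n : nat.
Implicit Types (A B C : {set pos n}).

Lemma is_crossP A a b :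
  reflect (exists2 p : pos n, p \in A & p.1 = a :> nat /\ p.2 = b :> nat) (is_cross A a b).
Proof.
apply: (iffP existsP) => [[p /andP[pA /eqP[<- <-]]]|[p pA [<- <-]]]; first by exists p.
by exists p; rewrite pA /tile eqxx.
Qed.

Lemma is_cross_pos A (p : pos n) : is_cross A p.1 p.2 = (p \in A).
Proof.
apply/is_crossP/idP => [[q qA [/val_inj e1 /val_inj e2]]|pA]; last by exists p.
by rewrite [p]surjective_pairing -e1 -e2 -surjective_pairing.
Qed.

Lemma is_cross_bound A a b : is_cross A a b -> a < n /\ b < n.
Proof. by case/is_crossP => p _ [<- <-]. Qed.

Lemma is_crossE A a b (an : a < n) (bn : b < n) :
  is_cross A a b = ((Ordinal an, Ordinal bn) \in A).
Proof. by rewrite -is_cross_pos. Qed.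

Lemma card_sum_is_cross A : #|A| = \sum_(a < n) \sum_(b < n) is_cross A a b.
Proof.
rewrite pair_bigA /= -sum1_card big_mkcond; apply: eq_bigr => p _.
by rewrite is_cross_pos; case: (p \in A).
Qed.

Lemma sum_is_cross_row A a :
  #|[set p : pos n in A | p.1 == a :> nat]| = \sum_(b < n) is_cross A a b.
Proof.
have E (x y : 'I_n) : is_cross [set p : pos n in A | p.1 == a :> nat] x y =
    is_cross A x y && (x == a :> nat) by rewrite -[x]/((x, y).1) -[y]/((x, y).2) !is_cross_pos inE.
rewrite card_sum_is_cross.
have [an|an] := ltnP a n; last first.
  rewrite [LHS]big1 => [|x _].
    rewrite [RHS]big1 // => y _.
    by apply/eqP; rewrite eqb0; apply/negP => /is_cross_bound[]; rewrite ltnNge an.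
  rewrite big1 // => y _; rewrite E; case: eqP => [e|_]; last by rewrite andbF.
  by have := ltn_ord x; rewrite e ltnNge an.
rewrite (bigD1 (Ordinal an)) //= [X in _ + X]big1 ?addn0 => [|x xa].
  by apply: eq_bigr => y _; rewrite (E (Ordinal an)) eqxx andbT.
rewrite big1 // => y _; rewrite E; case: eqP => [e|_]; last by rewrite andbF.
by move: xa; rewrite -val_eqE /= e eqxx.
Qed.

Lemma sum_is_cross_col A b :
  #|[set p : pos n in A | p.2 == b :> nat]| = \sum_(a < n) is_cross A a b.
Proof.
have E (x y : 'I_n) : is_cross [set p : pos n in A | p.2 == b :> nat] x y =
    is_cross A x y && (y == b :> nat) by rewrite -[x]/((x, y).1) -[y]/((x, y).2) !is_cross_pos inE.
rewrite card_sum_is_cross; apply: eq_bigr => x _.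
have [bn|bn] := ltnP b n; last first.
  rewrite big1 => [|y _].
    by apply/esym/eqP; rewrite eqb0; apply/negP => /is_cross_bound[_]; rewrite ltnNge bn.
  rewrite E; case: eqP => [e|_]; last by rewrite andbF.
  by have := ltn_ord y; rewrite e ltnNge bn.
rewrite (bigD1 (Ordinal bn)) //= big1 ?addn0 => [|y yb]; first by rewrite (E x (Ordinal bn)) eqxx andbT.
rewrite E; case: eqP => [e|_]; last by rewrite andbF.
by move: yb; rewrite -val_eqE /= e eqxx.
Qed.

(** A decreasing predicate is an initial segment whose length is its count. This turns row and
    column cardinalities into membership. *)
Lemma ltn_sum_antitone (f : nat -> bool) : (forall b, f b.+1 -> f b) -> (forall b, f b -> b < n) ->
  forall b, (b < \sum_(i < n) f i) = f b.
Proof.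
move=> anti bound b.
have fle i j : i <= j -> f j -> f i.
  by move=> ij; rewrite -(subnKC ij); elim: (j - i) => [|k IH]; rewrite ?addn0 // addnS => /anti.
have sum_iota k : \sum_(i < k) f i <= k.
  by rewrite -[leqRHS]card_ord -sum1_card leq_sum // => i _; apply: leq_b1.
have prefix k : f k -> \sum_(i < k.+1) f i = k.+1.
  move=> fk; rewrite (eq_bigr (fun=> 1)) ?sum1_card ?card_ord // => i _.
  by rewrite (fle _ k) // -ltnS.
have [fb|nfb] := boolP (f b).
  rewrite -(prefix b fb) (big_ord_widen n (fun i => f i : nat)) ?bound //.
  by rewrite [leqLHS]big_mkcond leq_sum // => i _; case: ifP.
apply/negbTE; rewrite -leqNgt; apply: leq_trans (sum_iota b).
have [bn|bn] := leqP b n.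
  rewrite [leqRHS](big_ord_widen n (fun i => f i : nat)) // [leqRHS]big_mkcond leq_sum // => i _.
  case: ltnP => // bi; rewrite leqn0 eqb0; apply: contra nfb; exact: fle.
rewrite [leqLHS](big_ord_widen b (fun i => f i : nat)) ?(ltnW bn) // [leqLHS]big_mkcond.
by apply: leq_sum => i _; case: ifP.
Qed.

End Tiles.

(** * Diagrams of dominant permutations *)

Section Diagram.
Variables (n : nat) (pi : 'S_n).
Local Notation D := (is_cross (diagram pi)).

Lemma mem_diagram (p : pos n) :
  (p \in diagram pi) = (p.1 < pi p.2) && (p.2 < (pi^-1)%g p.1).
Proof.
apply/imsetP/andP => [[e] |[h1 h2]].
  by rewrite inE => /andP[h1 h2] -> /=; rewrite permK.
exists (p.2, (pi^-1)%g p.1); last by rewrite /= permKV -surjective_pairing.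
by rewrite inE /= permKV h1 h2.
Qed.

End Diagram.

(** If s and t first differ at i, with s i < t i, then the box (s i, i) lies in the diagram of t but
    not in that of s. *)
Lemma diagram_inj n : injective (@diagram n).
Proof.
move=> pi w E; apply/permP => i.
have [k] := ubnP i; elim: k i => // k IH i ik.
have agree (j : 'I_n) : j < i -> pi j = w j by move=> ji; apply: IH; apply: leq_trans ji _.
have noless (s t : 'S_n) : diagram s = diagram t -> (forall j : 'I_n, j < i -> s j = t j) -> ~~ (s i < t i).
  move=> st ag; apply/negP => lt.
  have : (s i, i) \in diagram s; last by rewrite mem_diagram /= ltnn.
  rewrite st mem_diagram /= lt ltnNge; apply/negP => le.
  have ts : t ((t^-1)%g (s i)) = s i by rewrite permKV.
  move: le; rewrite leq_eqVlt => /predU1P[/val_inj e|lt'].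
    by move: lt; rewrite -ts e ltnn.
  by have := ag _ lt'; rewrite ts => /perm_inj e; move: lt'; rewrite e ltnn.
apply/val_inj/eqP; rewrite eqn_leq leqNgt (noless w pi) //; last by move=> j /agree.
by rewrite leqNgt (noless pi w).
Qed.

Section Dominant.
Variables (n : nat) (pi : 'S_n).
Hypothesis pi_dominant : one_dominant pi.
Local Notation D := (is_cross (diagram pi)).

Lemma diagram_gt0 a b : D a b -> 0 < a /\ 0 < b.
Proof.
case/is_crossP => p; rewrite mem_diagram => /andP[h1 h2] [<- <-].
have [pi0 _] := pi_dominant; split; rewrite lt0n; apply/eqP => e.
  have n0 : 0 < n by apply: leq_ltn_trans (ltn_ord p.1).
  have p1 : p.1 = pi (Ordinal n0) by apply: val_inj; rewrite /= e pi0.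
  by move: h2; rewrite p1 permK.
by move: h1; rewrite pi0.
Qed.

(** A box missing to the left of or above a box of D would exhibit a 132 pattern beyond position
    0. *)
Lemma diagram_down a b a' b' : D a b -> 0 < a' -> a' <= a -> 0 < b' -> b' <= b -> D a' b'.
Proof.
have [pi0 pi132] := pi_dominant.
have leftward (q : pos n) (y : 'I_n) : q \in diagram pi -> 0 < y -> y <= q.2 -> (q.1, y) \in diagram pi.
  rewrite !mem_diagram /= => /andP[h1 h2] y0; rewrite leq_eqVlt => /predU1P[/val_inj ->|yq].
    by rewrite h1 h2.
  rewrite (ltn_trans yq h2) andbT ltnNge leq_eqVlt negb_or.
  have := pi132 _ _ _ y0 yq h2; rewrite permKV h1 andbT => ->.
  rewrite andbT; apply/eqP => /val_inj e; move: (ltn_trans yq h2).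
  by rewrite -e permK ltnn.
have up (q : pos n) (x : 'I_n) : q \in diagram pi -> 0 < x -> x <= q.1 -> (x, q.2) \in diagram pi.
  rewrite !mem_diagram /= => /andP[h1 h2] x0 xq; rewrite (leq_ltn_trans xq h1) /=.
  move: xq; rewrite leq_eqVlt => /predU1P[/val_inj ->|xq] //.
  rewrite ltnNge leq_eqVlt negb_or; apply/andP; split.
    by apply/eqP => /val_inj e; move: (ltn_trans xq h1); rewrite -e permKV ltnn.
  apply/negP => lt; have y0 : 0 < (pi^-1)%g x.
    rewrite lt0n; apply/eqP => e; have := pi0 _ e; rewrite permKV => x0'.
    by rewrite x0' in x0.
  by have := pi132 _ _ _ y0 lt h2; rewrite !permKV xq h1.
move=> /is_crossP[p pD [<- <-]] a0 ap b0 bp.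
have an : a' < n by apply: leq_ltn_trans ap _.
have bn : b' < n by apply: leq_ltn_trans bp _.
rewrite (is_crossE _ an bn); apply: (up (p.1, Ordinal bn)) => //.
exact: leftward.
Qed.

Lemma diagram_1_1 : pi != 1%g -> D 1 1.
Proof.
move=> pi1; have [/eqP D0|[p pD]] := set_0Vmem (diagram pi).
  case/eqP: pi1; apply: diagram_inj; rewrite (eqP D0); apply/esym/setP => p.
  rewrite mem_diagram inE invg1 !perm1; apply/negbTE/negP => /andP[h1 h2].
  by have := ltn_trans h1 h2; rewrite ltnn.
have h : D p.1 p.2 by rewrite is_cross_pos.
have [h1 h2] := diagram_gt0 h.
exact: diagram_down h _ _ _ _.
Qed.

Lemma sum_diagram_row a : \sum_(j < n) D a j = \sum_(j < n) D a j.+1.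
Proof.
transitivity (\sum_(j < n.+1) D a j).
  rewrite big_ord_recr /= [X in _ + X](_ : _ = 0) ?addn0 //.
  by apply/eqP; rewrite eqb0; apply/negP => /is_cross_bound[_]; rewrite ltnn.
rewrite big_ord_recl /= [X in X + _](_ : _ = 0) //.
by apply/eqP; rewrite eqb0; apply/negP => /diagram_gt0[].
Qed.

Lemma sum_diagram_col b : \sum_(j < n) D j b = \sum_(j < n) D j.+1 b.
Proof.
transitivity (\sum_(j < n.+1) D j b).
  rewrite big_ord_recr /= [X in _ + X](_ : _ = 0) ?addn0 //.
  by apply/eqP; rewrite eqb0; apply/negP => /is_cross_bound[]; rewrite ltnn.
rewrite big_ord_recl /= [X in X + _](_ : _ = 0) //.
by apply/eqP; rewrite eqb0; apply/negP => /diagram_gt0[].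
Qed.

Lemma ltn_sum_diagram_row a b : (b < \sum_(j < n) D a j) = D a b.+1.
Proof.
rewrite sum_diagram_row; apply: (ltn_sum_antitone (f := fun j => D a j.+1)).
  by move=> j h; have [? _] := diagram_gt0 h; apply: diagram_down h _ _ _ _.
by move=> j /is_cross_bound[_ /ltnW].
Qed.

Lemma ltn_sum_diagram_col a b : (a < \sum_(j < n) D j b) = D a.+1 b.
Proof.
rewrite sum_diagram_col; apply: (ltn_sum_antitone (f := fun j => D j.+1 b)).
  by move=> j h; have [_ ?] := diagram_gt0 h; apply: diagram_down h _ _ _ _.
by move=> j /is_cross_bound[/ltnW].
Qed.

(** The rows of D start in column 1 and have no gaps, so pushing D to the left moves it by one
    column. *)
Lemma bottom_pdE a b : is_cross (bottom_pd pi) a b = D a b.+1.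
Proof.
have [an|an] := ltnP a n; last first.
  by apply/idP/idP => /is_cross_bound[]; rewrite ltnNge an.
have [bn|bn] := ltnP b n; last first.
  apply/idP/idP => /is_cross_bound[_]; rewrite ltnNge ?bn // (leq_trans bn) //.
rewrite (is_crossE _ an bn) inE /= -ltn_sum_diagram_row -sum_is_cross_row.
by congr (_ < #|pred_of_set _|); apply/setP => p; rewrite !inE -val_eqE.
Qed.

Lemma top_pdE a b : is_cross (top_pd pi) a b = D a.+1 b.
Proof.
have [bn|bn] := ltnP b n; last first.
  by apply/idP/idP => /is_cross_bound[_]; rewrite ltnNge bn.
have [an|an] := ltnP a n; last first.
  apply/idP/idP => /is_cross_bound[]; rewrite ltnNge ?an // (leq_trans an) //.
rewrite (is_crossE _ an bn) inE /= -ltn_sum_diagram_col -sum_is_cross_col.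
by congr (_ < #|pred_of_set _|); apply/setP => p; rewrite !inE -val_eqE.
Qed.

Lemma is_crossU (A B : {set pos n}) a b : is_cross (A :|: B) a b = is_cross A a b || is_cross B a b.
Proof.
apply/is_crossP/orP => [[p]|[]/is_crossP[p pA h]]; last 2 first.
- by exists p; rewrite // inE pA.
- by exists p; rewrite // inE pA orbT.
by rewrite inE => /orP[] pA h; [left|right]; apply/is_crossP; exists p.
Qed.

Lemma core_regionE a b : is_cross (core_region pi) a b = D a b.+1 || D a.+1 b.
Proof. by rewrite is_crossU bottom_pdE top_pdE. Qed.

Lemma card_bottom_pd : #|bottom_pd pi| = #|diagram pi|.
Proof.
rewrite !card_sum_is_cross; apply: eq_bigr => a _; rewrite sum_diagram_row.
by apply: eq_bigr => b _; rewrite bottom_pdE.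
Qed.

Lemma card_ord_lt k : k <= n -> #|[set x : 'I_n | x < k]| = k.
Proof.
move=> kn; rewrite cardsE -sum1_card -[RHS]card_ord -[RHS]sum1_card.
by rewrite (big_ord_widen n (fun=> 1) kn).
Qed.

(* The a + 1 values 0,..,a occupy position 0 and positions beyond b. *)
Lemma diagram_triangle a b : D a b -> a + b < n.
Proof.
move=> h; have [a0 b0] := diagram_gt0 h; have [an bn] := is_cross_bound h.
pose A := [set (pi^-1)%g x | x in [set x : 'I_n | x < a.+1]].
pose B := [set x : 'I_n | x < b.+1].
have cA : #|A| = a.+1 by rewrite card_imset ?card_ord_lt //; apply: perm_inj.
have cB : #|B| = b.+1 by rewrite card_ord_lt.
have n0 : 0 < n by apply: leq_ltn_trans an.
have AB : A :&: B \subset [set Ordinal n0].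
  apply/subsetP => y /setIP[/imsetP[x + ->]]; rewrite !inE ltnS => xa xb.
  have [x0|x0] := posnP (nat_of_ord x).
    apply/eqP/(@perm_inj _ pi)/val_inj; have [pi0 _] := pi_dominant.
    by rewrite permKV /= pi0.
  have := diagram_down h x0 xa b0 (leqnn b); rewrite (is_crossE _ (ltn_ord x) bn) mem_diagram /=.
  rewrite (_ : Ordinal (ltn_ord x) = x); last exact: val_inj.
  by case/andP => _; rewrite ltnNge -ltnS xb.
have := cardsUI A B; rewrite cA cB.
have := subset_leq_card AB; rewrite cards1.
have := max_card (A :|: B); rewrite card_ord; lia.
Qed.

End Dominant.

(** * Strands of an arbitrary filling *)

Section PipeLabels.
Variables (n : nat) (C : {set pos n}).
Local Notation X := (is_cross C).

(* Strand labels: hrow a g b is the strand entering tile (a, b) from the left  *)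
(* if g gives the strands entering row a from below, and up k gives the        *)
(* strands leaving the k lowest rows at the top.                               *)
Fixpoint hrow (a : nat) (g : nat -> nat) (b : nat) : nat :=
  if b is b'.+1 then if X a b' then hrow a g b' else g b' else a.

Fixpoint up (k b : nat) : nat :=
  if k is k'.+1 then if X (n - k) b then up k' b else hrow (n - k) (up k') b
  else n + b.

Definition enter_below a b := up (n - a.+1) b.
Definition enter_left a b := hrow a (enter_below a) b.
Definition exit_above a b := up (n - a) b.

Lemma enter_belowE a b : enter_below a b = exit_above a.+1 b. Proof. by []. Qed.

Lemma enter_left0 a : enter_left a 0 = a. Proof. by []. Qed.

Lemma enter_leftS a b : enter_left a b.+1 = if X a b then enter_left a b else enter_below a b. Proof. by []. Qed.

Lemma exit_aboveE a b : a < n -> exit_above a b = if X a b then enter_below a b else enter_left a b.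
Proof.
move=> an; rewrite /exit_above /left /enter_below; have -> : n - a = (n - a.+1).+1 by lia.
by rewrite /=; have -> : n - (n - a.+1).+1 = a by lia.
Qed.

Lemma exit_above_n b : exit_above n b = n + b. Proof. by rewrite /exit_above subnn. Qed.

(** Strands move only up and to the right: what leaves the k lowest rows entered in one of them, or
    through the bottom of the grid, where the labels are n + b. *)
Lemma up_ge k b : k <= n -> n - k <= up k b.
Proof.
elim: k b => [|k IH] b kn; first by rewrite subn0 leq_addr.
have IH' c : n - k.+1 <= up k c by apply: leq_trans (IH c (ltnW kn)); rewrite leq_sub2l.
rewrite /=; case: ifP => // _; elim: b => //= b IHb.
by case: ifP.
Qed.

Lemma enter_below_gt a b : a < n -> a < enter_below a b.
Proof. by move=> an; rewrite -{1}(subKn an); apply: up_ge; rewrite leq_subr. Qed.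

Section LowStrands.
Variable a2 : nat.
Hypothesis a2n : a2 < n.
Local Notation low x := (x <= a2 : nat).
Local Notation A a b := (\sum_(j < b) low (exit_above a j)).
Local Notation B a b := (\sum_(j < b) low (enter_below a j)).

(** Conservation in the first b tiles of row a: low strands come in from below or as the strand of
    row a itself, which is the 1, and leave at the top or to the right. *)
Lemma count_low a b : a <= a2 -> A a b + low (enter_left a b) = B a b + 1.
Proof.
move=> aa; have an : a < n by apply: leq_ltn_trans aa a2n.
elim: b => [|b IH]; first by rewrite !big_ord0 enter_left0 aa.
rewrite !big_ord_recr /= exit_aboveE // enter_leftS.
by case: ifP => _; [rewrite addnAC|]; rewrite IH addnAC.
Qed.

Lemma count_low_le a a' b : a' <= a -> a <= a2 -> A a b <= A a' b.
Proof.
move=> /subnK <-; elim: (a - a') => // k IH h; rewrite addSn in h.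
apply: leq_trans (IH (ltnW h)).
have cl : A (k + a') b + low (enter_left (k + a') b) = A (k + a').+1 b + 1 := count_low b (ltnW h).
by rewrite addSn -(leq_add2r 1) -cl leq_add2l leq_b1.
Qed.

Lemma count_low_widen a b b' : b <= b' -> A a b <= A a b'.
Proof.
move=> bb; rewrite (big_ord_widen b' (fun j => low (exit_above a j)) bb).
by rewrite [leqLHS]big_mkcond leq_sum // => i _; case: ifP.
Qed.

(* If only one strand from the rows up to a2 reached the top in the columns up *)
(* to b2, then the lower elbow would send it up left of column b2, so that a   *)
(* strand from below turns right at the upper elbow, and the number of low     *)
(* strands grows in row a1.                                                    *)
Lemma two_low_strands a1 b1 b2 : a1 < a2 -> b1 < b2 -> ~~ X a1 b2 -> ~~ X a2 b1 ->
  1 < A 0 b2.+1.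
Proof.
move=> a12 b12 h1 h2.
have e1 : 0 < A a2 b2.
  apply: leq_trans (count_low_widen _ b12).
  have := count_low b1.+1 (leqnn a2); rewrite enter_leftS (negPf h2).
  by rewrite (leqNgt (enter_below _ _)) enter_below_gt // addn0 => ->; rewrite addn1.
have e2 : 0 < B a1 b2 by apply: leq_trans e1 _; apply: count_low_le.
apply: leq_trans (count_low_le _ (leq0n a1) (ltnW a12)).
have := count_low b2.+1 (ltnW a12); rewrite enter_leftS (negPf h1) [in RHS]big_ord_recr /= addnAC.
by move=> /addIn ->; rewrite addn1 ltnS.
Qed.

End LowStrands.

(* Frontier of the tiles below row a together with the first b tiles of row a: *)
(* the left edges of the rows above, then the upper edges of the treated tiles *)
(* of row a, the current edge, and the lower edges of the other tiles of row a.*)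
Definition frontier a b p : nat :=
  if p < a then p else if p < a + b then exit_above a (p - a)
  else if p == a + b then enter_left a b else enter_below a (p - a.+1).

Definition swap (x p : nat) : nat :=
  if p == x then x.+1 else if p == x.+1 then x else p.

(** An elbow leaves the frontier unchanged and a cross exchanges two neighbouring entries. *)
Lemma frontierS a b p : a < n ->
  frontier a b.+1 p = frontier a b (if X a b then swap (a + b) p else p).
Proof.
move=> an; rewrite /frontier /swap addnS.
have [e|ne1] := eqVneq p (a + b).
  rewrite e ltnS leqnn ltnNge leq_addr /= addKn exit_aboveE //.
  case: ifP => _; last by rewrite ltnNge leq_addr ltnn eqxx.
  rewrite ltnNge (leq_trans (leq_addr b a)) // ltnNge leqnSn /= gtn_eqF // -addSn addKn //.
have [e|ne2] := eqVneq p (a + b).+1.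
  rewrite e ltnNge (leq_trans (leq_addr b a)) // ltnn /= enter_leftS; case: ifP => _.
    by rewrite ltnNge leq_addr ltnn eqxx.
  by rewrite ltnNge (leq_trans (leq_addr b a)) // ltnNge leqnSn /= gtn_eqF // -addSn addKn.
have -> : (if X a b then p else p) = p by case: ifP.
by case: (p < a) => //; rewrite ltnS [p <= _]leq_eqVlt (negPf ne1).
Qed.

Lemma frontier_next a b p : p < a.+1 + b -> frontier a 0 p = frontier a.+1 b p.
Proof.
move=> pb; rewrite /frontier addn0 pb ltnS [p <= a]leq_eqVlt.
have [->|ne] := eqVneq p a; first by rewrite ltnn enter_left0.
by case: (p < a) => //=; rewrite enter_belowE.
Qed.

Lemma frontier_start p : 0 < n -> frontier n.-1 0 p = p.
Proof.
move=> n0; rewrite /frontier addn0; case: ltnP => // h.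
case: eqP => [->|/eqP ne] //; rewrite enter_belowE prednK // exit_above_n subnKC //.
by rewrite -(prednK n0) ltn_neqAle eq_sym ne.
Qed.

Lemma frontier_ind (P : nat -> nat -> Prop) : (0 < n -> P n.-1 0) ->
    (forall a b, a < n -> P a b -> P a b.+1) ->
    (forall a, a.+1 < n -> (forall b, P a.+1 b) -> P a 0) ->
  forall a b, a < n -> P a b.
Proof.
move=> P0 Pstep Prow a; have [k] := ubnP (n - a); elim: k a => // k IH a kn b an.
elim: b => [|b IHb]; last exact: Pstep.
have [->|ne] := eqVneq a n.-1; first by apply: P0; apply: leq_ltn_trans an.
have an' : a.+1 < n by move/eqP: ne; clear -an; lia.
by apply: Prow => // b; apply: IH => //; clear -kn an'; lia.
Qed.

Definition treated a b a' b' := (a < a') || ((a' == a) && (b' < b)).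

Definition crossing x y a b :=
  X a b /\ ((enter_left a b = x /\ enter_below a b = y) \/ (enter_left a b = y /\ enter_below a b = x)).

Definition crossed a b x y := exists a' b', crossing x y a' b' /\ treated a b a' b'.

Lemma treatedS a b a' b' : treated a b a' b' -> treated a b.+1 a' b'.
Proof. by case/orP => [h|/andP[h h']]; rewrite /treated ?h // ltnS (ltnW h') orbT. Qed.

Lemma treated_row a b a' b' : treated a.+1 b a' b' -> treated a 0 a' b'.
Proof. by case/orP => [/ltnW|/andP[/eqP -> _]]; rewrite /treated ?ltnSn // => ->. Qed.

Lemma frontier_above_tile a b : frontier a b (a + b) = enter_left a b.
Proof. by rewrite /frontier ltnNge leq_addr ltnn eqxx. Qed.

Lemma frontier_below_tile a b : frontier a b (a + b).+1 = enter_below a b.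
Proof.
by rewrite /frontier !ltnNge (leq_trans (leq_addr b a)) // leqnSn /= gtn_eqF // -addSn addKn.
Qed.

Lemma swap_inj x : injective (swap x).
Proof.
by rewrite /swap => p q; do 4?[case: eqP => ?]; lia.
Qed.

Lemma frontier_inj a b : a < n -> injective (frontier a b).
Proof.
move: a b; apply: frontier_ind => [n0 p q|a b an inj p q|a an inj p q].
- by rewrite !frontier_start.
- by rewrite !frontierS //; case: ifP => _; [move=> /inj/swap_inj|apply: inj].
- rewrite !(@frontier_next _ (p + q)); [exact: inj|clear; lia|clear; lia].
Qed.

(** The frontier starts out increasing, and a cross changes only the order of the two strands that
    meet there. *)
Lemma frontier_inversion a b p q : a < n -> p < q -> frontier a b q < frontier a b p ->
  crossed a b (frontier a b p) (frontier a b q).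
Proof.
move=> an; move: p q; move: a b an.
apply: frontier_ind => [n0 p q pq|a b an cr p q pq|a an cr p q pq].
- by rewrite !frontier_start // => h; move: (ltn_trans pq h); rewrite ltnn.
- have cr' x y : crossed a b x y -> crossed a b.+1 x y.
    by move=> [a' [b' [h1 h2]]]; exists a', b'; split=> //; apply: treatedS.
  rewrite !frontierS //; case: ifP => Xab; last by move=> lt; apply: cr'; apply: cr.
  have [/andP[/eqP ep /eqP eq]|ne] := boolP ((p == a + b) && (q == (a + b).+1)).
    have -> : swap (a + b) p = (a + b).+1 by rewrite /swap ep eqxx.
    have -> : swap (a + b) q = a + b by rewrite /swap eq eqxx gtn_eqF.
    rewrite frontier_above_tile frontier_below_tile => _; exists a, b.
    by split; [split=> //; right|rewrite /treated eqxx ltnSn orbT].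
  move=> lt; apply: cr'; apply: cr => //.
  by move: ne pq; rewrite /swap; clear; do 4?[case: eqP => ?]; lia.
- rewrite !(@frontier_next _ (p + q)); [|clear; lia|clear; lia] => h.
  have [a' [b' [h1 h2]]] := cr _ _ _ pq h.
  by exists a', b'; split=> //; apply: treated_row h2.
Qed.

(** The cross that puts the two strands back in increasing order is preceded by an inversion, which
    [frontier_inversion] traces to an earlier cross. One of these two crosses differs from the given
    one. *)
Lemma frontier_double_crossing a b p q a1 b1 : a < n -> p < q ->
    frontier a b p < frontier a b q ->
    treated a b a1 b1 -> crossing (frontier a b p) (frontier a b q) a1 b1 ->
  exists a2 b2, [/\ treated a b a2 b2, crossing (frontier a b p) (frontier a b q) a2 b2
    & (a2, b2) <> (a1, b1)].
Proof.
move=> an; move: p q a1 b1; move: a b an.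
have nt a b : ~~ treated a b a b by rewrite /treated ltnn eqxx ltnn.
apply: frontier_ind => [n0 p q a1 b1 _ _|a b an IH p q a1 b1 pq|a an IH p q a1 b1 pq].
- by move=> t1 [/is_cross_bound[h _] _]; move: t1; rewrite /treated; clear -h; lia.
- rewrite !frontierS //; case: ifP => Xab lt t1 c1.
    have [/andP[/eqP ep /eqP eq]|ne] := boolP ((p == a + b) && (q == (a + b).+1)).
      move: lt c1; have -> : swap (a + b) p = (a + b).+1 by rewrite /swap ep eqxx.
      have -> : swap (a + b) q = a + b by rewrite /swap eq eqxx gtn_eqF.
      move=> lt c1; have [a0 [b0 [c0 t0]]] := frontier_inversion an (ltnSn _) lt.
      have flip x y a' b' : crossing x y a' b' -> crossing y x a' b'.
        by case=> h1 [] h2; split=> //; [right|left].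
      have [e|ne] := eqVneq (a1, b1) (a, b); last first.
        exists a, b; split; first by rewrite /treated eqxx ltnSn orbT.
          rewrite frontier_above_tile frontier_below_tile; split=> //; by right.
        by move=> e; rewrite e eqxx in ne.
      exists a0, b0; split; [exact: treatedS|exact: flip|].
      by rewrite e => -[e1 e2]; move: t0; rewrite e1 e2 (negPf (nt _ _)).
    have slt : swap (a + b) p < swap (a + b) q.
      by move: ne pq; rewrite /swap; clear; do 4?[case: eqP => ?]; lia.
    have t1' : treated a b a1 b1.
      move: t1; rewrite /treated ltnS => /orP[->//|/andP[/eqP e1]].
      rewrite leq_eqVlt => /predU1P[e2|->]; last by rewrite e1 eqxx orbT.
      subst a1 b1; case: c1 => _; rewrite -frontier_above_tile -frontier_below_tile.
      by case=> -[/(frontier_inj an) e1 /(frontier_inj an) e2];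
        move: ne pq e1 e2; rewrite /swap; clear; do 4?[case: eqP => ?]; lia.
    have [a2 [b2 [t2 c2 n2]]] := IH _ _ _ _ slt lt t1' c1.
    by exists a2, b2; split=> //; apply: treatedS.
  have t1' : treated a b a1 b1.
    move: t1; rewrite /treated ltnS => /orP[->//|/andP[/eqP e1]].
    rewrite leq_eqVlt => /predU1P[e2|->]; last by rewrite e1 eqxx orbT.
    by case: c1; rewrite e1 e2 Xab.
  have [a2 [b2 [t2 c2 n2]]] := IH _ _ _ _ pq lt t1' c1.
  by exists a2, b2; split=> //; apply: treatedS.
- rewrite !(@frontier_next _ (p + q + b1)); [|clear; lia|clear; lia] => lt t1 c1.
  (* Going [(p + q + b1).+1] tiles into the row below is far enough for the positions p and q and
     for the tile (a1, b1). *)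
  have t1' : treated a.+1 (p + q + b1).+1 a1 b1.
    by move: t1; rewrite /treated; clear; lia.
  move: lt c1; rewrite -!(@frontier_next _ (p + q + b1)) ?(@frontier_next _ (p + q + b1).+1);
    [|clear; lia|clear; lia|clear; lia|clear; lia] => lt c1.
  have [a2 [b2 [t2 c2 n2]]] := IH _ _ _ _ _ pq lt t1' c1.
  by exists a2, b2; split=> //; apply: treated_row t2.
Qed.

Lemma frontier_top b p : p < b -> frontier 0 b p = exit_above 0 p.
Proof. by move=> pb; rewrite /frontier add0n pb subn0. Qed.

Lemma exit_top_inj : 0 < n -> injective (exit_above 0).
Proof.
move=> n0 p q; have := @frontier_inj 0 (p + q).+1 n0 p q.
by rewrite !frontier_top //; lia.
Qed.

Lemma exit_top_inversion p q : 0 < n -> p < q -> exit_above 0 q < exit_above 0 p ->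
  exists a b, crossing (exit_above 0 p) (exit_above 0 q) a b.
Proof.
move=> n0 pq; have := @frontier_inversion 0 q.+1 p q n0 pq; rewrite !frontier_top //; last by lia.
by move=> h /h[a [b [h1 _]]]; exists a, b.
Qed.

Lemma exit_top_double_crossing p q a1 b1 : 0 < n -> p < q -> exit_above 0 p < exit_above 0 q ->
    crossing (exit_above 0 p) (exit_above 0 q) a1 b1 ->
  exists a2 b2, crossing (exit_above 0 p) (exit_above 0 q) a2 b2 /\ (a2, b2) <> (a1, b1).
Proof.
move=> n0 pq; have := @frontier_double_crossing 0 (q + b1).+1 p q a1 b1 n0 pq.
rewrite !frontier_top; [|clear; lia|clear -pq; lia] => h lt.
have t1 : treated 0 (q + b1).+1 a1 b1 by rewrite /treated; clear; lia.
by move=> /(h lt t1)[a2 [b2 [_ h2 h3]]]; exists a2, b2.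
Qed.

Lemma enter_left_neq_below a b : a < n -> enter_left a b <> enter_below a b.
Proof.
move=> an; rewrite -frontier_above_tile -frontier_below_tile.
by move=> /(frontier_inj an)/eqP; rewrite ltn_eqF.
Qed.

Section Walk.
Hypothesis triC : C \subset triangle n.

Lemma cross_triangle a b : X a b -> (a + b).+1 < n.
Proof.
by move=> /is_crossP[p pC [<- <-]]; move/subsetP: triC => /(_ p pC); rewrite inE.
Qed.

(** The fuel [a + (n - b)] covers the moves up and to the right that remain. The bound on [a + b] is
    preserved because crosses lie in the triangle, and it keeps the walk inside the grid. *)
Lemma walk_label k a b fl x0 s : a < n -> a + b + ~~ fl < n -> a + (n - b) <= k ->
  (if fl then enter_left a b else enter_below a b) = s ->
  (exists2 j, last x0 (walk C k a b fl) = (0, j) & j < n /\ exit_above 0 j = s) /\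
  (forall x y, (x, y) \in walk C k a b fl -> enter_left x y = s \/ enter_below x y = s).
Proof.
elim: k a b fl x0 => [|k IH] a b fl x0 an ab kab es; first by exfalso; lia.
have sE : enter_left a b = s \/ enter_below a b = s by move: es; case: ifP => _; [left|right].
have bn : b < n by lia.
have tri := @cross_triangle a b.
rewrite /=; case: ifP => turn.
  have sA : exit_above a b = s.
    by rewrite exit_aboveE // -es; case: (fl) (X a b) turn => [] [].
  case: a an ab kab es sE turn sA tri => [|a] an ab kab es sE turn sA tri.
    split=> [|x y]; first by exists b; rewrite // sA.
    by rewrite inE => /eqP[-> ->].
  have [||| [j lj jn] mem] := IH a b false (a.+1, b) _ _ _ sA; try lia.
  split; first by exists j.
  by move=> x y; rewrite inE => /predU1P[[-> ->] //|/mem].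
have sL : enter_left a b.+1 = s.
  by rewrite enter_leftS -es; case: (fl) (X a b) turn => [] [].
have [||| [j lj jn] mem] := IH a b.+1 true (a, b) _ _ _ sL; try lia.
split; first by exists j.
by move=> x y; rewrite inE => /predU1P[[-> ->] //|/mem].
Qed.

Lemma strand_label (i : 'I_n) :
  (exists2 j, last (i : nat, 0) (strand C i) = (0, j) & j < n /\ exit_above 0 j = i) /\
  (forall x y, (x, y) \in strand C i -> enter_left x y = i \/ enter_below x y = i).
Proof. by apply: walk_label => //; rewrite ?addn0 ?subn0 -?addnn ?leq_add2r // ltnW. Qed.

Lemma frontier_bound a b p : a < n -> p < n -> frontier a b p < n.
Proof.
move=> an; move: p; move: a b an; apply: frontier_ind => [n0 p pn|a b an IH p pn|a an IH p pn].
- by rewrite frontier_start.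
- rewrite frontierS //; case: ifP => [/cross_triangle h|_]; last exact: IH.
  apply: IH; move: h pn; rewrite /swap; clear; do 2?[case: eqP => ?]; lia.
- by rewrite (@frontier_next _ p) ?IH //; clear; lia.
Qed.

(** The strand is followed backwards from the tile to its entry. The equation records the fuel left:
    2n minus s - a moves up and b moves to the right. *)
Lemma label_strand a b (fl : bool) (s : 'I_n) : a < n -> b < n ->
    (if fl then enter_left a b else enter_below a b) = s ->
  exists k pre, k + s + b = n.*2 + a /\ strand C s = pre ++ walk C k a b fl.
Proof.
have [N] := ubnP (((n - a) + b).*2 + ~~ fl); elim: N a b fl => // N IH a b fl aN an bn.
have pred a' b' fl' : ((n - a') + b').*2 + ~~ fl' < N -> a' < n -> b' < n ->
    (if fl' then enter_left a' b' else enter_below a' b') = s ->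
    exists k pre, k.+1 + s + b' = n.*2 + a' /\ strand C s = pre ++ walk C k.+1 a' b' fl'.
  move=> h1 h2 h3 h4; have [[|k] [pre [h5 h6]]] := IH a' b' fl' h1 h2 h3 h4; last by exists k, pre.
  by exfalso; have := ltn_ord s; clear -h5 h3; lia.
case: fl aN => aN.
  case: b bn aN => [|b] bn aN; first by rewrite enter_left0 => e; exists n.*2, [::]; rewrite e addn0.
  rewrite enter_leftS => e; have [||||k [pre [h1 h2]]] := pred a b (X a b) => //.
  - by case: (X a b); clear -aN; lia.
  - exact: ltnW.
  by exists k, (rcons pre (a, b)); rewrite h2 cat_rcons /= addbb; split=> //; clear -h1; lia.
rewrite enter_belowE => e; have an' : a.+1 < n.
  move: an; rewrite leq_eqVlt => /predU1P[an|//]; move: e; rewrite an exit_above_n => e.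
  by have := ltn_ord s; rewrite -e ltnNge leq_addr.
rewrite exit_aboveE // in e; have [||||k [pre [h1 h2]]] := pred a.+1 b (~~ X a.+1 b) => //.
- by case: (X a.+1 b); clear -aN an'; lia.
- by case: (X a.+1 b) e.
exists k, (rcons pre (a.+1, b)); rewrite h2 cat_rcons /= addNb addbb.
by split=> //; clear -h1; lia.
Qed.

Lemma label_in_strand a b (s : 'I_n) : a < n -> b < n -> enter_left a b = s \/ enter_below a b = s ->
  (a, b) \in strand C s.
Proof.
move=> an bn e; have [fl e'] : exists fl : bool, (if fl then enter_left a b else enter_below a b) = s.
  by case: e => e; [exists true|exists false].
have [[|k] [pre [h ->]]] := label_strand an bn e'; last by rewrite mem_cat /= mem_head orbT.
by exfalso; have := ltn_ord s; clear -h bn; lia.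
Qed.

Lemma exits_atE (i j : 'I_n) : exits_at C i j = (exit_above 0 j == i).
Proof.
have [[k lk [kn ak]] _] := strand_label i; rewrite /exits_at lk.
have n0 : 0 < n by apply: leq_ltn_trans kn.
apply/eqP/eqP => [[<-] //|e]; congr (_, _).
by apply: (exit_top_inj n0); rewrite ak e.
Qed.

End Walk.
End PipeLabels.

(** * Inversions and crosses *)

Section InversionTiles.
Variables (n : nat) (C : {set pos n}) (w : 'S_n).
Hypothesis triC : C \subset triangle n.
Hypothesis topw : forall j : 'I_n, exit_above C 0 j = w j.
Implicit Types p q : pos n.

Definition tile_of_inversion q p := crossing C (w q.2) q.1 p.1 p.2.

Lemma inversion_tile q : q \in diagram w -> exists2 p, p \in C & tile_of_inversion q p.
Proof.
rewrite mem_diagram => /andP[h1 h2].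
have n0 : 0 < n by apply: leq_ltn_trans (ltn_ord q.1).
have lt : exit_above C 0 ((w^-1)%g q.1) < exit_above C 0 q.2 by rewrite !topw permKV.
have [a [b cr]] := exit_top_inversion n0 h2 lt; have [Xab _] := cr.
have [p pC [ep1 ep2]] := is_crossP _ _ _ Xab; exists p => //.
by move: cr; rewrite /tile_of_inversion ep1 ep2 !topw permKV.
Qed.

Lemma tile_of_inversion_inj q q' p : q \in diagram w -> q' \in diagram w ->
  tile_of_inversion q p -> tile_of_inversion q' p -> q = q'.
Proof.
rewrite !mem_diagram => /andP[h _] /andP[h' _] [_ l] [_ l'].
have [[e1 e2]|[e1 e2]] : (q.1 = q'.1 :> nat /\ w q.2 = w q'.2 :> nat) \/
    (q.1 = w q'.2 :> nat /\ w q.2 = q'.1 :> nat).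
  by move: l l' => [] [-> ->] [] [e1 e2]; [left|right|right|left].
- by rewrite [q]surjective_pairing (val_inj e1) (perm_inj (val_inj e2)) -surjective_pairing.
- by rewrite e1 e2 in h; move: (ltn_trans h h'); rewrite ltnn.
Qed.

(** Different inversions involve different pairs of strands, so the crosses chosen for them are
    different. *)
Lemma inversion_tiles : exists f : pos n -> pos n, {in diagram w &, injective f} /\
  (forall q, q \in diagram w -> f q \in C /\ tile_of_inversion q (f q)).
Proof.
pose P q p := (p \in C) && (((enter_left C p.1 p.2 == w q.2) && (enter_below C p.1 p.2 == q.1)) ||
   ((enter_left C p.1 p.2 == q.1) && (enter_below C p.1 p.2 == w q.2))).
pose f q := odflt q [pick p | P q p].
have fP q : q \in diagram w -> f q \in C /\ tile_of_inversion q (f q).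
  move=> qD; rewrite /f; case: pickP => [p /andP[pC l]|none].
    split=> //; split; first by rewrite is_cross_pos.
    by case/orP: l => /andP[/eqP e1 /eqP e2]; [left|right].
  have [p pC [_ l]] := inversion_tile qD; have := none p; rewrite /P pC.
  by case: l => -[-> ->]; rewrite !eqxx ?orbT.
exists f; split=> // q q' qD q'D E.
by apply: (@tile_of_inversion_inj q q' (f q)) => //; [|rewrite E]; apply: (fP _ _).2.
Qed.

Lemma card_diagram_le : #|diagram w| <= #|C|.
Proof.
have [f [f_inj fP]] := inversion_tiles; rewrite -(card_in_imset f_inj).
by apply/subset_leq_card/subsetP => _ /imsetP[q qD ->]; apply: (fP q qD).1.
Qed.

Lemma reduced_tile_unique (s t : 'I_n) p p' : reduced C -> s != t -> p \in C -> p' \in C ->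
    (enter_left C p.1 p.2 = s \/ enter_below C p.1 p.2 = s) -> (enter_left C p.1 p.2 = t \/ enter_below C p.1 p.2 = t) ->
    (enter_left C p'.1 p'.2 = s \/ enter_below C p'.1 p'.2 = s) ->
    (enter_left C p'.1 p'.2 = t \/ enter_below C p'.1 p'.2 = t) -> p = p'.
Proof.
move=> /forallP/(_ s)/forallP/(_ t)/implyP red /red/card_le1_eqP h pC p'C h1 h2 h3 h4.
by apply: h; rewrite inE ?pC ?p'C /= /tile !label_in_strand.
Qed.

(** By [exit_top_double_crossing], strands that cross and yet exit in increasing order cross twice.
    So every cross of a reduced filling belongs to an inversion, and no inversion has two
    crosses. *)
Lemma reduced_card_le_diagram : reduced C -> #|C| <= #|diagram w|.
Proof.
move=> red.
have ex p : p \in C -> exists2 q, q \in diagram w & tile_of_inversion q p.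
  move=> pC; have n0 : 0 < n by apply: leq_ltn_trans (ltn_ord p.1).
  have Xp : is_cross C p.1 p.2 by rewrite is_cross_pos.
  have tri := cross_triangle triC Xp.
  have ln : enter_left C p.1 p.2 < n.
    by rewrite -frontier_above_tile frontier_bound // ltnW.
  have bn : enter_below C p.1 p.2 < n by rewrite -frontier_below_tile frontier_bound.
  have main (x y : 'I_n) : x < y -> crossing C (w x) (w y) p.1 p.2 ->
      exists2 q, q \in diagram w & tile_of_inversion q p.
    move=> xy cr; exists (w y, x) => //=; rewrite mem_diagram /= permK xy andbT.
    have wxy : w x != w y by rewrite (inj_eq perm_inj) -val_eqE neq_ltn xy.
    rewrite ltn_neqAle eq_sym val_eqE wxy /= leqNgt; apply/negP => lt.
    have cr' : crossing C (exit_above C 0 x) (exit_above C 0 y) p.1 p.2 by rewrite !topw.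
    have lt' : exit_above C 0 x < exit_above C 0 y by rewrite !topw.
    have [a2 [b2 [cr2 ne]]] := exit_top_double_crossing n0 xy lt' cr'.
    have [p' p'C [e1 e2]] := is_crossP _ _ _ cr2.1.
    have [_ l] := cr; have [_ l'] := cr2; rewrite -e1 -e2 !topw in l' ne.
    case: ne; suff -> : p = p' by [].
    apply: (reduced_tile_unique red wxy pC p'C);
      by [case: l => -[-> ->]; auto|case: l' => -[-> ->]; auto].
  pose x := (w^-1)%g (Ordinal ln); pose y := (w^-1)%g (Ordinal bn).
  have wx : w x = enter_left C p.1 p.2 :> nat by rewrite permKV.
  have wy : w y = enter_below C p.1 p.2 :> nat by rewrite permKV.
  have [xy|yx|e] := ltngtP x y.
  - by apply: (main x y xy); rewrite wx wy; split=> //; left.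
  - by apply: (main y x yx); rewrite wx wy; split=> //; right.
  - case: (@enter_left_neq_below _ C p.1 p.2 (ltn_ord _)).
    by rewrite -wx -wy (val_inj e).
pose P p q := (q \in diagram w) && (((enter_left C p.1 p.2 == w q.2) && (enter_below C p.1 p.2 == q.1)) ||
   ((enter_left C p.1 p.2 == q.1) && (enter_below C p.1 p.2 == w q.2))).
pose g p := odflt p [pick q | P p q].
have gP p : p \in C -> g p \in diagram w /\ tile_of_inversion (g p) p.
  move=> pC; rewrite /g; case: pickP => [q /andP[qD l]|none].
    split=> //; split; first by rewrite is_cross_pos.
    by case/orP: l => /andP[/eqP e1 /eqP e2]; [left|right].
  have [q qD [_ l]] := ex p pC; have := none q; rewrite /P qD.
  by case: l => -[-> ->]; rewrite !eqxx ?orbT.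
have g_inj : {in C &, injective g}.
  move=> p p' pC p'C E; have [gD [_ l]] := gP p pC; have [_ [_ l']] := gP p' p'C.
  rewrite -E in l'.
  have ne : w (g p).2 != (g p).1.
    by move: gD; rewrite mem_diagram -val_eqE => /andP[lt _]; rewrite neq_ltn lt orbT.
  apply: (reduced_tile_unique red ne pC p'C);
    by [case: l => -[-> ->]; auto|case: l' => -[-> ->]; auto].
rewrite -(card_in_imset g_inj).
by apply/subset_leq_card/subsetP => _ /imsetP[q qD ->]; apply: (gP q qD).1.
Qed.

End InversionTiles.

(** * Faces of the pipe dream complex *)

Section PipeDreamFaces.
Variables (n : nat) (pi : 'S_n).
Hypothesis pi_dominant : one_dominant pi.
Local Notation D := (is_cross (diagram pi)).

(** Otherwise [two_low_strands] sends two strands of the rows 0..x2 to the columns 0..y2; but for 0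
    < j <= y2 the box (x2, j) of D makes [pi j] larger than x2. *)
Lemma reduced_pipe_dream_elbows (C : {set pos n}) x1 x2 y1 y2 :
  C \in reduced_pipe_dreams pi -> x1 < x2 -> y1 < y2 -> D x2 y2 ->
  is_cross C x1 y2 || is_cross C x2 y1.
Proof.
rewrite inE => /and3P[triC _ /forallP ex] x12 y12 Dxy.
have [x2n y2n] := is_cross_bound Dxy.
have top (j : 'I_n) : exit_above C 0 j = pi j by apply/eqP; rewrite -exits_atE.
apply/negPn/negP; rewrite negb_or => /andP[h1 h2].
have := two_low_strands x2n x12 y12 h1 h2; apply/negP; rewrite -leqNgt.
rewrite big_ord_recl big1 ?addn0 ?leq_b1 // => j _.
have jn : j.+1 < n by apply: leq_ltn_trans (ltn_ord j) y2n.
apply/eqP; rewrite eqb0 -ltnNge lift0 (top (Ordinal jn)).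
have [x20 y20] := diagram_gt0 pi_dominant Dxy.
have := diagram_down pi_dominant Dxy x20 (leqnn _) (ltn0Sn j) (ltn_ord j).
by rewrite (is_crossE _ x2n jn) mem_diagram => /andP[].
Qed.

Section Maximal.
Variable C : {set pos n}.
Hypothesis triC : C \subset triangle n.
Local Notation X := (is_cross C).
Hypothesis free : forall x1 x2 y1 y2, x1 < x2 -> y1 < y2 -> D x2 y2 -> X x1 y2 || X x2 y1.
Hypothesis maximal : forall x y, X x y -> exists x' y', ~~ X x' y' /\
  ([/\ x' < x, y < y' & D x y'] \/ [/\ x < x', y' < y & D x' y]).

Lemma last_elbow a y : (forall y', y' < y -> X a y') \/
  exists y', [/\ y' < y, ~~ X a y' & enter_left C a y = enter_below C a y'].
Proof.
elim: y => [|y IH]; first by left.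
have [h|h] := boolP (X a y); last by right; exists y; rewrite enter_leftS (negPf h).
rewrite enter_leftS h; case: IH => [all|[y' [h1 h2 h3]]].
  by left=> y'; rewrite ltnS leq_eqVlt => /predU1P[->|/all].
by right; exists y'; rewrite ltnW.
Qed.

Lemma corner_elbow : ~~ X 0 0.
Proof. by apply/negP => /maximal[x' [y' [_ []]]] []. Qed.

Section Corner.
Variables (a2 b2 : nat).
Hypothesis Dab : D a2 b2.

Let D_down x y : 0 < x -> x <= a2 -> 0 < y -> y <= b2 -> D x y.
Proof. by move=> h1 h2 h3 h4; apply: diagram_down Dab _ _ _ _. Qed.

(* A strand from the rows up to a2 that crosses the upper edge of row a in the *)
(* columns up to b2 got there from the first elbow of the first row with an    *)
(* elbow in these columns.                                                     *)
Lemma low_strand a y : a <= a2.+1 -> y <= b2 -> exit_above C a y <= a2 ->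
  exists x, [/\ a <= x <= a2, ~~ X x y, forall y', y' < y -> X x y' &
    forall x' y', a <= x' -> x' < x -> y' <= b2 -> X x' y'].
Proof.
have [a2n b2n] := is_cross_bound Dab.
move: a y; suff H k a y : a2.+1 - a = k -> a <= a2.+1 -> y <= b2 -> exit_above C a y <= a2 ->
    exists x, [/\ a <= x <= a2, ~~ X x y, forall y', y' < y -> X x y' &
    forall x' y', a <= x' -> x' < x -> y' <= b2 -> X x' y'] by move=> a y; apply: H erefl.
elim: k a y => [|k IH] a y ak aa yb lowy.
  have ea : a = a2.+1 by lia.
  by move: lowy; rewrite ea -enter_belowE leqNgt enter_below_gt.
have {}aa : a <= a2 by lia.
have an : a < n by apply: leq_ltn_trans aa a2n.
have {}IH y' : y' <= b2 -> enter_below C a y' <= a2 -> exists x, [/\ a < x <= a2, ~~ X x y',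
    forall y'', y'' < y' -> X x y'' & forall x' y'', a < x' -> x' < x -> y'' <= b2 -> X x' y''].
  by apply: IH; lia.
(* If (a, y) is an elbow, the strand came along row a. An earlier elbow in this row would bring it,
   by induction, from an elbow below and to the left of (a, y), against [free]. If (a, y) is a
   cross, the strand came from below, and row a has to consist of crosses. *)
move: lowy; rewrite exit_aboveE //; have [Xay|Xay] := boolP (X a y); last first.
  move=> lowl; exists a; split=> //; first by rewrite leqnn.
    case: (last_elbow a y) => // -[y' [y'y Xay' E]].
    have [x [/andP[ax xa] Xxy' _ _]] : exists x, [/\ a < x <= a2, ~~ X x y',
        forall y'', y'' < y' -> X x y'' & forall x' y'', a < x' -> x' < x -> y'' <= b2 -> X x' y''].
      by apply: IH; rewrite -?E //; lia.
    have := free ax y'y (D_down (leq_ltn_trans (leq0n _) ax) xa (leq_ltn_trans (leq0n _) y'y) yb).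
    by rewrite (negPf Xay) (negPf Xxy').
  by move=> x' y' h1 h2; rewrite leqNgt h2 in h1.
move=> /(IH y yb)[x [/andP[ax xa] Xxy first_y empty]].
suff row_a y' : y' <= b2 -> X a y'.
  exists x; split=> //; first by rewrite (ltnW ax).
  by move=> x' y'; rewrite leq_eqVlt => /predU1P[<- _ /row_a //|]; apply: empty.
move=> y'b; case: (boolP (X a y')) => // nX; exfalso.
(* Let z be the last elbow of row a in these columns. To the right of y it is in conflict with (x,
   y). To the left of y, the cross (x, z) is excluded by some elbow (u, t), whose position always
   contradicts [free], the rows of crosses between a and x, or the choice of z. *)
have exz : exists z, (z <= b2) && ~~ X a z by exists y'; rewrite y'b nX.
have ubz z : (z <= b2) && ~~ X a z -> z <= b2 by case/andP.
case: (ex_maxnP exz ubz) => z /andP[zb nXz] zmax.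
have x0 : 0 < x by apply: leq_ltn_trans ax.
have [zy|yz|e] := ltngtP z y; last by rewrite e Xay in nXz.
  have [u [t [nXut]]] := maximal (first_y z zy).
  case=> -[h1 h2 h3]; last first.
    by have := free (ltn_trans ax h1) h2 h3; rewrite (negPf nXz) (negPf nXut).
  have [yt|ty] := ltnP y t; first by have := free h1 yt h3; rewrite (negPf Xxy) (negPf nXut).
  have tb := leq_trans ty yb; have [ua|au|e] := ltngtP u a.
  - have Dat := D_down (leq_ltn_trans (leq0n _) ua) (ltnW (leq_trans ax xa)) (leq_ltn_trans (leq0n _) h2) tb.
    by have := free ua h2 Dat; rewrite (negPf nXz) (negPf nXut).
  - by move: nXut; rewrite empty.
  - by have := zmax t; rewrite -e tb nXut => /(_ isT); rewrite leqNgt h2.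
have Dxz : D x z by apply: D_down => //; lia.
by have := free ax yz Dxz; rewrite (negPf nXz) (negPf Xxy).
Qed.

(** The first elbow of a low strand in column y, given by [low_strand], is either in row 0 and not
    in column 0, or below a row 0 of crosses; both make (0, 0) a cross. *)
Lemma exit_above_gt y : 0 < y -> y <= b2 -> a2 < exit_above C 0 y.
Proof.
move=> y0 yb; rewrite ltnNge; apply/negP => /(low_strand (leq0n _) yb)[x [_ _ h1 h2]].
have [x0|x0] := posnP x; apply/negP: corner_elbow; apply/negPn.
  by rewrite -{1}x0 h1.
exact: h2.
Qed.

End Corner.

Hypothesis pi_neq1 : pi != 1%g.
Hypothesis card_le : #|C| <= #|diagram pi|.

(** By [exit_above_gt], D lies in the diagram of the permutation w of C. The bound [card_le] then
    makes the diagrams equal and [f] a bijection from inversions to crosses, so no pair of strands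
    has two crosses. *)
Lemma maximal_pipe_dream : C \in reduced_pipe_dreams pi.
Proof.
have [p0 _ _] := @is_crossP _ _ _ _ (diagram_1_1 pi_dominant pi_neq1).
have n0 : 0 < n by apply: leq_ltn_trans (ltn_ord p0.1).
have ex_exit (i : 'I_n) : exists j : 'I_n, exit_above C 0 j == i.
  have [[j _ [jn e]] _] := strand_label triC i.
  by exists (Ordinal jn); apply/eqP.
pose e i := xchoose (ex_exit i).
have eE i : exit_above C 0 (e i) = i by apply/eqP; apply: xchooseP (ex_exit i).
have e_inj : injective e by move=> i j ij; apply: val_inj; rewrite /= -eE ij eE.
pose w := ((perm e_inj)^-1)%g.
have wE (j : 'I_n) : exit_above C 0 j = w j.
  by rewrite -{1}(permKV (perm e_inj) j) permE eE.
have sub : diagram pi \subset diagram w.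
  apply/subsetP => p; rewrite -is_cross_pos => Dp.
  have [p1 p2] := diagram_gt0 pi_dominant Dp.
  rewrite mem_diagram -wE (exit_above_gt Dp p2 (leqnn _)) /= ltnNge; apply/negP => le.
  have [j0|j0] := posnP ((w^-1)%g p.1 : nat).
    have := wE ((w^-1)%g p.1); rewrite permKV j0 exit_aboveE // (negPf corner_elbow) enter_left0 => p10.
    by rewrite -p10 in p1.
  by have := exit_above_gt Dp j0 le; rewrite wE permKV ltnn.
have [f [f_inj fP]] := inversion_tiles wE.
have fC : f @: diagram w \subset C.
  by apply/subsetP => _ /imsetP[q qD ->]; apply: (fP q qD).1.
have cw : #|f @: diagram w| = #|diagram w| by rewrite card_in_imset.
have wpi : w = pi.
  apply/esym/diagram_inj/eqP; rewrite eqEcard sub -cw.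
  exact: leq_trans (subset_leq_card fC) card_le.
have fE : f @: diagram w = C by apply/eqP; rewrite eqEcard fC cw wpi.
rewrite inE triC /=; apply/andP; split; last first.
  by apply/forallP => j; rewrite exits_atE // wE wpi.
apply/forallP => s; apply/forallP => t; apply/implyP => st.
apply/card_le1_eqP => p p'; rewrite !inE => /and3P[pC ps pt] /and3P[p'C p's p't].
have pre (r : pos n) : r \in C -> exists2 q : pos n, q \in diagram w & r = f q.
  by rewrite -{1}fE => /imsetP[q qD ->]; exists q.
have [[q qD pq] [q' q'D p'q']] := (pre p pC, pre p' p'C); subst p p'.
move: ps pt p's p't.
have lab i r : tile r \in strand C i -> enter_left C r.1 r.2 = i \/ enter_below C r.1 r.2 = i.
  by apply: (strand_label triC i).2.
move=> /lab l1 /lab l2 /lab l3 /lab l4; congr f.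
have [_ [_ l]] := fP _ qD; have [_ [_ l']] := fP _ q'D.
have st' : s <> t :> nat by apply/eqP; rewrite val_eqE.
(* An inversion lists its larger strand first, so two inversions of the same pair {s, t}
   coincide. *)
have key (x y x' y' s' t' : nat) : s' <> t' -> y < x -> y' < x' -> x = s' \/ y = s' ->
    x = t' \/ y = t' -> x' = s' \/ y' = s' -> x' = t' \/ y' = t' -> x = x' /\ y = y'.
  by clear; lia.
move: qD q'D; rewrite !mem_diagram => /andP[lt _] /andP[lt' _].
have [e1 e2] : w q.2 = w q'.2 :> nat /\ q.1 = q'.1 :> nat.
  by case: l => -[e1 e2]; case: l' => -[e3 e4];
    rewrite e1 e2 in l1 l2; rewrite e3 e4 in l3 l4; apply: (key _ _ _ _ s t st' lt lt'); clear -l1 l2 l3 l4; tauto.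
by rewrite [q]surjective_pairing (perm_inj (val_inj e1)) (val_inj e2) -surjective_pairing.
Qed.

End Maximal.
Hypothesis pi_neq1 : pi != 1%g.
Implicit Types (p q : pos n) (F G : {set pos n}).

Definition box_conflict p q := [&& p.1 < q.1, q.2 < p.2 & D q.1 p.2].

Definition box_compatible F : bool := [forall p in F, forall q in F, ~~ box_conflict p q].

Definition box_face F := (F \subset triangle n) && box_compatible F.

Lemma box_compatibleP F :
  reflect (forall p q, p \in F -> q \in F -> ~~ box_conflict p q) (box_compatible F).
Proof.
apply: (iffP forall_inP) => [h p q pF qF|h p pF]; first by move/forall_inP: (h p pF); apply.
by apply/forall_inP => q qF; apply: h.
Qed.

Lemma conflict_triangle p q : box_conflict p q -> p \in triangle n /\ q \in triangle n.
Proof.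
move=> /and3P[h1 h2 /(diagram_triangle pi_dominant) h3]; rewrite !inE; split.
  by apply: leq_trans h3; rewrite ltnS -addSn leq_add2r.
by apply: leq_trans h3; rewrite ltnS -addnS leq_add2l.
Qed.

Lemma maximal_box_face_pipe_dream F : maxset box_face F ->
  #|triangle n :\: F| <= #|diagram pi| -> triangle n :\: F \in reduced_pipe_dreams pi.
Proof.
case/maxsetP => /andP[sF cF] maxF card_le.
apply: maximal_pipe_dream => //; first exact: subsetDl.
  move=> x1 x2 y1 y2 x12 y12 Dxy; have [x2n y2n] := is_cross_bound Dxy.
  have x1n := ltn_trans x12 x2n; have y1n := ltn_trans y12 y2n.
  rewrite (is_crossE _ x1n y2n) (is_crossE _ x2n y1n).
  have cfl : box_conflict (Ordinal x1n, Ordinal y2n) (Ordinal x2n, Ordinal y1n).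
    by rewrite /box_conflict /= x12 y12.
  have [t1 t2] := conflict_triangle cfl; rewrite !in_setD t1 t2 !andbT -negb_and.
  by apply: contraL cfl => /andP[h1 h2]; move/box_compatibleP: cF; apply.
move=> x y /is_crossP[p /setDP[pt pF] [<- <-]].
have : ~~ box_face (p |: F).
  by apply: contra pF => h; rewrite -(maxF _ h (subsetUr _ _)) setU11.
rewrite /box_face subUset sub1set pt sF /=.
have [/existsP[q /andP[qF c]] _|none /negP[]] := boolP [exists q in F, box_conflict p q || box_conflict q p].
  exists q.1, q.2; split; first by rewrite is_cross_pos in_setD qF.
  by case/orP: c => /and3P[h1 h2 h3]; [right|left].
move/box_compatibleP: cF => cF; apply/box_compatibleP => q r.
have nc q' : q' \in F -> ~~ box_conflict p q' && ~~ box_conflict q' p.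
  by move=> q'F; move: none; rewrite negb_exists => /forallP/(_ q'); rewrite q'F negb_or.
rewrite !in_setU1 => /predU1P[->|qF] /predU1P[->|rF]; last exact: cF.
- by rewrite /box_conflict ltnn.
- by case/andP: (nc r rF).
- by case/andP: (nc q qF).
Qed.

(** Discharged in the last part, by comparing ranks of families of roots. *)
Hypothesis box_face_card : forall F, maxset box_face F -> #|triangle n :\: F| <= #|diagram pi|.

Lemma PD_box_face F : (F \in PD pi) = box_face F.
Proof.
rewrite inE; apply/existsP/idP => [[G /andP[/imsetP[C CP ->] FC]]|bF].
  apply/andP; split; first exact: subset_trans FC (subsetDl _ _).
  apply/box_compatibleP => p q /(subsetP FC)/setDP[_ pC] /(subsetP FC)/setDP[_ qC].
  apply/negP => /and3P[h1 h2 h3].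
  by have := reduced_pipe_dream_elbows CP h1 h2 h3; rewrite !is_cross_pos (negPf pC) (negPf qC).
have [G mG FG] := maxset_exists bF; exists G; rewrite FG andbT.
have sG : G \subset triangle n by case/maxsetP: mG => /andP[].
apply/imsetP; exists (triangle n :\: G); first exact: maximal_box_face_pipe_dream (box_face_card mG).
by rewrite setDDr setDv set0U; apply/esym/setIidPr.
Qed.

Lemma core_region_conflict p : p \in core_region pi ->
  exists2 q, q \in core_region pi & box_conflict p q || box_conflict q p.
Proof.
rewrite -is_cross_pos (core_regionE pi_dominant) => /orP[] Dp.
  have [a0 _] := diagram_gt0 pi_dominant Dp; have [_ bn] := is_cross_bound Dp.
  have an : p.1.-1 < n by apply: leq_ltn_trans (leq_pred _) _.
  exists (Ordinal an, Ordinal bn).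
    by rewrite -is_cross_pos (core_regionE pi_dominant) /= prednK // Dp orbT.
  by rewrite /box_conflict /= orbC ltn_predL a0 ltnSn Dp.
have [_ b0] := diagram_gt0 pi_dominant Dp; have [an _] := is_cross_bound Dp.
have bn : p.2.-1 < n by apply: leq_ltn_trans (leq_pred _) _.
exists (Ordinal an, Ordinal bn).
  by rewrite -is_cross_pos (core_regionE pi_dominant) /= prednK // Dp.
by rewrite /box_conflict /= ltn_predL b0 ltnSn Dp.
Qed.

Lemma conflict_core_region p q : box_conflict p q -> p \in core_region pi /\ q \in core_region pi.
Proof.
move=> /and3P[h1 h2 h3]; rewrite -!is_cross_pos !(core_regionE pi_dominant).
have [a0 b0] := diagram_gt0 pi_dominant h3.
by rewrite (diagram_down pi_dominant h3 (ltn0Sn _) h1 b0) ?(diagram_down pi_dominant h3 a0 _ (ltn0Sn _) h2) ?orbT.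
Qed.

Lemma core_region_triangle : core_region pi \subset triangle n.
Proof.
by apply/subsetP => p /core_region_conflict[q _ /orP[] /conflict_triangle[]].
Qed.

(** A box of the core region is in conflict with some box, and a facet through the latter omits it.
    A box outside is in no conflict; a facet omitting it could be enlarged, and this would give a
    reduced pipe dream with fewer than [#|diagram pi|] crosses, against [card_diagram_le]. *)
Lemma PD_coneE : PD_cone pi = triangle n :\: core_region pi.
Proof.
apply/setP => p; rewrite inE in_setD andbC; case pt: (p \in triangle n); last by rewrite !andbF.
rewrite !andbT; apply/forall_inP/idP => [all|pc G GP].
  apply/negP => /core_region_conflict[q qc cpq].
  have : box_face [set q].
    rewrite /box_face sub1set (subsetP core_region_triangle) //.
    by apply/box_compatibleP => r s /set1P -> /set1P ->; rewrite /box_conflict ltnn.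
  rewrite -PD_box_face inE => /existsP[G /andP[GP]]; rewrite sub1set => qG.
  have pG := all G GP; have : G \in PD pi by rewrite inE; apply/existsP; exists G; rewrite GP /=.
  rewrite PD_box_face => /andP[_ /box_compatibleP cG].
  by move: cpq; rewrite (negPf (cG _ _ pG qG)) (negPf (cG _ _ qG pG)).
have GPD : G \in PD pi by rewrite inE; apply/existsP; exists G; rewrite GP /=.
have : box_face (p |: G).
  move: GPD; rewrite PD_box_face => /andP[sG /box_compatibleP cG].
  rewrite /box_face subUset sub1set pt sG; apply/box_compatibleP => q r.
  rewrite !in_setU1 => /predU1P[->|qG] /predU1P[->|rG]; last exact: cG.
  - by rewrite /box_conflict ltnn.
  - by apply: contra pc => /conflict_core_region[].
  - by apply: contra pc => /conflict_core_region[].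
move=> bpG; have [M mM pGM] := maxset_exists bpG; case/imsetP: GP => C CP eG.
have M_pd := maximal_box_face_pipe_dream mM (box_face_card mM).
have top C' : C' \in reduced_pipe_dreams pi -> C' \subset triangle n /\
    forall j : 'I_n, exit_above C' 0 j = pi j.
  rewrite inE => /and3P[tri _ /forallP ex]; split=> // j.
  by apply/eqP; rewrite -exits_atE.
have [tM topM] := top _ M_pd; have [tC topC] := top _ CP.
have redC : reduced C by move: CP; rewrite inE => /and3P[].
have := leq_trans (reduced_card_le_diagram tC topC redC) (card_diagram_le topM).
apply: contraLR => pG; rewrite -ltnNge; apply: proper_card; apply/properP; split.
  apply/subsetP => r /setDP[rt rM]; apply: contraNT rM => rC.
  by apply: (subsetP pGM); rewrite in_setU1 eG in_setD rt rC orbT.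
exists p; first by move: pG; rewrite eG in_setD pt andbT negbK.
by rewrite in_setD (subsetP pGM) ?setU11.
Qed.

Lemma core_box_compatible : core pi = [set F : {set pos n} | F \subset core_region pi & box_compatible F].
Proof.
apply/setP => F; rewrite [LHS]in_set PD_box_face PD_coneE /box_face [RHS]in_set.
have -> : [disjoint F & triangle n :\: core_region pi] = (F :&: triangle n \subset core_region pi).
  rewrite -setI_eq0 setIDA setD_eq0 //.
have [tF|nF] := boolP (F \subset triangle n); first by rewrite (setIidPl tF) andbC.
by rewrite /=; apply/esym/negbTE; apply: contra nF => /andP[/subset_trans h _]; apply: h core_region_triangle.
Qed.

End PipeDreamFaces.

(** * The tree *)

Section Region.
Variables (n : nat) (pi : 'S_n).
Hypotheses (pi_dominant : one_dominant pi) (pi_neq1 : pi != 1%g).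
Local Notation D := (is_cross (diagram pi)).
Local Notation R := (is_cross (region pi)).
Local Notation H := (col_height pi).
Local Notation L := (row_length pi).
Local Notation W := (L 0).
Local Notation lab := (label pi).

Let D11 : D 1 1 := diagram_1_1 pi_dominant pi_neq1.
Let D_gt0 := diagram_gt0 pi_dominant.
Let D_down := diagram_down pi_dominant.

Lemma regionE a b : R a b = [|| D a b.+1, D a.+1 b | (a == 0) && (b == 0)].
Proof.
rewrite is_crossU (core_regionE pi_dominant) -orbA; congr [|| _, _ | _].
have n0 : 0 < n by have [h _] := is_cross_bound D11; apply: ltn_trans h.
apply/is_crossP/andP => [[p]|[/eqP -> /eqP ->]].
  by rewrite inE => /eqP[e1 e2] [<- <-]; rewrite e1 e2.
by exists (Ordinal n0, Ordinal n0); rewrite // inE.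
Qed.

Lemma region_down a b a' b' : R a b -> a' <= a -> b' <= b -> R a' b'.
Proof.
rewrite !regionE => h ha hb; have [a0|a0] := posnP a'; have [b0|b0] := posnP b'.
- by rewrite !orbT.
- apply/orP; right; apply/orP; left; rewrite a0.
  case/or3P: h => [h|h|/andP[_ /eqP e]]; last by move: b0; rewrite lt0n -leqn0 -e hb.
    by have [h1 _] := D_gt0 h; apply: D_down h _ h1 b0 _ => //; apply: leqW.
  by apply: D_down h _ _ b0 hb.
- apply/orP; left; rewrite b0.
  case/or3P: h => [h|h|/andP[/eqP e _]]; last by move: a0; rewrite lt0n -leqn0 -e ha.
    by apply: D_down h a0 ha _ _.
  by have [_ h1] := D_gt0 h; apply: D_down h a0 _ _ h1 => //; apply: leqW.
- case/or3P: h => [h|h|/andP[/eqP e _]]; last by move: a0; rewrite lt0n -leqn0 -e ha.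
    by apply/orP; left; apply: D_down h a0 ha _ _.
  by apply/orP; right; apply/orP; left; apply: D_down h _ _ b0 hb.
Qed.

Lemma col_heightE a b : (a < H b) = R a b.
Proof.
rewrite /col_height sum_is_cross_col; apply: (ltn_sum_antitone (f := fun a => R a b)).
  by move=> x h; apply: region_down h _ _.
by move=> x /is_cross_bound[].
Qed.

Lemma row_lengthE a b : (b < L a) = R a b.
Proof.
rewrite /row_length sum_is_cross_row; apply: (ltn_sum_antitone (f := fun b => R a b)).
  by move=> x h; apply: region_down h _ _.
by move=> x /is_cross_bound[].
Qed.

Lemma diagram_regionS a b : D a.+1 b -> R a b.
Proof. by move=> h; rewrite regionE h orbT. Qed.

Lemma diagram_regionSr a b : D a b.+1 -> R a b.
Proof. by move=> h; rewrite regionE h. Qed.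

Lemma region_diagram a b : R a b -> 0 < a -> 0 < b -> D a b.
Proof.
rewrite regionE => /or3P[] h a0 b0; [exact: D_down h _ _ b0 _|exact: D_down h a0 _ b0 _|].
by case/andP: h a0 => /eqP ->.
Qed.

Lemma diagram_bounds a b : D a b -> [/\ 0 < a, 0 < b, a < H 0 & b < W].
Proof.
move=> h; have [a0 b0] := D_gt0 h; split=> //.
  rewrite col_heightE; apply: diagram_regionSr; exact: D_down h a0 _ _ b0.
rewrite row_lengthE; apply: diagram_regionS; exact: D_down h _ a0 b0 _.
Qed.

Lemma region_bounds a b : R a b -> a < H 0 /\ b < W.
Proof. by rewrite col_heightE row_lengthE => h; split; apply: region_down h _ _. Qed.

Lemma col_height_le b b' : b <= b' -> H b' <= H b.
Proof.
by move=> bb; rewrite leqNgt; apply/negP; rewrite col_heightE => h; have := region_down h (leqnn _) bb;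
  rewrite -col_heightE ltnn.
Qed.

Lemma row_length_le a a' : a <= a' -> L a' <= L a.
Proof.
by move=> aa; rewrite leqNgt; apply/negP; rewrite row_lengthE => h; have := region_down h aa (leqnn _);
  rewrite -row_lengthE ltnn.
Qed.

Lemma H0_gt1 : 1 < H 0.
Proof. by have [] := diagram_bounds D11. Qed.

Lemma W_gt1 : 1 < W.
Proof. by have [] := diagram_bounds D11. Qed.

Lemma col_height_last : H W = 0.
Proof. by apply/eqP; rewrite -leqn0 leqNgt col_heightE -row_lengthE ltnn. Qed.

Definition block b := inl b :: [seq inr a : nat + nat | a <- rev (iota (H b.+1) (H b - H b.+1))].

(* The E step below column b comes after the N steps of the rows below that    *)
(* column, and the N step of row a after the E steps of the columns of row a.  *)
Definition idxE b := b + (H 0 - H b).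
Definition idxN a := L a + (H 0 - a.+1).

Lemma size_blocks B : size (flatten [seq block b | b <- iota 0 B]) = idxE B.
Proof.
elim: B => [|B IH]; first by rewrite /idxE subnn.
rewrite -[B.+1]addn1 iotaD add0n map_cat flatten_cat size_cat IH /= cats0 addn1 size_map size_rev size_iota.
have h1 := col_height_le (leqnSn B); have h2 := col_height_le (leq0n B).
by rewrite /idxE; clear -h1 h2; lia.
Qed.

Lemma step_atE B : B < W -> step_at pi (idxE B) = inl B.
Proof.
move=> BW; rewrite /step_at /steps -/block.
rewrite (_ : W = B + (W - B.+1).+1); last by clear -BW; lia.
by rewrite iotaD map_cat flatten_cat nth_cat size_blocks ltnn subnn add0n.
Qed.

Lemma step_atN a : a < H 0 -> step_at pi (idxN a) = inr a.
Proof.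
rewrite col_heightE -row_lengthE => La; have LW := row_length_le (leq0n a).
set B := (L a).-1; have eL : L a = B.+1 by rewrite prednK.
have aB : a < H B by rewrite col_heightE -row_lengthE eL.
have Ba : H B.+1 <= a by rewrite leqNgt col_heightE -row_lengthE eL ltnn.
have HB := col_height_le (leq0n B).
rewrite /step_at /steps -/block (_ : W = B + (W - B.+1).+1); last by clear -LW eL; lia.
rewrite iotaD add0n map_cat flatten_cat nth_cat size_blocks.
have -> : (idxN a < idxE B) = false by apply/negbTE; rewrite /idxN /idxE eL; clear -aB HB; lia.
have -> : idxN a - idxE B = (H B - a.+1).+1 by rewrite /idxN /idxE eL; clear -aB HB; lia.
rewrite /= nth_cat size_map size_rev size_iota.
have -> : (H B - a.+1 < H B - H B.+1) = true by clear -aB Ba; lia.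
rewrite (nth_map 0) ?size_rev ?size_iota; last by clear -aB Ba; lia.
rewrite nth_rev ?size_iota; last by clear -aB Ba; lia.
rewrite nth_iota; last by clear -aB Ba; lia.
by congr inr; clear -aB Ba; lia.
Qed.

Lemma size_steps : size (steps pi) = W + H 0.
Proof. by rewrite /steps -/block size_blocks /idxE col_height_last subn0. Qed.

Lemma idxE_lt b : b < W -> idxE b < size (steps pi).
Proof. by rewrite size_steps /idxE => h; have := H0_gt1; clear -h; lia. Qed.

Lemma idxN_lt a : a < H 0 -> idxN a < size (steps pi).
Proof. by rewrite size_steps /idxN => h; have := row_length_le (leq0n a); clear -h; lia. Qed.

Definition all_steps : seq (nat + nat) := [seq inl b | b <- iota 0 W] ++ [seq inr a | a <- iota 0 (H 0)].

Lemma mem_all_steps (s : nat + nat) :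
  (s \in all_steps) = match s with inl b => b < W | inr a => a < H 0 end.
Proof.
rewrite mem_cat; case: s => k.
  rewrite (mem_map (fun x y => fun e : inl x = inl y => let: erefl := e in erefl)) mem_iota add0n.
  by case: mapP => [[]|] //; rewrite orbF.
rewrite orbC (mem_map (fun x y => fun e : inr x = inr y => let: erefl := e in erefl)) mem_iota add0n.
by case: mapP => [[]|] //; rewrite orbF.
Qed.

Lemma all_steps_sub : {subset all_steps <= steps pi}.
Proof.
move=> s; rewrite mem_all_steps; case: s => k h.
  by rewrite -(step_atE h) mem_nth // idxE_lt.
by rewrite -(step_atN h) mem_nth // idxN_lt.
Qed.

Lemma uniq_all_steps : uniq all_steps.
Proof.
rewrite cat_uniq !map_inj_uniq ?iota_uniq //=; try by move=> x y [].
by rewrite andbT; apply/hasPn => _ /mapP[a _ ->]; apply/mapP => -[].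
Qed.

Lemma uniq_steps : uniq (steps pi).
Proof.
apply: (leq_size_uniq uniq_all_steps all_steps_sub).
by rewrite size_steps size_cat !size_map !size_iota.
Qed.

Lemma index_stepE b : b < W -> index (inl b) (steps pi) = idxE b.
Proof. by move=> h; rewrite -(step_atE h) index_uniq ?idxE_lt ?uniq_steps. Qed.

Lemma index_stepN a : a < H 0 -> index (inr a) (steps pi) = idxN a.
Proof. by move=> h; rewrite -(step_atN h) index_uniq ?idxN_lt ?uniq_steps. Qed.

Lemma step_atP k : k < size (steps pi) ->
  (exists2 b, b < W & k = idxE b) \/ (exists2 a, a < H 0 & k = idxN a).
Proof.
move=> ks; have := mem_nth (inl 0) ks.
have le : size (steps pi) <= size all_steps by rewrite size_steps size_cat !size_map !size_iota.
have [_ eqi] := uniq_min_size uniq_all_steps all_steps_sub le.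
rewrite -eqi mem_all_steps.
case E: (nth _ _ _) => [b|a] h; [left; exists b|right; exists a] => //.
  by rewrite -index_stepE // -E index_uniq // uniq_steps.
by rewrite -index_stepN // -E index_uniq // uniq_steps.
Qed.

Lemma idxE_lt_idxN a b : R a b -> idxE b < idxN a.
Proof.
move=> Rab; have [aH bW] := region_bounds Rab; have := Rab; rewrite -col_heightE => h1.
have := Rab; rewrite -row_lengthE => h2; have h3 := col_height_le (leq0n b).
by rewrite /idxE /idxN; clear -h1 h2 h3; lia.
Qed.

Lemma idxN_to_idxE a b : a < H 0 -> ~~ R a b -> idxE b = (idxN a + (b - L a) + (a - H b)).+1.
Proof.
move=> aH nR; have h1 : H b <= a by rewrite leqNgt col_heightE.
have h2 : L a <= b by rewrite leqNgt row_lengthE.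
have h3 := col_height_le (leq0n b).
by rewrite /idxE /idxN; clear -aH h1 h2 h3; lia.
Qed.

Lemma in_A_N a : a < H 0 -> in_A pi (idxN a).
Proof. by move=> h; rewrite /in_A step_atN. Qed.

Lemma idxE_corner b : b < W -> D (H b) b -> idxE b = (idxN (H b)).+1 /\ L (H b) = b.
Proof.
move=> bW Db; have [a0 b0 aH _] := diagram_bounds Db.
have Lb : L (H b) = b.
  apply/eqP; rewrite eqn_leq; apply/andP; split; first by rewrite leqNgt row_lengthE -col_heightE ltnn.
  by rewrite -(prednK b0) row_lengthE diagram_regionSr // prednK.
by split=> //; rewrite /idxE /idxN Lb; clear -aH; lia.
Qed.

(* For b > 0, (H b, b) is the corner of the boundary just before the E step of *)
(* column b if column b - 1 is longer; otherwise it is not in D.               *)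
Lemma in_A_E b : b < W -> in_A pi (idxE b) = ~~ D (H b) b.
Proof.
move=> bW; rewrite /in_A step_atE // /E_bounds_bottom (bottom_pdE pi_dominant).
have Hb : 0 < H b by rewrite col_heightE -row_lengthE.
have Rb : R (H b).-1 b by rewrite -col_heightE prednK.
have [Db|nDb] := boolP (D (H b) b).
  have [eI eL] := idxE_corner bW Db; have [_ b0 aH _] := diagram_bounds Db.
  rewrite eI /= step_atN // /N_bounds_bottom (bottom_pdE pi_dominant) eL prednK // Db andbF //.
have DE : D (H b).-1 b.+1.
  move: Rb; rewrite regionE prednK // (negPf nDb) /= => /orP[//|/andP[/eqP e0 /eqP b0]].
  by have := H0_gt1; rewrite -b0 in Hb e0 *; clear -Hb e0; lia.
rewrite DE /=; case E: (idxE b) => [|k] //=.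
have ks : k < size (steps pi) by have := idxE_lt bW; rewrite E => /ltnW.
case: (step_atP ks) => [[b' b'W ek]|[a aH ek]]; first by rewrite ek step_atE.
rewrite ek step_atN // /N_bounds_bottom (bottom_pdE pi_dominant).
have La : 0 < L a by rewrite row_lengthE -col_heightE.
rewrite prednK //; apply: contra nDb => Da.
have nR : ~~ R a b.
  by apply/negP => /idxE_lt_idxN; rewrite E ek => h; move: (ltn_trans h (ltnSn _)); rewrite ltnn.
have := idxN_to_idxE aH nR; rewrite E ek => -[e].
have h1 : H b <= a by rewrite leqNgt col_heightE.
have h2 : L a <= b by rewrite leqNgt row_lengthE.
have [e1 e2] : b = L a /\ H b = a by clear -e h1 h2; lia.
by rewrite e2 e1.
Qed.

Local Notation cnt k := (count (in_A pi) (iota 0 k)).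

Lemma cntS k : cnt k.+1 = cnt k + in_A pi k.
Proof. by rewrite -addn1 iotaD count_cat /= addn0. Qed.

Lemma cnt_le k k' : k <= k' -> cnt k <= cnt k'.
Proof. by move/subnKC <-; rewrite iotaD count_cat leq_addr. Qed.

Lemma cnt_lt k k' : k < k' -> in_A pi k' -> cnt k.+1 < cnt k'.+1.
Proof. by move=> kk A; rewrite (cntS k') A addn1 ltnS cnt_le. Qed.

Lemma cnt_gt0 k : 0 < cnt k.+1.
Proof.
apply: leq_trans (cnt_le (ltn0Sn k)).
have h := W_gt1; have /in_A_E := ltnW h; rewrite /idxE subnn /= => ->.
by rewrite ?addn0 lt0b; apply/negP => /D_gt0[_].
Qed.

Lemma labelE b : b < W -> (lab (inl b)).+1 = cnt (idxE b).+1.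
Proof. by move=> h; rewrite /label index_stepE // prednK // cnt_gt0. Qed.

Lemma labelN a : a < H 0 -> (lab (inr a)).+1 = cnt (idxN a).+1.
Proof. by move=> h; rewrite /label index_stepN // prednK // cnt_gt0. Qed.

Lemma label_E_lt_N a b : R a b -> lab (inl b) < lab (inr a).
Proof.
move=> Rab; have [aH bW] := region_bounds Rab.
by rewrite -ltnS labelE // labelN // cnt_lt ?idxE_lt_idxN ?in_A_N.
Qed.

Lemma label_N_le_E a b : a < H 0 -> b < W -> ~~ R a b -> lab (inr a) <= lab (inl b).
Proof.
move=> aH bW nR; rewrite -ltnS labelE // labelN // cnt_le // (idxN_to_idxE aH nR).
by rewrite ltnS -addnA leqW // leq_addr.
Qed.

Lemma label_N_lt a a' : a' < a -> a < H 0 -> lab (inr a) < lab (inr a').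
Proof.
move=> aa aH; have a'H := ltn_trans aa aH.
rewrite -ltnS !labelN // cnt_lt ?in_A_N //.
have := row_length_le (ltnW aa); rewrite /idxN; clear -aa aH; lia.
Qed.

Lemma label_merged b : b < W -> D (H b) b -> lab (inl b) = lab (inr (H b)).
Proof.
move=> bW Db; have [_ _ aH _] := diagram_bounds Db.
apply: succn_inj; rewrite labelE // labelN // (idxE_corner bW Db).1 [LHS]cntS.
by rewrite -(idxE_corner bW Db).1 in_A_E // Db addn0.
Qed.

Lemma label_E_lt b b' : b < b' -> b' < W -> lab (inl b) < lab (inl b').
Proof.
move=> bb b'W; have bW := ltn_trans bb b'W.
have [Db|nDb] := boolP (D (H b') b'); last first.
  rewrite -ltnS !labelE // cnt_lt ?in_A_E //.
  have := col_height_le (ltnW bb); have := col_height_le (leq0n b).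
  by rewrite /idxE; clear -bb; lia.
rewrite (label_merged b'W Db); apply: label_E_lt_N.
by rewrite -row_lengthE (idxE_corner b'W Db).2.
Qed.

(** Strict inequality of labels detects R and weak inequality detects D: the boxes of D outside R
    are the corners (H b, b), where [label_merged] gives equality. This is the middle condition of
    [arc_conflict]. *)
Lemma label_E_le_N a b : a < H 0 -> b < W -> 0 < a -> 0 < b ->
  (lab (inl b) <= lab (inr a)) = D a b.
Proof.
move=> aH bW a0 b0; have [Rab|nR] := boolP (R a b).
  by rewrite ltnW ?label_E_lt_N // region_diagram.
have Hb : H b <= a by rewrite leqNgt col_heightE.
apply/idP/idP => [le|Dab].
  have [Db|nDb] := boolP (D (H b) b).
    move: le; rewrite (label_merged bW Db) => le.
    move: Hb; rewrite leq_eqVlt => /predU1P[<- //|lt].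
    by have := label_N_lt lt aH; rewrite ltnNge le.
  have : lab (inr a) < lab (inl b); last by rewrite ltnNge le.
  rewrite -ltnS labelE // labelN // cnt_lt ?in_A_E //.
  by rewrite (idxN_to_idxE aH nR) ltnS -addnA leq_addr.
have e : H b = a.
  apply/eqP; rewrite eqn_leq Hb -(prednK a0) col_heightE.
  by apply: diagram_regionS; rewrite prednK.
by rewrite label_merged // e.
Qed.

Lemma label_region a b : a < H 0 -> b < W -> (lab (inl b) < lab (inr a)) = R a b.
Proof.
move=> aH bW; apply/idP/idP; last exact: label_E_lt_N.
by apply: contraLR => nR; rewrite -leqNgt label_N_le_E.
Qed.

Lemma leq_label_E b b' : b < W -> b' < W -> (lab (inl b) < lab (inl b')) = (b < b').
Proof.
move=> h h'; apply/idP/idP => [|lt]; last exact: label_E_lt.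
by apply: contraLR; rewrite -!leqNgt leq_eqVlt => /predU1P[->|lt] //; apply/ltnW/label_E_lt.
Qed.

Lemma leq_label_N a a' : a < H 0 -> a' < H 0 -> (lab (inr a) < lab (inr a')) = (a' < a).
Proof.
move=> h h'; apply/idP/idP => [|lt]; last exact: label_N_lt.
by apply: contraLR; rewrite -!leqNgt leq_eqVlt => /predU1P[->|lt] //; apply/ltnW/label_N_lt.
Qed.

Local Notation m := (num_labels pi).

Lemma label_E0 : lab (inl 0) = 0.
Proof.
apply: succn_inj; rewrite labelE; last exact: ltnW W_gt1.
by apply/eqP; rewrite eqn_leq cnt_gt0 andbT /idxE subnn /= addn0 leq_b1.
Qed.

Lemma num_labels_gt0 : 0 < m.
Proof. by rewrite /num_labels -(prednK (leq_ltn_trans (leq0n _) (idxE_lt W_gt1))) cnt_gt0. Qed.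

Lemma label_N0 : lab (inr 0) = m.-1.
Proof.
apply: succn_inj; rewrite (prednK num_labels_gt0) labelN; last exact: ltnW H0_gt1.
congr (cnt _); rewrite size_steps /idxN; have := ltnW H0_gt1; clear; lia.
Qed.

Lemma label_lt (s : nat + nat) : s \in steps pi -> lab s < m.
Proof.
move=> h; rewrite -ltnS /label prednK ?cnt_gt0 // ltnS; apply: cnt_le.
by rewrite index_mem.
Qed.

Lemma label_E_lt_m b : b < W -> lab (inl b) < m.
Proof. by move=> h; apply: label_lt; apply: all_steps_sub; rewrite mem_all_steps. Qed.

Lemma label_N_lt_m a : a < H 0 -> lab (inr a) < m.
Proof. by move=> h; apply: label_lt; apply: all_steps_sub; rewrite mem_all_steps. Qed.

Definition is_E_label (i : 'I_m) : bool := has (fun b => lab (inl b) == i) (iota 0 W).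
Definition is_N_label (i : 'I_m) : bool := has (fun a => lab (inr a) == i) (iota 0 (H 0)).

Lemma is_E_labelP (i : 'I_m) : reflect (exists2 b, b < W & lab (inl b) = i) (is_E_label i).
Proof.
apply: (iffP hasP) => [[b]|[b bW e]].
  by rewrite mem_iota add0n => bW /eqP; exists b.
by exists b; rewrite ?mem_iota ?add0n // e.
Qed.

Lemma is_N_labelP (i : 'I_m) : reflect (exists2 a, a < H 0 & lab (inr a) = i) (is_N_label i).
Proof.
apply: (iffP hasP) => [[b]|[b bW e]].
  by rewrite mem_iota add0n => bW /eqP; exists b.
by exists b; rewrite ?mem_iota ?add0n // e.
Qed.

(** The counter grows by at most one per step, so no label is skipped. *)
Lemma cnt_hits N i : i < cnt N -> exists2 k, k < N & (cnt k.+1 == i.+1).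
Proof.
elim: N => // N IH; rewrite cntS; have [lt _|ge h] := ltnP i (cnt N).
  by have [k kN e] := IH lt; exists k; rewrite // ltnW.
by exists N; rewrite // eqn_leq cntS h andbT (leq_trans (leq_add (leqnn _) (leq_b1 _))) // addn1.
Qed.

Lemma E_or_N_label (i : 'I_m) : is_E_label i || is_N_label i.
Proof.
have [k ks /eqP ek] := cnt_hits (ltn_ord i).
case: (step_atP ks) => [[b bW e]|[a aH e]]; apply/orP.
  by left; apply/is_E_labelP; exists b; rewrite //; apply: succn_inj; rewrite labelE // -e.
by right; apply/is_N_labelP; exists a; rewrite //; apply: succn_inj; rewrite labelN // -e.
Qed.

(** The boxes of column b without a dot are as many as the boxes of D in column b + 1. After the
    drop they are the topmost ones, while those boxes of D occupy the rows from 1 on. *)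
Lemma mem_dropped_dots (p : pos n) :
  (p \in dropped_dots pi) = R p.1 p.2 && ~~ D p.1.+1 p.2.+1.
Proof.
rewrite inE col_heightE andbC; case Rp: (R p.1 p.2) => //=.
have sumR : H p.2 = \sum_(a < n) D a p.2.+1 + num_dots pi p.2.
  rewrite /num_dots /col_height !sum_is_cross_col -big_split /=; apply: eq_bigr => a _.
  have -> : is_cross (region pi :\: bottom_pd pi) a p.2 = R a p.2 && ~~ D a p.2.+1.
    by rewrite -[a : nat]/((a, p.2).1 : nat) -[p.2 : nat]/((a, p.2).2 : nat) -bottom_pdE //
      !is_cross_pos in_setD andbC.
  by case Da: (D a p.2.+1); rewrite ?(diagram_regionSr Da) //= ?andbT add0n.
by rewrite sumR addnK leqNgt (ltn_sum_diagram_col pi_dominant).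
Qed.

Lemma mem_tree_edges (e : 'I_m * 'I_m) : reflect
  (exists a b, [/\ R a b, ~~ D a.+1 b.+1, lab (inl b) = e.1 & lab (inr a) = e.2])
  (e \in tree_edges pi).
Proof.
rewrite inE; apply: (iffP andP) => [[_ /existsP[p /and3P[]]]|[a [b [Rab nD e1 e2]]]].
  by rewrite mem_dropped_dots => /andP[Rp nD] /eqP e1 /eqP e2; exists p.1, p.2.
split; first by rewrite -e1 -e2 label_E_lt_N.
have [p pR [p1 p2]] := is_crossP _ _ _ Rab; apply/existsP; exists p.
by rewrite mem_dropped_dots p1 p2 Rab nD e1 e2 !eqxx.
Qed.

(* From column b go to the lowest row x that meets D in column b + 1, whose    *)
(* label is also that of the next column y > b, and continue from y.           *)
Lemma connect_region a b (i j : 'I_m) : R a b -> lab (inl b) = i -> lab (inr a) = j ->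
  connect [rel x y : 'I_m | (x < y) && ((x, y) \in tree_edges pi)] i j.
Proof.
have [k] := ubnP (W - b); elim: k b i => // k IH b i kb Rab ei ej.
have edge x y (p q : 'I_m) : R x y -> ~~ D x.+1 y.+1 -> lab (inl y) = p -> lab (inr x) = q ->
    connect [rel x y : 'I_m | (x < y) && ((x, y) \in tree_edges pi)] p q.
  move=> Rxy nD ep eq; apply: connect1; rewrite /= -ep -eq label_E_lt_N //.
  by apply/mem_tree_edges; exists x, y.
have [Dab|nD] := boolP (D a.+1 b.+1); last exact: edge Rab nD ei ej.
have [aH bW] := region_bounds Rab.
have exx : exists x, D x b.+1 by exists a.+1.
have ubx x : D x b.+1 -> x <= n by move=> /is_cross_bound[/ltnW].
case: (ex_maxnP exx ubx) => x Dx xmax; have ax := xmax _ Dab.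
have nDx : ~~ D x.+1 b.+1 by apply/negP => /xmax; rewrite ltnn.
have Rxb : R x b by apply: diagram_regionSr.
have [x0 _ xH _] := diagram_bounds Dx.
set y := L x; have by' : b < y by rewrite row_lengthE.
have y0 : 0 < y by apply: leq_ltn_trans by'.
have Dxy : D x y.
  have : R x y.-1 by rewrite -row_lengthE prednK.
  rewrite regionE prednK // => /or3P[//|h|/andP[/eqP e _]]; last by rewrite e in x0.
  have [e|ne] := eqVneq y b.+1; first by rewrite e.
  case/negP: nDx; apply: D_down h _ (leqnn _) _ _ => //.
  by rewrite -ltnS prednK // ltn_neqAle eq_sym ne.
have [_ _ _ yW] := diagram_bounds Dxy.
have eH : H y = x.
  apply/eqP; rewrite eqn_leq; apply/andP; split; first by rewrite leqNgt col_heightE -row_lengthE ltnn.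
  by rewrite -(prednK x0) col_heightE; apply: diagram_regionS; rewrite prednK.
have merged : lab (inl y) = lab (inr x) by rewrite label_merged // eH.
pose q := Ordinal (label_N_lt_m xH).
apply: (connect_trans (y := q)); first exact: edge Rxb nDx ei _.
apply: (IH y) => //; last first.
  by apply: diagram_regionS; apply: D_down Dxy _ ax _ _.
clear -kb by' bW; lia.
Qed.

Lemma trans_closure_tree_edges :
  trans_closure (tree_edges pi) = arcs is_E_label is_N_label.
Proof.
apply/setP => -[i j]; rewrite !inE /=; case: ltnP => //= ij; apply/idP/andP; last first.
  move=> [/is_E_labelP[b bW eb] /is_N_labelP[a aH ea]]; apply: (connect_region _ eb ea).
  by rewrite -label_region // eb ea.
have endpoints (e : 'I_m * 'I_m) : e \in tree_edges pi -> is_E_label e.1 /\ is_N_label e.2.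
  move/mem_tree_edges => [a [b [Rab _ e1 e2]]]; have [aH bW] := region_bounds Rab.
  by split; [apply/is_E_labelP; exists b|apply/is_N_labelP; exists a].
move=> /connectP[p pth ej]; split.
  case: p pth ej => [_ ej|k p /= /andP[/andP[_ /endpoints[]]]] //.
  by rewrite ej ltnn in ij.
case/lastP: p pth ej => [_ /= ej|p k]; first by rewrite ej ltnn in ij.
by rewrite rcons_path last_rcons => /andP[_ /andP[_ /endpoints[_ h]]] ->.
Qed.

End Region.

(* Imported only here because classical_sets shadows lemmas of finset and       *)
(* fintype.                                                                     *)
From mathcomp Require Import boolp classical_sets reals convex.
From mathcomp Require Import interval_inference ring lra.

Import Order.TTheory GRing.Theory Num.Theory.

(** * Convex hulls and root polytopes *)

Section Combinations.
Local Open Scope ring_scope.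
Local Open Scope classical_set_scope.
Variables (R : realType) (m : nat).
Local Notation V := 'rV[R]_m.

Definition combinations (I : finType) (Q : I -> V) (F : {set I}) : set V :=
  [set x | exists c : I -> R, [/\ forall i, 0 <= c i, forall i, i \notin F -> c i = 0,
     \sum_i c i = 1 & x = \sum_i c i *: Q i]].

Lemma combination1 (I : finType) (Q : I -> V) (i : I) :
  \sum_j (j == i)%:R *: Q j = Q i.
Proof.
rewrite (bigD1 i) //= eqxx scale1r big1 ?addr0 // => j /negPf ->.
by rewrite scale0r.
Qed.

Lemma sum_indicator (I : finType) (i : I) : \sum_j (j == i)%:R = 1 :> R.
Proof. by rewrite (bigD1 i) //= eqxx big1 ?addr0 // => j /negPf ->. Qed.

Lemma mem_combinations (I : finType) (Q : I -> V) (F : {set I}) i :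
  i \in F -> combinations Q F (Q i).
Proof.
move=> iF; exists (fun j => (j == i)%:R); split => [j|j jF||]; first exact: ler0n.
- by case: eqP jF => // ->; rewrite iF.
- exact: sum_indicator.
- by rewrite combination1.
Qed.

Lemma combinations_convex (I : finType) (Q : I -> V) (F : {set I}) :
  convex_set (combinations Q F : set (convex_lmodType V)).
Proof.
move=> x y l; rewrite !inE => -[c [c0 cF c1 ->]] [d [d0 dF d1 ->]].
have l1 : l%:num <= 1 by [].
have l0 : 0 <= l%:num by [].
exists (fun i => l%:num * c i + (1 - l%:num) * d i); split => [i|i iF||].
- by rewrite addr_ge0 // mulr_ge0 // subr_ge0.
- by rewrite cF // dF // !mulr0 addr0.
- by rewrite big_split /= -!mulr_sumr c1 d1 !mulr1 addrC subrK.
- rewrite /conv /= !scaler_sumr -big_split /=; apply: eq_bigr => i _.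
  by rewrite [RHS]scalerDl -!scalerA.
Qed.

Lemma convex_combinations (I : finType) (Q : I -> V) (A : set (convex_lmodType V)) :
  convex_set A -> forall F : {set I}, (forall i, i \in F -> A (Q i)) ->
  combinations Q F `<=` A.
Proof.
move=> cA F; move eqk: #|F| => k; elim: k F eqk => [|k IH] F Fk QA x [c [c0 cF c1 ->]].
  have F0 := cards0_eq Fk; move: c1; rewrite big1 => [/eqP|i _]; last by rewrite cF // F0 inE.
  by rewrite eq_sym oner_eq0.
have [i iF] : exists i, i \in F by apply/set0Pn; rewrite -card_gt0 Fk.
have [ci1|ci1] := eqVneq (c i) 1.
  have cj j : j != i -> c j = 0.
    move=> ji; apply/eqP; rewrite eq_le c0 andbT.
    rewrite -(lerD2l (c i)) addr0 {2}ci1 -c1 (bigD1 i) //= lerD2l (bigD1 j) //= lerDl.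
    exact: sumr_ge0.
  rewrite (bigD1 i) //= big1 => [|j /cj ->]; last by rewrite scale0r.
  by rewrite ci1 scale1r addr0; apply: QA.
have sum' : \sum_(j | j != i) c j = 1 - c i by rewrite -c1 [in RHS](bigD1 i) //= addrAC subrr add0r.
have ci_le : c i <= 1 by rewrite -subr_ge0 -sum' sumr_ge0.
have ci_lt : 0 < 1 - c i by rewrite subr_gt0 lt_neqAle ci1.
pose c' j := if j == i then 0 else c j / (1 - c i).
have Ax : A (\sum_j c' j *: Q j).
  apply: (IH (F :\ i)%SET).
  - by apply/eqP; rewrite -eqSS -add1n -Fk (cardsD1 i F) iF.
  - by move=> j /setD1P[_]; exact: QA.
  exists c'; split=> // [j|j|].
  - by rewrite /c'; case: eqP => // _; rewrite divr_ge0 // ltW.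
  - rewrite in_setD1 negb_and negbK /c'; case: eqP => //= _ /cF ->; by rewrite mul0r.
  - rewrite (bigD1 i) //= /c' eqxx add0r.
    rewrite (eq_bigr (fun j => c j / (1 - c i))) => [|j /negPf -> //].
    by rewrite -mulr_suml sum' divff // gt_eqF.
have := cA (Q i) (\sum_j c' j *: Q j) (Itv01 (c0 i) ci_le).
rewrite !inE => /(_ (QA i iF) Ax); rewrite /conv /=.
congr (A _); rewrite [RHS](bigD1 i) //=; congr (_ + _).
rewrite scaler_sumr (bigD1 i) //= /c' eqxx scale0r scaler0 add0r.
apply: eq_bigr => j /negPf ->; rewrite scalerA mulrC divfK // gt_eqF //.
Qed.

Lemma hullE (I : finType) (Q : I -> V) (F : {set I}) :
  hull (Q @` [set` F]) = combinations Q F.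
Proof.
apply/seteqP; split.
  apply: smallest_sub; first exact: combinations_convex.
  by move=> _ [i iF <-]; apply: mem_combinations.
move=> x xF A [cA QA]; apply: (convex_combinations cA _ xF) => i iF.
by apply: QA; exists i.
Qed.

(** Split a linear relation into its positive and negative parts. *)
Lemma unique_nonneg_independent (I : finType) (W : lmodType R) (Q : I -> W) (F : {set I}) :
  (forall c d : I -> R, (forall i, 0 <= c i) -> (forall i, 0 <= d i) ->
    (forall i, i \notin F -> c i = 0) -> (forall i, i \notin F -> d i = 0) ->
    \sum_i c i *: Q i = \sum_i d i *: Q i -> c =1 d) ->
  forall c : I -> R, \sum_(i in F) c i *: Q i = 0 -> forall i, i \in F -> c i = 0.
Proof.
move=> uQ c sQ i iF.
pose cp j := if j \in F then Num.max (c j) 0 else 0.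
pose cm j := if j \in F then Num.max (- c j) 0 else 0.
have cE j : j \in F -> c j = cp j - cm j.
  by move=> jF; rewrite /cp /cm jF; case: (leP (c j) 0); case: (leP (- c j) 0); lra.
have cF j : j \notin F -> cp j = cm j by rewrite /cp /cm => /negPf ->.
have sumQ : \sum_j cp j *: Q j = \sum_j cm j *: Q j.
  apply/eqP; rewrite -subr_eq0 -sumrB (bigID (mem F)) /= [X in _ + X]big1 => [|j /cF ->].
    rewrite addr0 -{2}sQ; apply/eqP/eq_bigr => j /cE ->.
    by rewrite scalerBl.
  by rewrite subrr.
have := uQ _ _ _ _ _ _ sumQ i; rewrite cE // => ->; rewrite ?subrr //.
- by move=> j; rewrite /cp; case: ifP => // _; rewrite le_max lexx orbT.
- by move=> j; rewrite /cm; case: ifP => // _; rewrite le_max lexx orbT.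
- by move=> j /negPf; rewrite /cp => ->.
- by move=> j /negPf; rewrite /cm => ->.
Qed.

(** Appending the coordinate 1 turns affine independence into linear independence. *)
Lemma sum_pair (I : finType) (W : lmodType R) (Q : I -> W) (c : I -> R) :
  \sum_i c i *: (Q i, 1 : R^o) = (\sum_i c i *: Q i, \sum_i c i).
Proof.
elim/big_rec3: _ => // i x y z _ ->; congr (_, _).
by congr (_ + _); apply: mulr1.
Qed.

Section UniqueCombinations.
Variables (I : finType) (Q : I -> V) (D : {set {set I}}).

(** The common total is arbitrary. Total 1 makes hulls of faces meet in hulls of common faces; other
    totals are needed for affine independence, where positive and negative parts are compared. *)
Definition unique_combinations := forall F G (c d : I -> R),
  F \in D -> G \in D -> (forall i, 0 <= c i) -> (forall i, 0 <= d i) ->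
  (forall i, i \notin F -> c i = 0) -> (forall i, i \notin G -> d i = 0) ->
  \sum_i c i = \sum_i d i -> \sum_i c i *: Q i = \sum_i d i *: Q i -> c =1 d.

Hypothesis uQ : unique_combinations.

Lemma hull_vertex F G i : F \in D -> G \in D -> i \in G ->
  hull (Q @` [set` F]) (Q i) -> i \in F.
Proof.
move=> FD GD iG; rewrite hullE => -[c [c0 cF c1 e]].
pose d j : R := (j == i)%:R.
have d0 j : 0 <= d j by apply: ler0n.
have dG j : j \notin G -> d j = 0 by rewrite /d; case: eqP => // ->; rewrite iG.
have cd := uQ FD GD c0 d0 cF dG (etrans c1 (esym (sum_indicator i))).
apply/negPn/negP => iF; have := cd _ i; rewrite cF // /d eqxx combination1 e.
by move=> /(_ erefl)/eqP; rewrite eq_sym oner_eq0.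
Qed.

Lemma hull_subset F G : F \in D -> G \in D ->
  hull (Q @` [set` F]) `<=` hull (Q @` [set` G]) -> F \subset G.
Proof.
move=> FD GD s; apply/fintype.subsetP => i iF; apply: (hull_vertex GD FD iF).
by apply: s; apply: sub_gen_smallest; exists i.
Qed.

Lemma sub_hull (F G : {set I}) : F \subset G -> hull (Q @` [set` F]) `<=` hull (Q @` [set` G]).
Proof.
move=> /fintype.subsetP FG; rewrite !hullE => x [c [c0 cF c1 e]].
by exists c; split=> // i iG; apply: cF; apply: contra iG => /FG.
Qed.

Lemma hull_inj F G : F \in D -> G \in D ->
  hull (Q @` [set` F]) = hull (Q @` [set` G]) -> F = G.
Proof.
by move=> FD GD e; apply/eqP; rewrite finset.eqEsubset !hull_subset // e.
Qed.

Lemma unique_combinations_affinely_independent F : F \in D -> affinely_independent Q F.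
Proof.
move=> FD c sc sQ; apply: (unique_nonneg_independent (Q := fun i => (Q i, 1 : R^o))).
  move=> c' d c0 d0 cF dF; rewrite !sum_pair => -[E1 E2].
  exact: (uQ FD FD).
have sum_in (W : nmodType) (f : I -> W) : \sum_(i in F) f i = \sum_i (if i \in F then f i else 0).
  by rewrite big_mkcond.
rewrite sum_in (eq_bigr (fun i => (if i \in F then c i else 0) *: (Q i, 1 : R^o))).
  rewrite sum_pair; congr (_, _); last by rewrite -sum_in.
  by rewrite -[RHS]sQ sum_in; apply: eq_bigr => i _; case: ifP; rewrite ?scale0r.
by move=> i _; case: ifP; rewrite ?scale0r.
Qed.

Lemma unique_combinations_realized :
  realized_by D [set hull (Q @` [set` F]) | F in [set` D]].
Proof.
exists Q; split=> //; first exact: unique_combinations_affinely_independent.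
move=> F G FD GD; apply/seteqP; split; last first.
  by move=> x h; split; move: x h; apply: sub_hull; rewrite ?finset.subsetIl ?finset.subsetIr.
rewrite !hullE => x [[c [c0 cF c1 ->]] [d [d0 dG d1 e]]].
have cd := uQ FD GD c0 d0 cF dG (etrans c1 (esym d1)) e.
exists c; split=> // i; rewrite inE negb_and => /orP[/cF //|/dG]; by rewrite cd.
Qed.

Lemma hull_simplex F : F \in D -> simplex #|F| (hull (Q @` [set` F])).
Proof.
move=> FD; exists (Q \o enum_val (A := F)).
  move=> c sc sQ j _.
  pose c' i := \sum_(k : 'I_#|F| | enum_val k == i) c k.
  have c'E k : c' (enum_val k) = c k.
    by rewrite /c' (eq_bigl (pred1 k)) ?big_pred1_eq // => l /=; rewrite (inj_eq enum_val_inj).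
  rewrite -c'E; apply: (unique_combinations_affinely_independent FD) (enum_valP j).
    rewrite big_enum_val -[RHS]sc [RHS](eq_bigl xpredT) => [|k]; last by rewrite inE.
    by apply: eq_bigr => k _; rewrite c'E.
  rewrite big_enum_val -[RHS]sQ [RHS](eq_bigl xpredT) => [|k]; last by rewrite inE.
  by apply: eq_bigr => k _; rewrite c'E.
congr hull; apply/seteqP; split=> x /=.
  by move=> [i iF <-]; exists (enum_rank_in iF i); rewrite //= enum_rankK_in.
by move=> [k _ <-]; exists (enum_val k) => //=; apply: enum_valP.
Qed.

End UniqueCombinations.

Lemma unique_combinations_homothety (I : finType) (Q : I -> V) D (v : V) (eps : R) :
  eps != 0 -> unique_combinations Q D ->
  unique_combinations (fun i => v + eps *: (Q i - v)) D.
Proof.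
move=> eps0 uQ F G c d FD GD c0 d0 cF dG sumE.
have E (b : I -> R) : \sum_i b i *: (v + eps *: (Q i - v)) =
    (\sum_i b i) *: ((1 - eps) *: v) + eps *: \sum_i b i *: Q i.
  rewrite scaler_suml scaler_sumr -big_split /=; apply: eq_bigr => i _.
  by apply/rowP => k; rewrite !mxE; ring.
rewrite !E sumE => /addrI /(scalerI eps0) sQ; exact: (uQ F G).
Qed.

Lemma homothety_hull (I : finType) (Q : I -> V) (F : {set I}) (v : V) (eps : R) :
  (fun x => v + eps *: (x - v)) @` hull (Q @` [set` F]) =
  hull ((fun i => v + eps *: (Q i - v)) @` [set` F]).
Proof.
rewrite !hullE.
have E (c : I -> R) : \sum_i c i = 1 ->
    \sum_i c i *: (v + eps *: (Q i - v)) = v + eps *: (\sum_i c i *: Q i - v).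
  move=> c1; rewrite -[in RHS](scale1r v) -c1 !scaler_suml -sumrB scaler_sumr -big_split /=.
  by apply: eq_bigr => i _; apply/rowP => k; rewrite !mxE; ring.
apply/seteqP; split=> x.
  by move=> [_ [c [c0 cF c1 ->]] <-]; exists c; split; rewrite ?E.
move=> [c [c0 cF c1 ->]]; exists (\sum_i c i *: Q i); first by exists c.
by rewrite E.
Qed.

Lemma unique_combinations_imset (I J : finType) (phi : I -> J) (U : {set I})
    (Q : J -> V) (D : {set {set I}}) (D' : {set {set J}}) :
  {in U &, injective phi} -> (forall F, F \in D -> F \subset U /\ phi @: F \in D') ->
  unique_combinations Q D' -> unique_combinations (Q \o phi) D.
Proof.
move=> injU DD' uQ F G c d FD GD c0 d0 cF dG.
have [/fintype.subsetP FU FD'] := DD' F FD; have [/fintype.subsetP GU GD'] := DD' G GD.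
pose push (b : I -> R) j := \sum_(i in U | phi i == j) b i.
have sumE (b : I -> R) (W : lmodType R) (q : J -> W) : (forall i, i \notin U -> b i = 0) ->
    \sum_i b i *: q (phi i) = \sum_j push b j *: q j.
  move=> bU; rewrite (bigID (mem U)) /= [X in _ + X]big1 ?addr0 => [|i /bU ->]; last by rewrite scale0r.
  rewrite (partition_big phi xpredT) //=; apply: eq_bigr => j _.
  by rewrite scaler_suml; apply: eq_bigr => i /andP[_ /eqP ->].
have pushE b i : i \in U -> push b (phi i) = b i.
  move=> iU; rewrite /push (eq_bigl (pred1 i)) ?big_pred1_eq // => j /=.
  apply/andP/eqP => [[jU /eqP /injU ->] //|->]; by rewrite iU eqxx.
have cU i : i \notin U -> c i = 0 by move=> iU; apply: cF; apply: contra iU => /FU.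
have dU i : i \notin U -> d i = 0 by move=> iU; apply: dG; apply: contra iU => /GU.
have sum1 b : (forall i, i \notin U -> b i = 0) -> \sum_i b i = \sum_j push b j.
  move=> bU; have := sumE b R^o (fun=> 1) bU.
  by under eq_bigr do rewrite [_ *: _]mulr1; under [in RHS]eq_bigr do rewrite [_ *: _]mulr1.
rewrite !sum1 // !(sumE _ _ Q) // => s1 sQ i.
have supp b (H : {set I}) j : (forall i, i \notin H -> b i = 0) -> j \notin phi @: H -> push b j = 0.
  move=> bH jH; apply: big1 => k /andP[_ /eqP kj]; apply: bH.
  by apply: contra jH => kH; apply/imsetP; exists k.
have [iU|iU] := boolP (i \in U); last by rewrite cU // dU.
rewrite -(pushE c) // -(pushE d) //; apply: (uQ _ _ _ _ FD' GD') => // j; try exact: sumr_ge0.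
  exact: supp cF.
exact: supp dG.
Qed.

Lemma affinely_independent_row_free k (p : 'I_k -> V) :
  affinely_independent p [set: 'I_k]%SET ->
  row_free (\matrix_i row_mx (p i) (1%:M : 'M[R]_1)).
Proof.
move=> ip; set M := \matrix_i _; rewrite -kermx_eq0; apply/eqP/row_matrixP => i.
rewrite row0; set a := row i _.
have aM : a *m M = 0 by apply/sub_kermxP; exact: row_sub.
have aE : a *m M = \sum_j a 0 j *: row_mx (p j) 1%:M.
  by rewrite mulmx_sum_row; apply: eq_bigr => j _; rewrite rowK.
have [h1 h2] : \sum_j a 0 j *: p j = 0 /\ \sum_j a 0 j = 0.
  split.
    apply/rowP => k0; have := congr1 (fun A : 'rV_(m + 1) => A 0 (lshift 1 k0)) aE.
    rewrite aM mxE summxE => E; rewrite summxE [RHS]mxE [RHS]E; apply: eq_bigr => j _.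
    by rewrite mxE [RHS]mxE row_mxEl.
  have := congr1 (fun A : 'rV_(m + 1) => A 0 (rshift m 0)) aE.
  rewrite aM mxE summxE => E; rewrite [RHS]E; apply: eq_bigr => j _.
  by rewrite [RHS]mxE row_mxEr [X in _ * X]mxE eqxx mulr1.
apply/rowP => j; rewrite [RHS]mxE; apply: (ip (fun j => a 0 j)); rewrite ?inE //.
  by rewrite -[RHS]h2; apply: eq_bigl => l; rewrite inE.
by rewrite -[RHS]h1; apply: eq_bigl => l; rewrite inE.
Qed.

(** In homogeneous coordinates the l independent vertices are combinations of the other k, so the
    bound is one on ranks. *)
Lemma simplex_dim k l (s : set V) : simplex k s -> simplex l s -> (l <= k)%N.
Proof.
move=> [p ip es] [q iq et].
have range_setT j (f : 'I_j -> V) : range f = f @` [set` [set: 'I_j]%SET].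
  by congr (_ @` _); apply/seteqP; split => x _ //=; rewrite inE.
have sq j : combinations p [set: 'I_k]%SET (q j).
  rewrite -hullE -range_setT -es et.
  by apply: sub_gen_smallest; exists j.
have [C hC] := choice sq.
set P := \matrix_i row_mx (p i) (1%:M : 'M[R]_1).
have : row_free (\matrix_i row_mx (q i) (1%:M : 'M[R]_1)).
  exact: affinely_independent_row_free.
rewrite (_ : \matrix_i _ = (\matrix_(i, j) C i j) *m P) /row_free.
  by move/eqP <-; apply: leq_trans (mxrankM_maxr _ _) (rank_leq_row _).
apply/row_matrixP => i; rewrite rowK row_mul mulmx_sum_row.
rewrite (eq_bigr (fun j => C i j *: row_mx (p j) 1%:M)) => [|j _]; last by rewrite /P rowK !mxE.
have [_ _ c1 ->] := hC i; apply/rowP => x; rewrite summxE mxE.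
case: splitP => y exy.
  rewrite summxE; apply: eq_bigr => j _; rewrite mxE [RHS]mxE.
  by rewrite (_ : x = lshift 1 y) ?row_mxEl //; apply: val_inj.
have -> : x = rshift m y by apply: val_inj.
rewrite mxE [y]ord1 eqxx -[LHS]c1; apply: eq_bigr => j _.
by rewrite [RHS]mxE row_mxEr mxE eqxx mulr1.
Qed.

End Combinations.

(** * Uniqueness of root combinations *)

Section RootCombinations.
Local Open Scope ring_scope.
Variables (R : realType) (m : nat).
Local Notation V := 'rV[R]_m.
Local Notation arc := ('I_m * 'I_m)%type.
Implicit Types (F G : {set arc}) (x : V).

(** On a combination of roots this is the weight of the arcs passing over the gap between p and p +
    1. *)
Definition cut (p : nat) x : R := \sum_(q : 'I_m | (q <= p)%N) x 0 q.

Lemma cut_root p (e : arc) : (e.1 < e.2)%N ->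
  cut p (Defs.root R m e.1 e.2) = ((e.1 <= p) && (p < e.2))%N%:R.
Proof.
move=> lt; rewrite /cut; under eq_bigr do rewrite mxE.
have S (i : 'I_m) : \sum_(q : 'I_m | (q <= p)%N) (q == i :> nat)%:R = (i <= p)%N%:R :> R.
  have [ip|ip] := leqP i p.
    rewrite (bigD1 i) //= eqxx big1 ?addr0 // => j /andP[_ /negPf].
    by rewrite -val_eqE /= => ->.
  by rewrite big1 // => j jp; case: eqP => // ji; rewrite ji leqNgt ip in jp.
rewrite sumrB !S; have [h1|h1] := leqP e.1 p; have [h2|h2] := leqP e.2 p => //=; rewrite ?subrr ?subr0 //.
by have := leq_trans lt (leq_trans h2 (ltnW h1)); rewrite ltnn.
Qed.

Lemma cut_sum (I : finType) (c : I -> R) (Q : I -> V) p :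
  cut p (\sum_e c e *: Q e) = \sum_e c e * cut p (Q e).
Proof.
rewrite /cut; under eq_bigr do rewrite summxE; rewrite exchange_big /=.
by apply: eq_bigr => e _; rewrite mulr_sumr; apply: eq_bigr => q _; rewrite mxE.
Qed.

Section Cover.
Variables (F : {set arc}) (c : arc -> R).
Hypotheses (incF : increasing F) (cF : compatible F).
Hypotheses (c0 : forall e, 0 <= c e) (supp : forall e, e \notin F -> c e = 0).
Let x := \sum_e c e *: Defs.root R m e.1 e.2.

Definition cover (k l : nat) : R := \sum_(e : arc | (e.1 <= k)%N && (l <= e.2)%N) c e.

Lemma cut_combination p : cut p x = \sum_(e : arc | (e.1 <= p)%N && (p < e.2)%N) c e.
Proof.
rewrite cut_sum [RHS]big_mkcond /=; apply: eq_bigr => e _.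
have [eF|eF] := boolP (e \in F); last by rewrite supp // mul0r if_same.
by rewrite cut_root ?incF //; case: ifP; rewrite ?mulr1 ?mulr0.
Qed.

Lemma cover_le_cut k l p : (k <= p)%N -> (p < l)%N -> cover k l <= cut p x.
Proof.
move=> kp pl; rewrite cut_combination /cover big_mkcond [leRHS]big_mkcond /=.
apply: ler_sum => e _; case: ifP => [/andP[h1 h2]|_]; last by case: ifP.
by rewrite (leq_trans h1 kp) (leq_trans pl h2).
Qed.

(* Cut at the end of the longest arc that starts at or before k and ends       *)
(* inside [k, l), or at k if there is none.                                    *)
Lemma cover_is_cut k l : (k < l)%N ->
  exists p, [/\ (k <= p)%N, (p < l)%N & cut p x = cover k l].
Proof.
move=> kl.
pose P p := (p == k) || [exists e : arc in F, [&& e.1 <= k, k < e.2, e.2 < l & e.2 == p :> nat]]%N.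
have Pl p : P p -> (p <= l)%N.
  case/orP => [/eqP ->|/existsP[e /and5P[_ _ _ h /eqP <-]]]; exact: ltnW.
have Pk : exists p, P p by exists k; rewrite /P eqxx.
case: (ex_maxnP Pk Pl) => p Pp pmax; exists p.
have kp : (k <= p)%N by apply: pmax; rewrite /P eqxx.
have pl : (p < l)%N by case/orP: Pp => [/eqP -> //|/existsP[e /and5P[_ _ _ h /eqP <-]]].
split=> //; rewrite cut_combination /cover big_mkcond [RHS]big_mkcond /=.
apply: eq_bigr => f _; have [fF|fF] := boolP (f \in F); last by rewrite supp // !if_same.
congr (if _ then _ else _).
apply/idP/idP => /andP[h1 h2]; last by rewrite (leq_trans h1 kp) (leq_trans pl h2).
have [fk|fk] := leqP f.1 k.
  rewrite /= leqNgt; apply/negP => fl.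
  suff Pf : P f.2 by move: (pmax _ Pf); rewrite leqNgt h2.
  apply/orP; right; apply/existsP; exists f; rewrite fF fk fl eqxx !andbT /=.
  exact: leq_ltn_trans h2.
case/orP: Pp => [/eqP pk|/existsP[e /and5P[eF e1 e2 e3 /eqP e4]]].
  by move: fk; rewrite ltnNge -pk h1.
have /compatibleP/(_ e f eF fF)/negP[] := cF.
by rewrite /arc_conflict (leq_ltn_trans e1 fk) e4 h1.
Qed.

End Cover.

(** Each [cover] is a cut of the common point and at most the cuts of its interval, so both
    combinations have equal covers. The cover of the ends of e is the weight of e plus that of
    longer arcs, so the weights agree by induction, longest arcs first. *)
Lemma root_combination_unique F G (c d : arc -> R) :
  increasing F -> compatible F -> increasing G -> compatible G ->
  (forall e, 0 <= c e) -> (forall e, 0 <= d e) ->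
  (forall e, e \notin F -> c e = 0) -> (forall e, e \notin G -> d e = 0) ->
  \sum_e c e *: Defs.root R m e.1 e.2 = \sum_e d e *: Defs.root R m e.1 e.2 -> c =1 d.
Proof.
move=> incF cF incG cG c0 d0 suppc suppd E.
have coverE k l : (k < l)%N -> cover c k l = cover d k l.
  move=> kl; apply/eqP; rewrite eq_le.
  have [p [p1 p2 p3]] := cover_is_cut incF cF suppc kl.
  have [q [q1 q2 q3]] := cover_is_cut incG cG suppd kl.
  rewrite -{2}p3 -{1}q3 {1}E -{1}E.
  by rewrite -{1}E (cover_le_cut incF c0 suppc q1 q2) E (cover_le_cut incG d0 suppd p1 p2).
move=> e; move eqk: (m - (e.2 - e.1))%N => k.
elim/ltn_ind: k e eqk => k IH e ek.
have [lt|ge] := ltnP e.1 e.2; last first.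
  rewrite suppc ?suppd //; [have inc := incG|have inc := incF];
    by apply/negP => /inc; rewrite ltnNge ge.
have := coverE _ _ lt; rewrite /cover (bigD1 e) ?leqnn //= [RHS](bigD1 e) ?leqnn //=.
rewrite (eq_bigr d) => [/addIr //|f /andP[/andP[f1 f2] fe]].
apply: (IH _ _ f erefl); rewrite -ek.
have ne : (f.1 != e.1 :> nat) || (f.2 != e.2 :> nat).
  by rewrite -negb_and; apply: contra fe; rewrite !val_eqE; case: f e {f1 f2 lt ek} => [? ?] [? ?].
move: f1 f2 lt ne (ltn_ord e.2) (ltn_ord f.2); clear; lia.
Qed.

(** The roots along F are independent by uniqueness of combinations; those along H span every e_i -
    e_j by adding up along paths. *)
Lemma compatible_card_le_connected F (H : {set arc}) : increasing F -> compatible F ->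
  (forall i j, connect (adjacent H) i j) -> (#|F| <= #|H|)%N.
Proof.
move=> incF cF conH.
pose rt (e : arc) : V := Defs.root R m e.1 e.2.
pose M (E : {set arc}) : 'M[R]_(#|E|, m) := \matrix_(k < #|E|) rt (enum_val k).
have memM (E : {set arc}) (e : arc) : e \in E -> (rt e <= M E)%MS.
  move=> eE; have := row_sub (enum_rank_in eE e) (M E).
  by rewrite rowK enum_rankK_in.
have rtN i j : Defs.root R m i j = - Defs.root R m j i.
  by apply/rowP => q; rewrite !mxE opprB.
have con i j : (Defs.root R m (i : 'I_m) (j : 'I_m) <= M H)%MS.
  have /connectP[p pth ->] := conH i j; elim: p i pth => [|k p IH] i /=.
    move=> _; rewrite (_ : Defs.root _ _ _ _ = 0) ?sub0mx //.
    by apply/rowP => q; rewrite !mxE subrr.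
  case/andP => ik /IH h.
  have -> : Defs.root R m i (last k p) = Defs.root R m i k + Defs.root R m k (last k p).
    by apply/rowP => q; rewrite !mxE addrA subrK.
  apply: addmx_sub h; case/orP: ik => [/memM //|ki].
  by rewrite rtN eqmx_opp (memM _ _ ki).
have sub : (M F <= M H)%MS by apply/row_subP => k; rewrite rowK; exact: con.
have freeF : row_free (M F).
  rewrite -kermx_eq0; apply/eqP/row_matrixP => i; rewrite row0; set a := row i _.
  have aM : a *m M F = 0 by apply/sub_kermxP; exact: row_sub.
  pose b e := \sum_(k : 'I_#|F| | enum_val k == e) a 0 k.
  have bE k : b (enum_val k) = a 0 k.
    by rewrite /b (eq_bigl (pred1 k)) ?big_pred1_eq // => l /=; rewrite (inj_eq enum_val_inj).
  apply/rowP => k; rewrite [RHS]mxE -bE; apply: (unique_nonneg_independent (Q := rt)) (enum_valP k).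
    by move=> c d c0 d0; apply: root_combination_unique.
  rewrite big_enum_val -[RHS]aM mulmx_sum_row; apply: eq_bigr => l _.
  by rewrite bE rowK.
have := mxrankS sub; move: freeF; rewrite /row_free => /eqP ->.
by move/leq_trans; apply; apply: rank_leq_row.
Qed.

End RootCombinations.

(** * The section of the canonical triangulation *)

Section ArcComplex.
Local Open Scope ring_scope.
Local Open Scope classical_set_scope.
Variables (R : realType) (m : nat).
Local Notation V := 'rV[R]_m.
Local Notation arc := ('I_m * 'I_m)%type.
Local Notation rt e := (Defs.root R m (nat_of_ord e.1) (nat_of_ord e.2)).
Variables (T0 : {set arc}) (S K : pred 'I_m) (lo hi : 'I_m).
Hypotheses (lo0 : lo = 0%N :> nat) (him : hi = m.-1 :> nat) (lohi : lo != hi).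
Hypotheses (S_lo : S lo) (K_hi : K hi) (SK : forall v, S v || K v).
Hypothesis T0E : trans_closure T0 = arcs S K.
Variables (u : V) (c : R).
Hypothesis sep : separates_0 T0 u c.
Implicit Types (e f : arc) (F G T : {set arc}) (x : V).

Lemma dot_sum (I : finType) (w : I -> R) (Q : I -> V) :
  dot u (\sum_i w i *: Q i) = \sum_i w i * dot u (Q i).
Proof.
rewrite /dot; under eq_bigr do rewrite summxE mulr_sumr.
rewrite exchange_big /=; apply: eq_bigr => i _; rewrite mulr_sumr.
by apply: eq_bigr => k _; rewrite mxE mulrCA.
Qed.

Lemma dotZ (a : R) x : dot u (a *: x) = a * dot u x.
Proof.
by rewrite /dot mulr_sumr; apply: eq_bigr => k _; rewrite mxE mulrCA.
Qed.

Lemma graph_cone_closure i j : connect [rel i j : 'I_m | (i < j)%N && ((i, j) \in T0)] i j ->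
  graph_cone T0 (Defs.root R m i j).
Proof.
move=> /connectP[p pth ->] {j}; elim: p i pth => [|k p IH] i /=.
  move=> _; exists (fun=> 0) => //; rewrite big1 => [|e _]; last by rewrite scale0r.
  by apply/rowP => q; rewrite !mxE subrr.
case/andP => /andP[_ ik] /IH [w w0 E].
exists (fun e => w e + (e == (i, k))%:R) => [e|]; first by rewrite addr_ge0 // ler0n.
have -> : Defs.root R m i (last k p) = Defs.root R m i k + Defs.root R m k (last k p).
  by apply/rowP => q; rewrite !mxE addrA subrK.
rewrite E addrC; under [RHS]eq_bigr do rewrite scalerDl.
rewrite big_split /=; congr (_ + _).
rewrite (bigD1 (i, k)) //= eqxx scale1r big1 ?addr0 // => e /andP[_ /negPf ->].
by rewrite scale0r.
Qed.

Lemma dot_root e : e \in arcs S K -> c < dot u (rt e).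
Proof.
rewrite -T0E inE => /andP[lt con]; case: sep => _; apply.
by exists e.1, e.2; split=> //; exact: graph_cone_closure.
Qed.

Lemma c_gt0 : 0 < c. Proof. by case: sep. Qed.

Lemma dot_root_gt0 e : e \in arcs S K -> 0 < dot u (rt e).
Proof. by move=> /dot_root; apply: lt_trans c_gt0. Qed.

(** The point where the ray through the root of e meets the hyperplane. *)
Definition arc_vertex e : V := (c / dot u (rt e)) *: rt e.

Definition arc_faces : {set {set arc}} := [set F | compatible_arcs S K F].

Lemma arc_facesP F : F \in arc_faces -> [/\ {subset F <= arcs S K}, increasing F & compatible F].
Proof.
rewrite inE => /andP[sF cF]; split=> //; first exact/fintype.subsetP.
exact: increasing_sub sF (@increasing_arcs _ _ _).
Qed.

Lemma arc_faces_sub F G : F \subset G -> G \in arc_faces -> F \in arc_faces.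
Proof.
rewrite !inE => FG /andP[sG cG].
by rewrite /compatible_arcs (fintype.subset_trans FG sG) (compatible_sub FG cG).
Qed.

Lemma dot_arc_vertex e : e \in arcs S K -> dot u (arc_vertex e) = c.
Proof. by move=> eG; rewrite dotZ divfK // gt_eqF // dot_root_gt0. Qed.

Lemma arc_vertex_unique : unique_combinations arc_vertex arc_faces.
Proof.
move=> F G w w' /arc_facesP[sF incF cF] /arc_facesP[sG incG cG] w0 w0' wF wG _.
have scaled (b : arc -> R) (H : {set arc}) : {subset H <= arcs S K} ->
    (forall e, 0 <= b e) -> (forall e, e \notin H -> b e = 0) ->
    forall e, 0 <= b e * (c / dot u (rt e)) /\ (e \notin H -> b e * (c / dot u (rt e)) = 0).
  move=> sH b0 bH e; have [eH|eH] := boolP (e \in H).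
    by split=> //; rewrite mulr_ge0 // divr_ge0 // ltW // ?c_gt0 // dot_root_gt0 // sH.
  by rewrite bH // mul0r lexx.
rewrite /arc_vertex; under eq_bigr do rewrite scalerA.
under [in RHS]eq_bigr do rewrite scalerA.
move=> /(root_combination_unique incF cF incG cG) E.
have {}E := E (fun e => (scaled _ _ sF w0 wF e).1) (fun e => (scaled _ _ sG w0' wG e).1)
  (fun e => (scaled _ _ sF w0 wF e).2) (fun e => (scaled _ _ sG w0' wG e).2).
move=> e; have [eG|eG] := boolP (e \in arcs S K).
  by apply: mulIf (E e); rewrite mulf_neq0 ?invr_neq0 // gt_eqF ?c_gt0 // dot_root_gt0.
rewrite wF ?wG //; apply: contra eG; [exact: sG|exact: sF].
Qed.

(** A root in the cone of a compatible T is a combination along T and along a single arc; by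
    uniqueness this arc is in T. *)
Lemma cone_roots_arcs T x : T \in arc_faces ->
  cone_roots T x <-> exists2 e, e \in T & x = rt e.
Proof.
move=> TD; have [sT incT cT] := arc_facesP TD; split; last first.
  move=> [e eT ->]; exists e.1, e.2; split; [exact: incT|by []|].
  exists (fun f => (f == e)%:R) => [f|]; first exact: ler0n.
  rewrite (bigD1 e) //= eqxx scale1r big1 ?addr0 // => f /andP[_ /negPf ->].
  by rewrite scale0r.
move=> [i [j [ij -> [w w0 E]]]]; exists (i, j) => //.
pose w' e := if e \in T then w e else 0.
pose d e : R := (e == (i, j))%:R.
have E' : \sum_e w' e *: rt e = \sum_e d e *: rt e.
  rewrite (combination1 (fun e : arc => rt e)) /= E [RHS]big_mkcond.
  by apply: eq_bigr => e _; rewrite /w'; case: ifP; rewrite ?scale0r.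
have incij : increasing [set (i, j)]%SET by move=> e /set1P ->.
have cij : compatible [set (i, j)]%SET.
  by apply/compatibleP => e f /set1P -> /set1P ->; rewrite /arc_conflict ltnn.
have [//|ijT] := boolP ((i, j) \in T).
have w'0 e : 0 <= w' e by rewrite /w'; case: ifP.
have w'T e : e \notin T -> w' e = 0 by rewrite /w' => /negPf ->.
have d0 e : 0 <= d e by exact: ler0n.
have d1 e : e \notin [set (i, j)]%SET -> d e = 0 by rewrite /d inE => /negPf ->.
have := root_combination_unique incT cT incij cij w'0 d0 w'T d1 E' (i, j).
by rewrite w'T // /d eqxx => /esym/eqP; rewrite oner_eq0.
Qed.

(** Vertex sets of the faces of the triangulation, [None] being the origin. *)
Definition with_origin (b : bool) F : {set option arc} :=
  [set o | if o is Some e then e \in F else b]%SET.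

Definition polytope_vertex (o : option arc) : V := if o is Some e then rt e else 0.

Lemma big_option (I : finType) (W : nmodType) (f : option I -> W) :
  \sum_o f o = f None + \sum_i f (Some i).
Proof.
rewrite (bigD1 None) //=; congr (_ + _).
rewrite (reindex_omap Some id) /=; last by case.
by apply: eq_bigl => i; rewrite eqxx.
Qed.

Lemma polytope_vertex_sum (b : option arc -> R) :
  \sum_o b o *: polytope_vertex o = \sum_e b (Some e) *: rt e.
Proof. by rewrite big_option scaler0 add0r. Qed.

Lemma section_hull b F : F \in arc_faces ->
  hull (polytope_vertex @` [set` with_origin b F]) `&` hyperplane u c =
  hull (arc_vertex @` [set` if b then F else finset.set0]).
Proof.
move=> FD; have [sF _ _] := arc_facesP FD.
have dF e : e \in F -> 0 < dot u (rt e) by move=> /sF; apply: dot_root_gt0.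
have c0 := c_gt0; rewrite !hullE; apply/seteqP; split.
  move=> _ [[w [w0 wF w1 ->]]]; rewrite /hyperplane /= polytope_vertex_sum dot_sum => E.
  have wS e : e \notin F -> w (Some e) = 0 by move=> eF; apply: wF; rewrite inE.
  case: b wF => wF.
    exists (fun e => w (Some e) * (dot u (rt e) / c)); split=> [e|e eF||].
    - have [eF|eF] := boolP (e \in F); last by rewrite wS // mul0r.
      by rewrite mulr_ge0 // divr_ge0 // ltW // dF.
    - by rewrite wS // mul0r.
    - under eq_bigr do rewrite mulrA.
      by rewrite -mulr_suml E divff // gt_eqF.
    - apply: eq_bigr => e _; have [eF|eF] := boolP (e \in F); last by rewrite wS // mul0r !scale0r.
      rewrite /arc_vertex scalerA; congr (_ *: _).
      by field; rewrite !gt_eqF ?dF.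
  exfalso; move: w1; rewrite big_option wF ?inE // add0r => w1.
  have E' : \sum_e w (Some e) * (dot u (rt e) - c) = 0.
    by under eq_bigr do rewrite mulrBr; rewrite sumrB E -mulr_suml w1 mul1r subrr.
  have pos e : true -> 0 <= w (Some e) * (dot u (rt e) - c).
    move=> _; have [eF|eF] := boolP (e \in F); last by rewrite wS // mul0r.
    by rewrite mulr_ge0 // subr_ge0 ltW // dot_root // sF.
  have w00 e : w (Some e) = 0.
    have [eF|/wS //] := boolP (e \in F).
    have /eqP := @psumr_eq0P _ _ _ _ pos E' e isT; rewrite /= mulf_eq0 => /orP[/eqP //|].
    by rewrite subr_eq0 gt_eqF // dot_root // sF.
  by move: w1; rewrite big1 // => /esym/eqP; rewrite oner_eq0.
case: b => [|x [w [w0 wF w1 _]]]; last first.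
  by move: w1; rewrite big1 => [/esym/eqP|e _]; rewrite ?oner_eq0 // wF // inE.
move=> x [w [w0 wF w1 ->]]; split; last first.
  rewrite /hyperplane /= dot_sum -[RHS]mul1r -w1 mulr_suml; apply: eq_bigr => e _.
  by have [eF|eF] := boolP (e \in F); [rewrite dot_arc_vertex // sF|rewrite wF // !mul0r].
pose t e := w e * (c / dot u (rt e)).
have t_le e : t e <= w e.
  have [eF|eF] := boolP (e \in F); last by rewrite /t wF // mul0r.
  by rewrite ler_piMr // ler_pdivrMr ?dF // mul1r ltW // dot_root // sF.
(* Rescaling to the roots lowers the total weight; the origin takes up the rest. *)
exists (fun o => if o is Some e then t e else 1 - \sum_e t e); split => [[e|]|[e|]||].
- have [eF|eF] := boolP (e \in F); last by rewrite /t wF // mul0r.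
  by rewrite mulr_ge0 // divr_ge0 // ltW // dF.
- by rewrite subr_ge0 -w1 ler_sum.
- by rewrite inE /t => eF; rewrite wF // mul0r.
- by rewrite inE.
- by rewrite big_option subrK.
- by rewrite polytope_vertex_sum; apply: eq_bigr => e _; rewrite /arc_vertex scalerA.
Qed.

Lemma section_arc_faces :
  section_triangulation T0 u c = [set hull (arc_vertex @` [set` F]) | F in [set` arc_faces]].
Proof.
have pvE (b : bool) F (A : set V) : (forall x, A x <-> (b /\ x = 0) \/ exists2 e, e \in F & x = rt e) ->
    A = polytope_vertex @` [set` with_origin b F].
  move=> hA; apply/seteqP; split => x.
    case/hA => [[bt ->]|[e eF ->]]; first by exists None => //=; rewrite inE.
    by exists (Some e) => //=; rewrite inE.
  move=> [[e|] /=]; rewrite inE => h <-; apply/hA; first by right; exists e.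
  by left.
apply/seteqP; split => s.
  move=> [_ [T [A [canT sA ->]]] <-].
  have TD : T \in arc_faces by rewrite inE; apply: canonical_tree_compatible canT.
  have roots := cone_roots_arcs _ TD.
  pose F := [set e in T | `[< A (rt e) >]]%SET.
  have FT : F \subset T by apply/fintype.subsetP => e; rewrite inE => /andP[].
  have EA : A = polytope_vertex @` [set` with_origin `[< A 0 >] F].
    apply: pvE => x.
    split=> [Ax|[[/asboolP A0 ->]//|[e]]]; last by rewrite inE => /andP[_ /asboolP Ae] ->.
    case: (sA x Ax) => [x0|/roots[e eT xe]]; first by left; split=> //; apply/asboolP; rewrite -x0.
    by right; exists e => //; rewrite inE eT; apply/asboolP; rewrite -xe.
  rewrite [X in hull X]EA section_hull ?(arc_faces_sub FT TD) //.
  exists (if `[< A 0 >] then F else finset.set0) => //=.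
  by apply: arc_faces_sub TD; case: ifP => // _; apply: finset.sub0set.
move=> [F /= FD <-]; have := FD; rewrite inE => cF.
have [T mT FT] := maximal_compatible_extend cF.
have TD : T \in arc_faces by rewrite inE; case/maxsetP: mT.
have roots := cone_roots_arcs _ TD.
exists (hull (polytope_vertex @` [set` with_origin true F])); last by rewrite section_hull.
exists T, (polytope_vertex @` [set` with_origin true F]); split=> //.
  exact: (canonical_tree_maximal lo0 him S_lo K_hi SK T0E mT).
move=> x [[e|] /=]; rewrite inE => h <-; last by left.
by right; apply/roots; exists e => //; apply: (fintype.subsetP FT).
Qed.

Local Notation CC := (section_triangulation T0 u c).
Local Notation facets := (maxset (compatible_arcs S K)).
Local Notation e0 := (lo, hi).
Local Notation hF F := (hull (arc_vertex @` [set` F])).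
Let v := arc_vertex e0.

Lemma section_face F : F \in arc_faces -> CC (hF F).
Proof. by move=> FD; rewrite section_arc_faces; exists F. Qed.

Lemma section_faceP s : CC s -> exists2 F, F \in arc_faces & s = hF F.
Proof. by rewrite section_arc_faces => -[F FD <-]; exists F. Qed.

Lemma long_face : [set e0]%SET \in arc_faces.
Proof.
rewrite inE -[X in compatible_arcs _ _ X]finset.setU0.
apply: compatible_arcsU1_long => //; rewrite /compatible_arcs finset.sub0set.
by apply/compatibleP => e f; rewrite inE.
Qed.

Lemma long_face_hull : hF [set e0]%SET = [set v].
Proof.
rewrite hullE; apply/seteqP; split => x /=.
  move=> [w [w0 wF w1 ->]]; have wE e : e != e0 -> w e = 0 by move=> h; apply: wF; rewrite inE.
  rewrite (bigD1 e0) //= big1 ?addr0 => [|e /wE ->]; last by rewrite scale0r.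
  move: w1; rewrite (bigD1 e0) //= big1 ?addr0 => [->|e /wE //]; by rewrite scale1r.
by move=> ->; apply: mem_combinations; rewrite inE.
Qed.

Lemma mem_long_vertex F : F \in arc_faces -> hF F v -> e0 \in F.
Proof. by move=> FD; apply: (hull_vertex arc_vertex_unique FD long_face); rewrite inE. Qed.

Lemma long_vertex_mem F : e0 \in F -> hF F v.
Proof. by move=> h; apply: sub_gen_smallest; exists e0. Qed.

Lemma section_dot F x : F \in arc_faces -> hF F x -> dot u x = c.
Proof.
move=> /arc_facesP[sF _ _]; rewrite hullE => -[w [w0 wF w1 ->]].
rewrite dot_sum -[RHS]mul1r -w1 mulr_suml; apply: eq_bigr => e _.
by have [eF|eF] := boolP (e \in F); [rewrite dot_arc_vertex // sF|rewrite wF // !mul0r].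
Qed.

Lemma long_vertex_unique (w : V) (t : R) :
  CC [set w] -> w = t *: Defs.root R m 0 m.-1 -> v = w.
Proof.
move=> /section_faceP[F FD E] wt.
have dw : dot u w = c by apply: (section_dot FD); rewrite -E.
have e0G : e0 \in arcs S K by apply: long_arc_arcs.
move: dw; rewrite {1}wt dotZ /v /arc_vertex /= lo0 him => <-.
rewrite mulfK ?wt //; have := dot_root_gt0 e0G; rewrite /= lo0 him => h.
by rewrite gt_eqF.
Qed.

(** The long arc can be added to any face, so every face avoiding it is in the link. *)
Lemma linkE : link CC v = [set hF F | F in [set F | F \in arc_faces /\ e0 \notin F]].
Proof.
apply/seteqP; split => t.
  move=> [/section_faceP[F FD ->] nv _]; exists F => //; split=> //.
  by apply: contra_notN nv => /long_vertex_mem.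
move=> [F [FD nF] <-]; split; first exact: section_face.
  by move=> /(mem_long_vertex FD); apply/negP.
exists (hF (e0 |: F)%SET); split.
- by apply: section_face; move: FD; rewrite !inE; apply: compatible_arcsU1_long.
- by apply: long_vertex_mem; rewrite setU11.
- by apply: sub_hull; apply: finset.subsetUr.
Qed.

Lemma facet_hull T : facets T -> facet CC (hF T).
Proof.
case/maxsetP => cT maxT; have TD : T \in arc_faces by rewrite inE.
split; first exact: section_face.
move=> _ /section_faceP[G GD ->] s; rewrite (maxT G) //; first by rewrite inE in GD.
exact: (hull_subset arc_vertex_unique TD GD).
Qed.

Lemma facetP (f : set V) : facet CC f -> exists2 T, facets T & f = hF T.
Proof.
move=> [/section_faceP[F FD ->] maxF]; exists F => //; have := FD; rewrite inE => cF.
apply/maxsetP; split=> // G cG FG; have GD : G \in arc_faces by rewrite inE.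
apply: (hull_inj arc_vertex_unique GD FD); apply: maxF; first exact: section_face.
exact: sub_hull.
Qed.

Lemma boundary_facet_hull T e : facets T -> e \in T ->
    (forall T', facets T' -> T :\ e \subset T' -> T' = T) ->
  boundary_facet CC (hF (T :\ e)%SET).
Proof.
move=> mT eT uT; have TD : T \in arc_faces by rewrite inE; case/maxsetP: mT.
have sT : T :\ e \subset T := finset.subsetDl _ _.
have TeD := arc_faces_sub sT TD.
split; first exact: section_face.
exists (hF T); split; [exact: facet_hull|exact: sub_hull| |].
  exists #|T :\ e|; split; last exact: (hull_simplex arc_vertex_unique).
  have <- : #|T| = #|T :\ e|.+1 by rewrite (cardsD1 e) eT.
  exact: (hull_simplex arc_vertex_unique).
move=> g /facetP[T' mT' ->] s; rewrite (uT T') //.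
apply: (hull_subset arc_vertex_unique) => //.
by rewrite inE; case/maxsetP: mT'.
Qed.

Lemma long_vertex_boundary (x : 'I_m) : x != lo -> x != hi -> ~~ (S x && K x) ->
  boundary_complex CC [set v].
Proof.
move=> xlo xhi nSK.
have [T [e [mT eT ee0 uT]]] : exists T e, [/\ facets T, e \in T, e != e0
    & forall T', facets T' -> T :\ e \subset T' -> T' = T].
  case/nandP: nSK => h; first exact: (free_arc_to_sink lo0 him S_lo K_hi SK h).
  exact: (free_arc_from_source lo0 him S_lo K_hi SK h).
split; first by rewrite -long_face_hull; apply: section_face; apply: long_face.
exists (hF (T :\ e)%SET); first exact: boundary_facet_hull.
rewrite -long_face_hull; apply: sub_hull; rewrite finset.sub1set in_setD1 eq_sym ee0.
exact: (long_arc_maximal lo0 him S_lo K_hi lohi mT).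
Qed.

(** A codimension 1 face lacking an arc other than the long one lies in a second facet by [flip].
    One lacking only the long arc lies in a single facet, because every facet contains that arc. *)
Lemma boundaryE : (forall x : 'I_m, x != lo -> x != hi -> S x && K x) ->
  boundary_complex CC = [set hF F | F in [set F | F \in arc_faces /\ e0 \notin F]].
Proof.
move=> inner; apply/seteqP; split => s.
  move=> [/section_faceP[F FD ->] [_ [/section_faceP[G GD ->]]]].
  move=> [_ [/facetP[T mT ->] GT [k [sk1 sk]] uT]] FG.
  have TD : T \in arc_faces by rewrite inE; case/maxsetP: mT.
  have {}GT : G \subset T by exact: (hull_subset arc_vertex_unique).
  have {}FG : F \subset G by exact: (hull_subset arc_vertex_unique).
  exists F => //; split=> //; apply/negP => /(fintype.subsetP FG) e0G.
  (* The two hulls are simplices with k and k + 1 vertices, which [simplex_dim] keeps apart. *)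
  have nGT : G != T.
    by apply/eqP => e; have := simplex_dim sk; rewrite e => /(_ _ sk1); rewrite ltnn.
  have [e eT eG] : exists2 e, e \in T & e \notin G.
    by apply/subsetPn; apply: contra nGT => h; rewrite finset.eqEsubset GT.
  have ee0 : e != e0 by apply: contraNneq eG => ->.
  have [T' [mT' sT' neT]] := flip lo0 him S_lo K_hi inner mT eT ee0.
  case/eqP: neT; have TD' : T' \in arc_faces by rewrite inE; case/maxsetP: mT'.
  apply: (hull_inj arc_vertex_unique TD' TD); apply: uT; first exact: facet_hull.
  apply: sub_hull; apply: fintype.subset_trans sT'; apply/fintype.subsetP => f fG.
  rewrite in_setD1 (fintype.subsetP GT) // andbT.
  by apply: contraNneq eG => <-.
move=> [F [FD nF] <-]; split; first exact: section_face.
have /(maximal_compatible_extend)[T mT sT] : compatible_arcs S K (e0 |: F).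
  by apply: compatible_arcsU1_long => //; rewrite inE in FD.
exists (hF (T :\ e0)%SET).
  apply: boundary_facet_hull => //; first by apply: (fintype.subsetP sT); rewrite setU11.
  move=> T' mT' sT'; have [cT' _] := maxsetP mT'; have [_ max] := maxsetP mT.
  apply: max => //; rewrite -(finset.setD1K (long_arc_maximal lo0 him S_lo K_hi lohi mT)).
  by rewrite finset.subUset finset.sub1set sT' (long_arc_maximal lo0 him S_lo K_hi lohi mT').
apply: sub_hull; apply/fintype.subsetP => f fF; rewrite in_setD1.
rewrite (fintype.subsetP sT) ?inE ?fF ?orbT // andbT.
by apply: contraNneq nF => <-.
Qed.

End ArcComplex.

(** * The core as a link *)

Section BoxesAndArcs.
Local Open Scope nat_scope.
Local Open Scope set_scope.
Variables (n : nat) (pi : 'S_n).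
Hypotheses (pi_dominant : one_dominant pi) (pi_neq1 : pi != 1%g).
Local Notation D := (is_cross (diagram pi)).
Local Notation R := (is_cross (region pi)).
Local Notation H := (col_height pi).
Local Notation W := (row_length pi 0).
Local Notation lab := (label pi).
Local Notation m := (num_labels pi).
Local Notation S := (@is_E_label n pi).
Local Notation K := (@is_N_label n pi).
Implicit Types (p q : pos n) (F G : {set pos n}).

Let m_gt0 : 0 < m := num_labels_gt0 pi_dominant pi_neq1.

Definition first_label : 'I_m := Ordinal m_gt0.

Lemma pred_num_labels_lt : m.-1 < m. Proof. by rewrite prednK. Qed.

Definition last_label : 'I_m := Ordinal pred_num_labels_lt.

Local Notation lo := first_label.
Local Notation hi := last_label.

Lemma first_labelE : lo = 0 :> nat. Proof. by []. Qed.
Lemma last_labelE : hi = m.-1 :> nat. Proof. by []. Qed.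

Lemma W0 : 0 < W. Proof. exact: ltnW (W_gt1 pi_dominant pi_neq1). Qed.
Lemma H0 : 0 < H 0. Proof. exact: ltnW (H0_gt1 pi_dominant pi_neq1). Qed.

Lemma first_E_label : S lo.
Proof. by apply/is_E_labelP; exists 0; rewrite ?W0 // label_E0. Qed.

Lemma last_N_label : K hi.
Proof. by apply/is_N_labelP; exists 0; rewrite ?H0 // label_N0. Qed.

Lemma first_neq_last : lo != hi.
Proof.
rewrite -val_eqE /= -(label_E0 pi_dominant pi_neq1) -(label_N0 pi_dominant pi_neq1).
by rewrite ltn_eqF // label_E_lt_N // -col_heightE ?H0.
Qed.

(** On the region the labels are below m, so the default [lo] of [insubd] does not intervene. *)
Definition arc_of p : 'I_m * 'I_m :=
  (insubd lo (lab (inl (p.2 : nat))), insubd lo (lab (inr (p.1 : nat)))).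

Lemma region_pos p : p \in region pi -> [/\ R p.1 p.2, p.1 < H 0 & p.2 < W].
Proof.
rewrite -is_cross_pos => Rp; have [h1 h2] := region_bounds pi_dominant pi_neq1 Rp.
by split.
Qed.

Lemma arc_of1 p : p \in region pi -> (arc_of p).1 = lab (inl (p.2 : nat)) :> nat.
Proof. by move=> /region_pos[_ _ h]; rewrite val_insubd label_E_lt_m. Qed.

Lemma arc_of2 p : p \in region pi -> (arc_of p).2 = lab (inr (p.1 : nat)) :> nat.
Proof. by move=> /region_pos[_ h _]; rewrite val_insubd label_N_lt_m. Qed.

(** N labels decrease as the row number grows, so the box p in the upper row gives the second arc.
    The corner of the two boxes enters through [label_E_le_N]. *)
Lemma arc_of_conflict p q : p \in region pi -> q \in region pi ->
  arc_conflict (arc_of q) (arc_of p) = box_conflict pi p q.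
Proof.
move=> pR qR; have [Rp p1 p2] := region_pos pR; have [Rq q1 q2] := region_pos qR.
rewrite /arc_conflict /box_conflict !arc_of1 // !arc_of2 //.
rewrite leq_label_E // leq_label_N // andbC andbA andbC -andbA.
case: ltnP => [lt1|]; last by rewrite !andbF.
case: ltnP => [lt2|]; last by rewrite !andbF.
by rewrite !andbT label_E_le_N //; [exact: leq_ltn_trans (leq0n _) lt2|exact: leq_ltn_trans (leq0n _) lt1].
Qed.

Lemma arc_of_inj : {in region pi &, injective arc_of}.
Proof.
move=> p q pR qR e; have [Rp p1 p2] := region_pos pR; have [Rq q1 q2] := region_pos qR.
have e1 : lab (inl (p.2 : nat)) = lab (inl (q.2 : nat)) by rewrite -!arc_of1 // e.
have e2 : lab (inr (p.1 : nat)) = lab (inr (q.1 : nat)) by rewrite -!arc_of2 // e.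
rewrite [p]surjective_pairing [q]surjective_pairing; congr (_, _); apply/val_inj => /=.
  have := leq_label_N pi_dominant pi_neq1 p1 q1; have := leq_label_N pi_dominant pi_neq1 q1 p1.
  by rewrite e2 ltnn; clear; lia.
have := leq_label_E pi_dominant pi_neq1 p2 q2; have := leq_label_E pi_dominant pi_neq1 q2 p2.
by rewrite e1 ltnn; clear; lia.
Qed.

Lemma arc_of_arcs p : p \in region pi -> arc_of p \in arcs S K.
Proof.
move=> pR; have [Rp p1 p2] := region_pos pR; rewrite inE arc_of1 // arc_of2 // label_E_lt_N //=.
apply/andP; split; first by apply/is_E_labelP; exists p.2; rewrite // arc_of1.
by apply/is_N_labelP; exists p.1; rewrite // arc_of2.
Qed.

Lemma arc_of_onto e : e \in arcs S K -> exists2 p, p \in region pi & arc_of p = e.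
Proof.
rewrite inE => /and3P[lt /is_E_labelP[b bW eb] /is_N_labelP[a aH ea]].
have Rab : R a b by rewrite -(label_region pi_dominant pi_neq1 aH bW) eb ea.
have [p pR [p1 p2]] := is_crossP _ _ _ Rab; exists p => //.
rewrite [LHS]surjective_pairing [RHS]surjective_pairing; congr (_, _); apply: val_inj.
  by rewrite [LHS]arc_of1 // p2.
by rewrite [LHS]arc_of2 // p1.
Qed.

Lemma core_region_sub : core_region pi \subset region pi.
Proof. exact: finset.subsetUl. Qed.

Lemma mem_core_region p : (p \in core_region pi) = (p \in region pi) && (arc_of p != (lo, hi)).
Proof.
have n0 : 0 < n by apply: leq_ltn_trans (ltn_ord p.1).
pose o : pos n := (Ordinal n0, Ordinal n0).
have oR : o \in region pi by rewrite !inE orbT.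
have ao : arc_of o = (lo, hi).
  rewrite [LHS]surjective_pairing; congr (_, _); apply: val_inj.
    by rewrite [LHS]arc_of1 // label_E0.
  by rewrite [LHS]arc_of2 // label_N0.
have nco : o \notin core_region pi.
  rewrite -is_cross_pos core_regionE //; apply/negP.
  by case/orP => /(diagram_gt0 pi_dominant) [].
apply/idP/andP => [pc|[pR ne]].
  have pR := fintype.subsetP core_region_sub _ pc; split=> //; rewrite -ao.
  by apply: contra nco => /eqP/arc_of_inj <-.
move: pR; rewrite /region finset.in_setU => /orP[//|]; rewrite inE => /eqP[e1 e2].
by case/eqP: ne; rewrite -ao [p]surjective_pairing; congr (arc_of (_, _)); apply: val_inj.
Qed.

Lemma box_compatible_imset F : F \subset region pi ->
  compatible_arcs S K (arc_of @: F) = box_compatible pi F.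
Proof.
move=> /fintype.subsetP FR; rewrite /compatible_arcs.
have -> : arc_of @: F \subset arcs S K.
  by apply/fintype.subsetP => _ /imsetP[p pF ->]; apply: arc_of_arcs; apply: FR.
apply/compatibleP/box_compatibleP => h.
  by move=> p q pF qF; rewrite -arc_of_conflict ?FR // h ?finset.imset_f.
by move=> _ _ /imsetP[p pF ->] /imsetP[q qF ->]; rewrite arc_of_conflict ?FR // h.
Qed.

Lemma bottom_region : bottom_pd pi \subset region pi.
Proof. by apply: fintype.subset_trans core_region_sub; apply: finset.subsetUl. Qed.

(** Boxes outside the region are in no conflict, so a box whose arc is compatible with the image of
    F can be added to F. *)
Lemma maximal_box_face_imset F : maxset (box_face pi) F ->
  maxset (compatible_arcs S K) (arc_of @: (F :&: region pi)).
Proof.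
case/maxsetP => /andP[sF cF] maxF; have cF' := box_compatibleP _ _ cF.
apply/maxsetP; split.
  rewrite box_compatible_imset ?finset.subsetIr //; apply/box_compatibleP => p q.
  by move=> /finset.setIP[pF _] /finset.setIP[qF _]; apply: cF'.
move=> E /andP[/fintype.subsetP sE /compatibleP cE] /fintype.subsetP FE.
apply/eqP; rewrite finset.eqEsubset; apply/andP; split; last exact/fintype.subsetP.
apply/fintype.subsetP => e eE; have [p pR ep] := arc_of_onto (sE e eE); subst e.
apply: finset.imset_f; rewrite inE pR andbT.
have nc q : q \in F -> ~~ box_conflict pi p q && ~~ box_conflict pi q p.
  move=> qF; have [qR|qR] := boolP (q \in region pi).
    have qE : arc_of q \in E by apply: FE; apply: finset.imset_f; rewrite inE qF.
    by rewrite -!arc_of_conflict // !cE.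
  apply/andP; split; apply: contra qR => /(conflict_core_region pi_dominant)[h1 h2];
    exact: (fintype.subsetP core_region_sub).
have pt : p \in triangle n.
  have [pc|pc] := boolP (p \in core_region pi).
    exact: (fintype.subsetP (core_region_triangle pi_dominant)).
  move: pR; rewrite /region finset.in_setU (negPf pc) /= inE => /eqP[e1 e2]; rewrite inE e1 e2.
  have /(diagram_triangle pi_dominant) := diagram_1_1 pi_dominant pi_neq1.
  by apply: leq_ltn_trans.
suff cpF : box_face pi (p |: F) by rewrite -(maxF _ cpF (finset.subsetUr _ _)) finset.setU11.
rewrite /box_face finset.subUset finset.sub1set pt sF; apply/box_compatibleP => q r.
rewrite !finset.in_setU1 => /predU1P[->|qF] /predU1P[->|rF]; last exact: cF'.
- by rewrite /box_conflict ltnn.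
- by case/andP: (nc r rF).
- by case/andP: (nc q qF).
Qed.

(* The arcs of a facet span the roots of all arcs, and those of the region     *)
(* minus bottom_pd are linearly independent over Re.                           *)
Lemma box_face_card (Re : realType) F : maxset (box_face pi) F ->
  #|triangle n :\: F| <= #|diagram pi|.
Proof.
move=> mF; have mE := maximal_box_face_imset mF.
set U := F :&: region pi in mE.
have sub : triangle n :\: F \subset region pi :\: U.
  apply/fintype.subsetP => p /finset.setDP[pt pF].
  have pc : p \in core_region pi.
    apply: contraNT pF => pc; have [/andP[sF cF] maxF] := maxsetP mF.
    suff cpF : box_face pi (p |: F) by rewrite -(maxF _ cpF (finset.subsetUr _ _)) finset.setU11.
    rewrite /box_face finset.subUset finset.sub1set pt sF; apply/box_compatibleP => q r.
    have noc q' : ~~ box_conflict pi p q' && ~~ box_conflict pi q' p.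
      by apply/andP; split; apply: contra pc => /(conflict_core_region pi_dominant)[].
    rewrite !finset.in_setU1 => /predU1P[->|qF] /predU1P[->|rF]; last exact: (box_compatibleP _ _ cF).
    - by rewrite /box_conflict ltnn.
    - by case/andP: (noc r).
    - by case/andP: (noc q).
  by rewrite finset.in_setD (fintype.subsetP core_region_sub) // inE (negPf pF).
have cU : #|arc_of @: U| = #|U|.
  apply: card_in_imset => p q /finset.setIP[_ pR] /finset.setIP[_ qR]; exact: arc_of_inj.
pose B := region pi :\: bottom_pd pi.
have BR : B \subset region pi by exact: finset.subsetDl.
have cB : #|arc_of @: B| = #|B|.
  apply: card_in_imset => p q /finset.setDP[pR _] /finset.setDP[qR _]; exact: arc_of_inj.
have compB : compatible_arcs S K (arc_of @: B).
  rewrite box_compatible_imset //; apply/box_compatibleP => p q /finset.setDP[_ pb] /finset.setDP[_ qb].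
  apply: contra qb => /and3P[h1 h2 h3]; rewrite -is_cross_pos bottom_pdE //.
  have [a0 b0] := diagram_gt0 pi_dominant h3.
  exact: (diagram_down pi_dominant h3 a0 (leqnn _) (ltn0Sn _) h2).
have con i j := maximal_connected first_labelE last_labelE first_E_label last_N_label
  (E_or_N_label pi_dominant pi_neq1) i j mE.
have le : #|B| <= #|U|.
  rewrite -cB -cU; case/andP: compB => sB cBB.
  apply: (compatible_card_le_connected Re) => //.
  exact: increasing_sub sB (@increasing_arcs _ _ _).
apply: leq_trans (subset_leq_card sub) _; rewrite -card_bottom_pd //.
have := cardsID (bottom_pd pi) (region pi); rewrite (finset.setIidPr bottom_region) -/B.
move=> e1; have := cardsID U (region pi); rewrite (finset.setIidPr (finset.subsetIr _ _)) => e2.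
by rewrite -(leq_add2l #|U|) e2 -e1 [leqRHS]addnC leq_add2l.
Qed.

Lemma core_faces (Re : realType) F :
  (F \in core pi) = (F \subset core_region pi) && box_compatible pi F.
Proof.
by rewrite (core_box_compatible pi_dominant pi_neq1 (@box_face_card Re)) inE.
Qed.

Lemma arc_of_imset_core F : F \subset core_region pi -> (lo, hi) \notin arc_of @: F.
Proof.
move=> /fintype.subsetP sF; apply/imsetP => -[p /sF]; rewrite mem_core_region => /andP[_ ne] e.
by rewrite -e eqxx in ne.
Qed.

Lemma core_faces_imset (Re : realType) (E : {set 'I_m * 'I_m}) :
  E \in arc_faces S K -> (lo, hi) \notin E -> exists2 F, F \in core pi & E = arc_of @: F.
Proof.
move=> ED nE; pose F := [set p in core_region pi | arc_of p \in E]%SET.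
have EF : E = arc_of @: F.
  apply/setP => e; apply/idP/imsetP => [eE|[p]]; last by rewrite inE => /andP[_ ?] ->.
  have [sE _ _] := arc_facesP ED; have [p pR ep] := arc_of_onto (sE e eE).
  exists p => //; rewrite inE mem_core_region pR ep eE andbT.
  by apply: contraNneq nE => <-.
have sF : F \subset core_region pi by apply/fintype.subsetP => p; rewrite inE => /andP[].
exists F => //; rewrite (core_faces Re) sF -box_compatible_imset ?(fintype.subset_trans sF core_region_sub) //.
by rewrite -EF; rewrite inE in ED.
Qed.

Lemma core_realized (Re : realType) (V := 'rV[Re]_m) (Q : 'I_m * 'I_m -> V) :
  unique_combinations Q (arc_faces S K) ->
  realized_by (core pi)
    [set hull (Q @` [set` F])%classic | F in [set F | F \in arc_faces S K /\ (lo, hi) \notin F]]%classic.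
Proof.
move=> uQ.
have coreP F : F \in core pi -> [/\ F \subset core_region pi, F \subset region pi &
    arc_of @: F \in arc_faces S K].
  rewrite (core_faces Re) => /andP[sF cF]; have sR := fintype.subset_trans sF core_region_sub.
  by rewrite [_ \in arc_faces _ _]inE box_compatible_imset.
have uQ' : unique_combinations (Q \o arc_of) (core pi).
  apply: unique_combinations_imset arc_of_inj _ uQ => F /coreP[_ h1 h2]; by split.
have := unique_combinations_realized uQ'; congr (realized_by _ _).
have imE F : ((Q \o arc_of) @` [set` F] = Q @` [set` arc_of @: F])%classic.
  apply/seteqP; split => x /=.
    by move=> [p pF <-]; exists (arc_of p) => //; apply: finset.imset_f.
  by move=> [e /imsetP[p pF ->] <-]; exists p.
apply/seteqP; split => s /=.
  move=> [F FC <-]; have [sF _ FD] := coreP F FC; exists (arc_of @: F); last by rewrite imE.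
  by split=> //; apply: arc_of_imset_core.
move=> [E [ED nE] <-]; have [F FC ->] := core_faces_imset Re ED nE.
by exists F; rewrite // imE.
Qed.

(** * Recognizing the permutation 1 m ... 2 from its labels *)

Lemma increasing_gap (f : nat -> nat) N : (forall b b', b < b' -> b' < N -> f b < f b') ->
  forall b b', b <= b' -> b' < N -> f b + (b' - b) <= f b'.
Proof.
move=> inc b b' /subnKC <-; rewrite addKn; elim: (b' - b) => [|k IH]; first by rewrite !addn0.
rewrite !addnS => h; apply: leq_ltn_trans (inc _ _ (ltnSn _) h).
by apply: IH; apply: ltnW.
Qed.

Lemma num_labels_gt1 : 1 < m.
Proof. by have := first_neq_last; rewrite -val_eqE /=; move: m_gt0; clear; lia. Qed.

Let gapE b b' : b <= b' -> b' < W -> lab (inl b) + (b' - b) <= lab (inl b').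
Proof. by apply: (increasing_gap (f := fun b => lab (inl b))) => x y; apply: label_E_lt. Qed.

Let gapN a a' : a' <= a -> a < H 0 -> lab (inr a) + (a - a') <= lab (inr a').
Proof.
move=> aa aH; have := increasing_gap (f := fun k => m - lab (inr k)) (N := H 0) _ aa aH.
have h1 := label_N_lt_m pi_dominant pi_neq1 aH.
have h2 := label_N_lt_m pi_dominant pi_neq1 (leq_ltn_trans aa aH).
have mono x y : x < y -> y < H 0 -> m - lab (inr x) < m - lab (inr y).
  move=> xy yH; have := label_N_lt pi_dominant pi_neq1 xy yH.
  by have := label_N_lt_m pi_dominant pi_neq1 (ltn_trans xy yH); clear; lia.
by move=> /(_ mono); clear -h1 h2; lia.
Qed.

Lemma last_E_lt : lab (inl W.-1) < m.-1.
Proof.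
rewrite -(label_N0 pi_dominant pi_neq1) label_E_lt_N // -row_lengthE // prednK //; exact: W0.
Qed.

Lemma last_N_gt : 0 < lab (inr (H 0).-1).
Proof.
rewrite -{1}(label_E0 pi_dominant pi_neq1) label_E_lt_N // -col_heightE // prednK //; exact: H0.
Qed.

Lemma width_le : W <= m.-1 /\ H 0 <= m.-1.
Proof.
have w0 := W0; have h0 := H0; have l1 := last_E_lt; have l2 := last_N_gt.
have g1 := gapE (leq0n W.-1) _; have g2 := gapN (leq0n (H 0).-1) _.
rewrite label_E0 // label_N0 // in g1 g2.
by move: (g1 ltac:(by rewrite prednK)) (g2 ltac:(by rewrite prednK)); clear -w0 h0 l1 l2; lia.
Qed.

Lemma label_E_id b : W = m.-1 -> b < W -> lab (inl b) = b.
Proof.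
move=> Wm bW; have l1 := last_E_lt; have w0 := W0.
have h1 : b <= W.-1 by rewrite -ltnS prednK.
have h2 : W.-1 < W by rewrite prednK.
have := gapE h1 h2; have := gapE (leq0n b) bW; rewrite label_E0 //.
by clear -l1 Wm bW w0; lia.
Qed.

Lemma label_N_opp a : H 0 = m.-1 -> a < H 0 -> lab (inr a) = m.-1 - a.
Proof.
move=> Hm aH; have l1 := last_N_gt; have h0 := H0.
have h1 : a <= (H 0).-1 by rewrite -ltnS prednK.
have h2 : (H 0).-1 < H 0 by rewrite prednK.
have := gapN h1 h2; have := gapN (leq0n a) aH; rewrite label_N0 //.
by clear -l1 Hm aH h0; lia.
Qed.

Lemma reversed_diagram (w : 'S_n) k : k <= n -> (forall i : 'I_n, w i = one_reversed k i :> nat) ->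
  forall a b, is_cross (diagram w) a b = [&& 0 < a, 0 < b & a + b < k].
Proof.
move=> kn wE a b; have [an|an] := ltnP a n; last first.
  by apply/idP/and3P => [/is_cross_bound[]|[_ b0]]; clear -kn an; lia.
have [bn|bn] := ltnP b n; last first.
  by apply/idP/and3P => [/is_cross_bound[]|[a0 _]]; clear -kn bn; lia.
have wV (i : 'I_n) : (w^-1)%g i = w i.
  apply: (@perm_inj _ w); rewrite permKV; apply: val_inj.
  by rewrite /= wE wE /one_reversed; clear; case: ifP; case: ifP; lia.
rewrite (is_crossE _ an bn) mem_diagram wV !wE /= /one_reversed.
by clear; case: ifP; case: ifP; lia.
Qed.

(** E labels are distinct and below m - 1, N labels distinct and positive. If the inner labels are
    of both kinds, there are m - 1 of each, column b has label b and row a has label m - 1 - a, and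
    D is the staircase a + b < m, which determines pi by [diagram_inj]. Conversely the staircase has
    these labels. *)
Lemma inner_labelsP : (forall x, x != lo -> x != hi -> S x && K x) <->
  extend pi =1 one_reversed m.
Proof.
have m1 := num_labels_gt1; have D11 := diagram_1_1 pi_dominant pi_neq1.
have [Wm Hm] := width_le.
split=> [inner|rev].
  have We : W = m.-1.
    apply/eqP; rewrite eqn_leq Wm /=.
    have <- : size [seq lab (inl b) | b <- iota 0 W] = W by rewrite size_map size_iota.
    rewrite -[leqLHS](size_iota 0); apply: uniq_leq_size; first exact: iota_uniq.
    move=> i; rewrite mem_iota add0n => im.
    have im' : i < m by apply: leq_trans im (leq_pred _).
    have : S (Ordinal im').
      have [->|nlo] := eqVneq (Ordinal im') lo; first exact: first_E_label.
      have nhi : Ordinal im' != hi by rewrite -val_eqE /= ltn_eqF.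
      by case/andP: (inner _ nlo nhi).
    move=> /is_E_labelP[b bW eb]; apply/mapP; exists b; by rewrite ?mem_iota ?eb.
  have He : H 0 = m.-1.
    apply/eqP; rewrite eqn_leq Hm /=.
    have <- : size [seq lab (inr a) | a <- iota 0 (H 0)] = H 0 by rewrite size_map size_iota.
    rewrite -[leqLHS](size_iota 1); apply: uniq_leq_size; first exact: iota_uniq.
    move=> i; rewrite mem_iota add1n prednK // => /andP[i0 im].
    have : K (Ordinal im).
      have [->|nhi] := eqVneq (Ordinal im) hi; first exact: last_N_label.
      have nlo : Ordinal im != lo by rewrite -val_eqE /= -lt0n.
      by case/andP: (inner _ nlo nhi).
    move=> /is_N_labelP[a aH ea]; apply/mapP; exists a; by rewrite ?mem_iota ?ea.
  have DE a b : D a b = [&& 0 < a, 0 < b & a + b < m].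
    apply/idP/and3P => [Dab|[a0 b0 ab]].
      have [a0 b0 aH bW] := diagram_bounds pi_dominant pi_neq1 Dab; split=> //.
      move: Dab; rewrite -label_E_le_N // label_E_id // label_N_opp //.
      by clear -aH He m1; lia.
    have aH : a < H 0 by rewrite He; clear -b0 ab; lia.
    have bW : b < W by rewrite We; clear -a0 ab; lia.
    by rewrite -label_E_le_N // label_E_id // label_N_opp //; clear -ab; lia.
  have m3 : 2 < m by move: D11; rewrite DE.
  have mn : m <= n.
    have : D 1 m.-2 by rewrite DE; clear -m3; lia.
    by move/(diagram_triangle pi_dominant); clear -m3; lia.
  have rev_lt (i : 'I_n) : one_reversed m i < n.
    by rewrite /one_reversed; have := ltn_ord i; clear -mn; case: ifP; lia.
  pose f (i : 'I_n) := Ordinal (rev_lt i).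
  have f_inj : injective f.
    move=> i j [] e; apply: val_inj; move: e; rewrite /= /one_reversed.
    by clear; case: ifP; case: ifP; lia.
  have wpi : pi = perm f_inj.
    apply: diagram_inj; apply/setP => p; rewrite -!is_cross_pos DE.
    by rewrite (@reversed_diagram _ m) // => i; rewrite permE.
  have piE j : pi j = f j := etrans (congr1 (fun s : 'S_n => s j) wpi) (permE f_inj j).
  move=> i; rewrite /extend; case: insubP => [j _ <-|]; first by rewrite piE.
  by rewrite -leqNgt /one_reversed => h; clear -h mn; case: ifP; lia.
have n1 : 1 < n by have [] := is_cross_bound D11.
have piE (i : 'I_n) : pi i = one_reversed m i :> nat by rewrite -rev /extend valK.
have mn : m <= n.
  have := ltn_ord (pi (Ordinal n1)); rewrite piE /one_reversed /= m1; clear -m1; lia.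
have DE := reversed_diagram mn piE.
have We : W = m.-1.
  apply/eqP; rewrite eqn_leq Wm /= -(prednK (n := m.-1)); last by clear -m1; lia.
  rewrite row_lengthE // regionE // !DE; clear -m1.
  by case: m m1 => [|[|[|k]]] //= _; rewrite ?orbT //=; lia.
have He : H 0 = m.-1.
  apply/eqP; rewrite eqn_leq Hm /= -(prednK (n := m.-1)); last by clear -m1; lia.
  rewrite col_heightE // regionE // !DE; clear -m1.
  by case: m m1 => [|[|[|k]]] //= _; rewrite ?orbT //=; lia.
move=> x xlo xhi; have xm := ltn_ord x.
have x0 : 0 < x by rewrite lt0n; apply: contra xlo => /eqP e; rewrite -val_eqE /= e.
have xW : x < m.-1.
  by rewrite ltn_neqAle -ltnS prednK // xm andbT; apply: contra xhi => /eqP e; rewrite -val_eqE /= e.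
apply/andP; split; first by apply/is_E_labelP; exists x; rewrite ?We // label_E_id ?We.
apply/is_N_labelP; exists (m.-1 - x); first by rewrite He; clear -x0 xW; lia.
rewrite label_N_opp //; last by rewrite He; clear -x0 xW; lia.
by clear -xW; lia.
Qed.

End BoxesAndArcs.

Unset Implicit Arguments.
Local Open Scope ring_scope.

Theorem theorem4p4 (R : realType) (n : nat) (pi : 'S_n)
    (pi_dominant : one_dominant pi) (pi_neq1 : pi != 1%g)
    (u : 'rV[R]_(num_labels pi)) (c : R)
    (uc_separates : separates_0 (tree_edges pi) u c) :
  exists v : 'rV[R]_(num_labels pi),
    unique (vertex_on_long_ray u c) v /\
    (~ (extend pi =1 one_reversed (num_labels pi)) ->
       boundary_complex (C_complex u c) [set v]%classic /\
       (forall eps : R, 0 < eps <= 1 ->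
          realized_by (core pi) (vertex_figure_at (C_complex u c) v eps))) /\
    (extend pi =1 one_reversed (num_labels pi) ->
       realized_by (core pi) (boundary_complex (C_complex u c))).
Proof.
set lo := first_label pi_dominant pi_neq1; set hi := last_label pi_dominant pi_neq1.
have lo0 : lo = 0%N :> nat by [].
have him : hi = (num_labels pi).-1 :> nat by [].
have lohi : lo != hi := first_neq_last pi_dominant pi_neq1.
have Slo := first_E_label pi_dominant pi_neq1.
have Khi := last_N_label pi_dominant pi_neq1.
have SK := E_or_N_label pi_dominant pi_neq1.
have TE := trans_closure_tree_edges pi_dominant pi_neq1.
have uQ := arc_vertex_unique TE uc_separates.
have CE := section_arc_faces lo0 him Slo Khi SK TE uc_separates.
exists (arc_vertex u c (lo, hi)); split; [split|split].
- split.
    rewrite -(long_face_hull _ _ u c) /C_complex CE; exists [set (lo, hi)]%SET => //.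
    exact: long_face lohi Slo Khi.
  exists (c / dot u (Defs.root R (num_labels pi) lo hi)); last by [].
  have e0G : (lo, hi) \in arcs (is_E_label (pi := pi)) (is_N_label (pi := pi)).
    exact: long_arc_arcs.
  by rewrite Num.Theory.divr_ge0 // Order.POrderTheory.ltW // ?(c_gt0 uc_separates) // (dot_root_gt0 TE uc_separates e0G).
- move=> w [wC [t _ wt]].
  exact: (long_vertex_unique lo0 him lohi Slo Khi SK TE uc_separates wC wt).
- move=> nrev; split.
    have [x [xlo xhi nSK]] : exists x, [/\ x != lo, x != hi & ~~ (is_E_label x && is_N_label x)].
      apply/not_existsP => none; apply: nrev; apply/(inner_labelsP pi_dominant pi_neq1) => x xlo xhi.
      by apply/negPn/negP => h; apply: (none x).
    exact: (long_vertex_boundary lo0 him lohi Slo Khi SK TE uc_separates xlo xhi nSK).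
  move=> eps /andP[eps0 _]; rewrite /vertex_figure_at /C_complex.
  rewrite (linkE lo0 him lohi Slo Khi SK TE uc_separates).
  have eps_neq0 : eps != 0 by rewrite Order.POrderTheory.gt_eqF.
  (* A homothety preserves uniqueness of combinations, so the link shrunk towards v still realizes
     the core. *)
  have := core_realized pi_dominant pi_neq1 (unique_combinations_homothety (v := arc_vertex u c (lo, hi)) eps_neq0 uQ).
  congr (realized_by _ _); apply/seteqP; split => s /=.
    move=> [F FD <-]; exists (hull (arc_vertex u c @` [set` F])%classic); first by exists F.
    by rewrite homothety_hull.
  by move=> [_ [F FD <-] <-]; exists F; rewrite // homothety_hull.
- move=> /(inner_labelsP pi_dominant pi_neq1) inner; rewrite /C_complex.
  rewrite (boundaryE lo0 him lohi Slo Khi SK TE uc_separates inner).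
  exact: (core_realized pi_dominant pi_neq1 uQ).
Qed.
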